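(* Let $(P_n)_{n\ge 0}$ be polynomials, $P_n$ of degree $n$, with $P_0(x)=1$, satisfying the differential-difference equation $$P_{n+1}(x)=A_{n}(x)P_{n}^{\prime}(x)+B_{n}(x)P_{n}(x),\qquad n\geq0,$$ where $A_n$ and $B_n$ are polynomials of degree at most $2$ and $1$ respectively. Assume that the zeros $x_{1,n}\le\dots\le x_{n,n}$ of $P_n$ are real and interlace, i.e. $x_{k,n}\leq x_{k,n-1}\leq x_{k+1,n}$ for $1\leq k\leq n-1$ and all $n\ge 2$. Let $\phi(n)$ be a positive (weakly) increasing sequence, either tending to $\infty$ or constant, and $\alpha\le\beta$ real numbers with $x_{k,n}/\phi(n)\in[\alpha,\beta]$ for all $1\le k\le n$, $n\in\mathbb{N}$. Put $\alpha^*=\min\{0,\alpha\}$, $\beta^*=\max\{0,\beta\}$ if $\phi(n)\to\infty$, and $\alpha^*=\alpha$, $\beta^*=\beta$ if $\phi$ is constant. Suppose that $\phi(n)=n^{\sigma}L(n)$ is regularly varying with $\sigma\ge 0$, and that the limits $$\lim_{n\rightarrow\infty}\frac{n}{\phi^{2}(n)}A_{n}(\phi(n)x)=a(x),\qquad \lim_{n\rightarrow\infty}\frac{1}{\phi(n)}B_{n}(\phi(n)x)=b(x)$$ exist. For an infinite set $\Lambda\subset\mathbb{N}$ along which the limit exists, uniformly for $t\in[0,1]$ and $x$ in compact subsets of $\mathbb{C}\setminus[\alpha^*,\beta^*]$, let $$f_{\Lambda}(t,x)=\lim_{n\rightarrow\infty,\,n\in\Lambda}\frac{\phi(n)}{n}\,\frac{P_{[nt]}^{\prime}(\phi(n)x)}{P_{[nt]}(\phi(n)x)}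 .$$ Then $f_\Lambda=f$ is independent of the subsequence $\Lambda$, and it satisfies, for $s\in[0,1]$ and $x\in\mathbb{C}\setminus[\alpha^*,\beta^*]$, $$f(s,x)=\int_{0}^{s}\frac{\frac{d}{dx}\left[t^{2\sigma-1}a(xt^{-\sigma})f(t,x)+t^{\sigma}b(xt^{-\sigma})\right]}{t^{2\sigma-1}a(xt^{-\sigma})f(t,x)+t^{\sigma}b(xt^{-\sigma})}\,dt,$$ with $f(0,x)=0$ and $$\lim_{x\rightarrow\infty}x f(s,x)=s .$$
   Context: $\mathbb{N}=\{1,2,\dots\}$ and $[nt]$ denotes the integer part (floor) of $nt$. The sequence $\phi(n)=n^\sigma L(n)$ is regularly varying if $\lim_{n\to\infty}L([nt])/L(n)=1$ for every $t\in(0,1]$. The limits defining $a$ and $b$ are taken for every $x$; $a$ and $b$ are polynomials of degree at most $2$ and $1$ respectively.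
   Formalization: The formal theorem also assumes that the coefficient of x^2 in a plus the coefficient of x in b is nonzero; otherwise the denominator in the integral equation vanishes identically and f_Λ may depend on Λ (e.g. A_n=0, B_n=(x-ξ_n)/(n+1), φ=1). *)

(* Defs.v *)
From HB Require Import structures.
From mathcomp Require Export all_boot all_order all_algebra.
From mathcomp Require Export complex.
From mathcomp Require Export all_classical all_reals all_analysis.

Set Implicit Arguments.
Unset Strict Implicit.
Unset Printing Implicit Defensive.

Export Order.TTheory GRing.Theory Num.Def Num.Theory.
Export numFieldNormedType.Exports.

Global Open Scope classical_set_scope.
Global Open Scope complex_scope.
Global Open Scope ring_scope.

(* [R[i]^o] is [R[i]] with its topology, norm and structure of normed space
   over itself, so that [_^`()] below is complex differentiation. *)

Section Definitions.
Context {R : realType}.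
Local Notation C := (R[i]^o).

(* The zeros of [p], of degree [n], listed with multiplicity, are the real
   numbers [x 1 <= ... <= x n]. *)
Definition ordered_real_zeros (n : nat) (p : {poly R[i]}) (x : nat -> R) :=
  [/\ size p = n.+1,
      p = lead_coef p *: \prod_(1 <= k < n.+1) ('X - ((x k)%:C)%:P) &
      forall k, (1 <= k < n)%N -> x k <= x k.+1].

(* Sequences are indexed by n >= 1; the value at 0 is irrelevant. *)
Definition regularly_varying (sigma : R) (phi L : nat -> R) :=
  (forall n, (0 < n)%N -> phi n = n%:R `^ sigma * L n) /\
  (forall t : R, 0 < t <= 1 ->
     L (truncn (n%:R * t)) / L n @[n --> \oo] --> (1 : R)).

Definition real_segment (a b : R) : set C := [set r%:C | r in `[a, b]].

Definition rescaled_log_deriv (P : nat -> {poly R[i]}) (phi : nat -> R)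
    (n : nat) (tx : R * C) : C :=
  let m := truncn (n%:R * tx.1) in
  let y : R[i] := (phi n)%:C * tx.2 in
  (phi n / n%:R)%:C * ((P m)^`().[y] / (P m).[y]).

Definition limit_along (P : nat -> {poly R[i]}) (phi : nat -> R)
    (I : set C) (Lambda : set nat) (f : R -> C -> C) :=
  forall K : set C, compact K -> K `<=` ~` I ->
    {uniform `[0, 1] `*` K,
       rescaled_log_deriv P phi @ within Lambda \oo --> (fun tx => f tx.1 tx.2)}.

(* t^(2 sigma - 1) a(x t^(-sigma)) f(t, x) + t^sigma b(x t^(-sigma)) *)
Definition denominator (a b : {poly R[i]}) (sigma : R) (f : R -> C -> C)
    (t : R) (x : C) : C :=
  let y : R[i] := x * (t `^ (- sigma))%:C in
  (t `^ (2 * sigma - 1))%:C * a.[y] * f t x + (t `^ sigma)%:C * b.[y].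

Definition integrand (a b : {poly R[i]}) (sigma : R) (f : R -> C -> C)
    (t : R) (x : C) : C :=
  ((denominator a b sigma f t)^`())%classic x / denominator a b sigma f t x.

(* Complex-valued functions of a real variable are integrated componentwise. *)
Definition cintegrable (D : set R) (g : R -> C) :=
  lebesgue_measure.-integrable D (fun t => (complex.Re (g t))%:E) /\
  lebesgue_measure.-integrable D (fun t => (complex.Im (g t))%:E).

Definition cintegral (D : set R) (g : R -> C) : C :=
  (\int[lebesgue_measure]_(t in D) complex.Re (g t) +i*
   \int[lebesgue_measure]_(t in D) complex.Im (g t)).

(* Neighbourhoods of the point at infinity of the complex plane. *)
Definition cinfty_nbhs : set_system C :=
  [set U | exists M : R, forall x : C, M%:C < `|x| -> U x].

End Definitions.

(* Main.v *)
Require Import Defs.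
From mathcomp Require Import ring lra zify.

(** Let X n be the zeros of P n divided by phi n, and Y n the zeros of P n.+1
    divided by the same phi n. Dividing the recurrence by the ratio of leading
    coefficients, whose limit is lambda = a_2 + b_1, gives
<<
      p_Y = (A_n / n) p_X' + B_n p_X,    A_n -> a, B_n -> b,
>>
    for the monic polynomials p_X and p_Y with these zeros (monic_step), where a
    and b have been divided by lambda; the zeros being real, the same holds with the
    real parts of the coefficients (real_step). The theorem follows once the empirical
    measures of X n are known to converge along the whole sequence.

    Moments. Newton's identities express the increments D_K, the sums of y ^ K over
    Y n minus the sums of x ^ K over X n, through the moments M_K, the means of
    x ^ K over X n (newton1, newtonSS). On the other hand n phi(n) ^ K M_K is, up to
    a constant, the sum of phi(j) ^ K D_K(j) over j < n, and by Karamata's theorem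
    the sum of the weights is asymptotic to n phi(n) ^ K / (1 + K sigma) (karamata).
    Together they give a drift equation for M_K with constant K (a_2 + sigma) + 1 and a source made of
    lower moments. By induction (tracking, moment_all) the zeros are always
    self-similar, D_K - (1 + K sigma) M_K -> 0, and M_K converges if its drift
    constant is positive. This settles the case a_2 + sigma >= 0.

    If a_2 + sigma < 0, interlacing enters. It forces A_n <= 0 at the zeros
    (interlaced_sign), and Newton's identities then become inequalities (step_ineq).
    Tested on high powers they bound a convex quadratic polynomial, the drift, by 0
    at both ends of the support of any limit measure; hence the mean of the drift is
    nonpositive as well, which is possible for a point mass only (variance_le0). The
    position of this mass solves a quadratic equation and moves slowly, so it
    converges, and all moments with it (moment_cvg).

    Stieltjes transforms. Off the segment, 1 / (z - y) is a C^1-limit of polynomials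
    in y (inv_papprox). So its mean over X n converges to a function G(z), and its
    increment converges to Q = G - sigma (z G)' (cincr_cvg); interlacing
    bounds the variation of the error independently of n. The quotient
    p_Y(z) / p_X(z) equals A_n times the mean of 1 / (z - x) plus B_n, so it converges
    to D = a G + b. Interlacing keeps D from vanishing, and Q is the limit of the
    logarithmic derivatives of the quotient, whence D' = D Q (ratio_limit_deriv).

    The limit function. The zeros of P_[nt] on the scale phi n are X_[nt] dilated
    by phi [nt] / phi n, which tends to t ^ sigma. Therefore
    f(t, z) = t ^ (1 - sigma) G(z t ^ (- sigma)), whatever the subsequence
    (rescaled_log_deriv_cvg). The denominator of the integrand is
    lambda t ^ sigma D(z t ^ (- sigma)), the integrand is t ^ (- sigma) Q(z t ^ (- sigma))
    by D' = D Q, and this is the t-derivative of f (integrandE, transform_ftc). *)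

Set Implicit Arguments.
Unset Strict Implicit.
Unset Printing Implicit Defensive.

(** * Newton identities for one step of the recurrence *)

Section PowerSums.
Variable R : fieldType.
Implicit Types (s x y : seq R) (P Q S T : {poly R}).

Definition psum (k : nat) s : R := \sum_(a <- s) a ^+ k.

Definition roots_poly s : {poly R} := \prod_(a <- s) ('X - a%:P).

(** The reversed polynomial: in the variable u = 1 / z the recurrence becomes an
    identity between formal power series. *)
Definition recip_poly s : {poly R} := \prod_(a <- s) (1 - a *: 'X).

Lemma horner_roots_poly s z : (roots_poly s).[z] = \prod_(a <- s) (z - a).
Proof. by rewrite /roots_poly horner_prod; apply: eq_bigr => a _; rewrite !hornerE. Qed.

Lemma log_deriv_roots_poly s z : z \notin s ->
  (roots_poly s)^`().[z] = (roots_poly s).[z] * \sum_(a <- s) (z - a)^-1.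
Proof.
elim: s => [|a s IH] zs; first by rewrite /roots_poly !big_nil derivC !hornerE.
move: zs; rewrite inE negb_or => /andP[za zs].
rewrite /roots_poly !big_cons derivM !hornerE /= -/(roots_poly s) derivXsubC hornerC mul1r IH//.
by field; rewrite subr_eq0.
Qed.

Definition eqmodX N P Q := forall i, (i < N)%N -> P`_i = Q`_i.

Lemma eqmodXMl N P Q S : eqmodX N P Q -> eqmodX N (S * P) (S * Q).
Proof.
move=> PQ i iN; rewrite !coefM; apply: eq_bigr => j _.
by rewrite PQ// (leq_ltn_trans (leq_subr _ _)).
Qed.

Lemma eqmodXD N P Q S T : eqmodX N P Q -> eqmodX N S T -> eqmodX N (P + S) (Q + T).
Proof. by move=> h h' i iN; rewrite !coefD h// h'. Qed.

Lemma eqmodXB N P Q S T : eqmodX N P Q -> eqmodX N S T -> eqmodX N (P - S) (Q - T).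
Proof. by move=> h h' i iN; rewrite !coefB h// h'. Qed.

Lemma eqmodX_sym N P Q : eqmodX N P Q -> eqmodX N Q P.
Proof. by move=> h i iN; rewrite h. Qed.

Lemma eqmodX_trans N P Q S : eqmodX N P Q -> eqmodX N Q S -> eqmodX N P S.
Proof. by move=> h h' i iN; rewrite h// h'. Qed.

Lemma eqmodX_deriv N P Q : eqmodX N P Q -> eqmodX N ('X * P^`()) ('X * Q^`()).
Proof.
by move=> h [|i] iN; rewrite !coefXM//= !coef_deriv h.
Qed.

Lemma eqmodX_cancel N P Q S : S`_0 != 0 ->
  eqmodX N (S * P) (S * Q) -> eqmodX N P Q.
Proof.
move=> S0 h i; elim/ltn_ind: i => i IH iN.
have := h i iN; rewrite !coefM !big_ord_recl /= !subn0.
rewrite (eq_bigr (fun j : 'I_i => S`_(bump 0 j) * Q`_(i - bump 0 j))); last first.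
  move=> j _; have ji := ltn_ord j.
  by rewrite IH // /bump; lia.
by move/addIr/(mulfI S0).
Qed.

Lemma recip_poly0 s : (recip_poly s)`_0 = 1.
Proof.
rewrite -horner_coef0 /recip_poly horner_prod big1 // => a _.
by rewrite !hornerE ?mulr0 ?subr0.
Qed.

(** A formal logarithmic derivative: the power sums of s are the coefficients of
    size s - u P' / P, with P the reversed polynomial. *)
Lemma recip_psum N s :
  eqmodX N (recip_poly s * \poly_(k < N) psum k s)
           ((size s)%:R *: recip_poly s - 'X * (recip_poly s)^`()).
Proof.
elim: s => [|a s IH] i iN.
  by rewrite /recip_poly !big_nil derivC mulr0 scale0r subr0 mul1r coef_poly iN /psum big_nil coef0.
have E : \poly_(k < N) psum k (a :: s) = \poly_(k < N) a ^+ k + \poly_(k < N) psum k s.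
  by apply/polyP => j; rewrite coefD !coef_poly; case: ifP => _; rewrite ?addr0// /psum big_cons.
have G : eqmodX N ((1 - a *: 'X) * \poly_(k < N) a ^+ k) 1.
  move=> j jN; rewrite mulrBl mul1r -scalerAl coefB coefZ coefXM !coef_poly jN coef1.
  case: j jN => [|j] jN /=; first by rewrite mulr0 subr0.
  by rewrite (ltnW jN) exprS subrr.
rewrite /recip_poly big_cons -/(recip_poly s) E mulrDr derivM.
set Q := recip_poly s in IH *; set L := 1 - a *: 'X in G *.
have -> : L^`() = - a%:P by rewrite derivB derivC derivZ derivX sub0r -alg_polyC.
have h1 := eqmodXMl Q G; have h2 := eqmodXMl L IH.
have := eqmodXD h1 h2 iN; rewrite mulr1.
rewrite (_ : Q * (L * _) = L * Q * \poly_(k < N) a ^+ k); last by ring.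
rewrite (_ : L * (Q * _) = L * Q * \poly_(k < N) psum k s); last by ring.
move=> ->; congr ((polyseq _)`_i).
rewrite /= -natr1 -!mul_polyC polyCD /L -!mul_polyC.
by move: (size s)%:R (Q^`()) => c Q'; ring.
Qed.

Lemma horner_recip_poly s u : u != 0 ->
  (recip_poly s).[u] = u ^+ size s * (roots_poly s).[u^-1].
Proof.
move=> u0; rewrite /recip_poly horner_prod horner_roots_poly.
elim: s => [|a s IH]; first by rewrite !big_nil /= mulr1.
rewrite !big_cons IH /= exprS !hornerE /=; field.
exact: u0.
Qed.

Lemma horner_recip_deriv s u : u != 0 ->
  u * ((size s)%:R *: recip_poly s - 'X * (recip_poly s)^`()).[u] =
  u ^+ size s * (roots_poly s)^`().[u^-1].
Proof.
move=> u0; elim: s => [|a s IH].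
  by rewrite /recip_poly /roots_poly !big_nil derivC mulr0 scale0r subr0 !horner0 !mulr0.
have := horner_recip_poly s u0; move: IH.
rewrite /recip_poly /roots_poly !big_cons !derivM -/(recip_poly s) -/(roots_poly s).
rewrite derivXsubC derivB derivC derivZ derivX sub0r !hornerE /= -natr1.
move: (recip_poly s).[u] (roots_poly s).[u^-1] (recip_poly s)^`().[u] (roots_poly s)^`().[u^-1].
move=> P p P' p' h1 h2.
set v := u ^+ size s in h1 h2 *; rewrite exprS -/v.
transitivity (u * (v * p) + (1 - a * u) * (v * p')); last by field.
rewrite -h1 -h2; ring.
Qed.

End PowerSums.

Lemma poly_eq_horner (R : numFieldType) (p q : {poly R}) :
  (forall u, u != 0 -> p.[u] = q.[u]) -> p = q.
Proof.
move=> h; apply/eqP; rewrite -subr_eq0; apply/negPn/negP => d0.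
set d := p - q in d0.
pose rs : seq R := [seq i.+1%:R | i <- iota 0 (size d)].
have : (size rs < size d)%N.
  apply: max_poly_roots => //.
    apply/allP => _ /mapP[i _ ->].
    have u0 : i.+1%:R != 0 :> R by rewrite pnatr_eq0.
    by rewrite /root /d hornerD hornerN h// subrr.
  by rewrite map_inj_uniq ?iota_uniq// => i j /eqP; rewrite eqr_nat => /eqP[].
by rewrite size_map size_iota ltnn.
Qed.

Definition dpsum (R : fieldType) (x y : seq R) k : R := psum k y - psum k x.

Section NewtonStep.
Variable R : numFieldType.
Variables (x y : seq R) (A B : {poly R}).
Hypothesis sizeA : (size A <= 3)%N.
Hypothesis sizeB : (size B <= 2)%N.
Hypothesis sizey : size y = (size x).+1.
Hypothesis step : roots_poly y = A * (roots_poly x)^`() + B * roots_poly x.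

Let n := size x.
Let quad z : A.[z] = A`_0 + A`_1 * z + A`_2 * z ^+ 2.
Proof.
rewrite (horner_coef_wide _ sizeA) !big_ord_recr big_ord0 /= add0r expr0 mulr1 expr1 //.
Qed.
Let lin z : B.[z] = B`_0 + B`_1 * z.
Proof.
rewrite (horner_coef_wide _ sizeB) !big_ord_recr big_ord0 /= add0r expr0 mulr1 expr1 //.
Qed.

(** The recurrence rewritten in u = 1 / z. *)
Lemma recip_step : recip_poly y =
  ((A`_2)%:P + A`_1 *: 'X + A`_0 *: 'X^2) * (n%:R *: recip_poly x - 'X * (recip_poly x)^`())
  + ((B`_1)%:P + B`_0 *: 'X) * recip_poly x.
Proof.
apply: poly_eq_horner => u u0.
rewrite horner_recip_poly// step sizey !hornerD !hornerM quad lin.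
have := horner_recip_deriv x u0; rewrite -/n.
have := horner_recip_poly x u0; rewrite -/n.
set E := (_ - _).[u]; set P := (recip_poly x).[u]; set p := (roots_poly x).[_].
set p' := _^`().[_] => h1 h2.
rewrite h1 !hornerE /= exprS.
have -> : E = u^-1 * (u ^+ n * p') by rewrite -h2; field.
set v := u ^+ n; field.
exact: u0.
Qed.

(** The coefficients of the power series recip_poly y / recip_poly x. *)
Let d k : R := A`_2 * psum k x + (if k is k1.+1 then A`_1 * psum k1 x else B`_1)
  + (match k with 0 => 0 | 1 => B`_0 | k2.+2 => A`_0 * psum k2 x end).
Local Notation Dl := (dpsum x y).

(** Let D be the quotient of the two reversed polynomials. Subtracting their
    logarithmic derivatives gives D * S = D - u D', where S is the generating
    series of the increments; this is the coefficient of u ^ K. *)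
Lemma newton_conv K : \sum_(i < K.+1) d i * Dl (K - i)%N = (1 - K%:R) * d K.
Proof.
pose N := K.+1.
pose S := \poly_(k < N) psum k x; pose S' := \poly_(k < N) psum k y.
pose D := \poly_(k < N) d k.
pose P := recip_poly x; pose Q := recip_poly y.
have hS := @recip_psum _ N x; have hS' := @recip_psum _ N y.
rewrite -/n -/S -/P in hS; rewrite -/S' -/Q sizey -/n in hS'.
have P0 : P`_0 != 0 by rewrite recip_poly0 oner_eq0.
have hD : eqmodX N (((A`_2)%:P + A`_1 *: 'X + A`_0 *: 'X^2) * S + ((B`_1)%:P + B`_0 *: 'X)) D.
  move=> i iN; rewrite !mulrDl -!scalerAl mulrC !coefD coefMC !coefZ !coefXM coefXnM coefC coefX !coef_poly iN /d.
  case: i iN => [|[|i]] iN /=.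
  - by rewrite !mulr0 !addr0 mulrC.
  - by rewrite mulr1 mulr0 addr0 add0r mulrC.
  by rewrite (_ : i.+2 - 2 = i)%N ?(ltnW iN) ?(ltnW (ltnW iN)) ?mulr0 ?addr0 1?mulrC //; lia.
have hQ : eqmodX N Q (P * D).
  rewrite /Q recip_step -/P.
  apply: (@eqmodX_trans _ _ _ (((A`_2)%:P + A`_1 *: 'X + A`_0 *: 'X^2) * (P * S) + ((B`_1)%:P + B`_0 *: 'X) * P)).
    by apply: eqmodXD => //; apply: eqmodXMl; apply: eqmodX_sym.
  rewrite (_ : _ + _ = P * (((A`_2)%:P + A`_1 *: 'X + A`_0 *: 'X^2) * S + ((B`_1)%:P + B`_0 *: 'X))); last by ring.
  exact: eqmodXMl.
have key : eqmodX N (D * (S' - S)) (D - 'X * D^`()).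
  apply: (@eqmodX_cancel _ _ _ _ P) => //.
  have h1 : eqmodX N (P * D * S') (n.+1%:R *: (P * D) - 'X * (P * D)^`()).
    apply: (@eqmodX_trans _ _ _ (Q * S')).
      by rewrite mulrC [Q * _]mulrC; apply: eqmodXMl; apply: eqmodX_sym.
    apply: eqmodX_trans hS' _; apply: eqmodXB; last exact: eqmodX_deriv.
    by rewrite -!mul_polyC; exact: eqmodXMl.
  have h2 : eqmodX N (D * (P * S)) (D * (n%:R *: P - 'X * P^`())) by exact: eqmodXMl.
  have := eqmodXB h1 h2.
  rewrite derivM -!mul_polyC -natr1 polyCD (_ : _ - _ = P * (D * (S' - S))); last by ring.
  by move/eqmodX_trans; apply; move=> i _; congr ((polyseq _)`_i); ring.
have := key K (ltnSn K); rewrite coefB coefXM coefM.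
have -> : \sum_(j < K.+1) D`_j * (S' - S)`_(K - j) = \sum_(i < K.+1) d i * Dl (K - i)%N.
  apply: eq_bigr => i _; rewrite coefB !coef_poly (ltn_ord i).
  by rewrite (leq_ltn_trans (leq_subr _ _))//.
move=> ->; case: K @N @S @S' @D hS hS' hD hQ key => [|K] N S S' D hS hS' hD hQ key /=.
  by rewrite subr0 mulr0n subr0 mul1r coef_poly.
by rewrite coef_deriv coef_poly ltnSn /= mulrBl mul1r mulr_natl.
Qed.

Lemma d_0 : d 0 = 1.
Proof.
have := newton_conv 0; rewrite big_ord_recl big_ord0 addr0 subr0 mul1r /= subn0.
have : (recip_poly y)`_0 = 1 by rewrite recip_poly0.
have P0 : (recip_poly x).[0] = 1 by rewrite horner_coef0 recip_poly0.
rewrite -horner_coef0 recip_step !(hornerD, hornerM, hornerN, hornerZ, hornerX, hornerC, hornerXn) P0.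
rewrite !mulr0 !mul0r ?expr0n /= ?mulr0 !addr0 subr0 !mulr1 => h _.
by rewrite /d /psum big_const_seq count_predT iter_addr_0 addr0.
Qed.

Lemma newton1 : Dl 1 = - (A`_2 * psum 1 x + A`_1 * psum 0 x + B`_0).
Proof.
have := newton_conv 1; rewrite !big_ord_recl big_ord0 /= addr0 subrr mul0r subn0 /bump /= subnn.
rewrite d_0 mul1r (_ : Dl 0 = 1) ?mulr1; last first.
  have := newton_conv 0; rewrite big_ord_recl big_ord0 addr0 subr0 mul1r /= subn0.
  by rewrite d_0 mul1r.
by move/eqP; rewrite addr_eq0 => /eqP.
Qed.

Definition esum_step j : R := \sum_(a <- x) A.[a] * a ^+ j.

Lemma d_SS k : d k.+2 = esum_step k.
Proof.
rewrite /d /esum_step /psum !big_distrr /= -!big_split /=; apply: eq_bigr => a _.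
by rewrite quad !exprS; ring.
Qed.

(** Solving newton_conv for the highest increment, since d 0 = 1 and d j.+2 is the
    sum of A(a) a ^ j over the zeros. *)
Lemma newtonSS K : Dl K.+2 = - K.+2%:R * esum_step K + Dl 1 * Dl K.+1
  - \sum_(i < K) Dl i.+1 * esum_step (K.-1 - i)%N.
Proof.
have := newton_conv K.+2.
rewrite 2!big_ord_recl big_ord_recr /= subn0 d_0 mul1r /bump !leq0n /= !add1n subSS subn0 subnn.
have -> : Dl 0 = 1.
  have := newton_conv 0; rewrite big_ord_recl big_ord0 addr0 subr0 mul1r /= subn0.
  by rewrite d_0 mul1r.
have -> : d 1 = - Dl 1 by rewrite newton1 /d opprK.
rewrite mulr1 d_SS.
under eq_bigr => i _ do rewrite !add1n !subSS d_SS.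
rewrite (reindex_inj rev_ord_inj) /=.
have -> : \sum_(j < K) esum_step (K - j.+1) * Dl (K - (K - j.+1))%N = \sum_(i < K) Dl i.+1 * esum_step (K.-1 - i)%N.
  apply: eq_bigr => i _; rewrite mulrC; congr (Dl _ * esum_step _); have := ltn_ord i; lia.
move=> h.
set Z := \sum_(i < K) _ in h *.
have -> : Dl K.+2 = (1 - K.+2%:R) * esum_step K - (- Dl 1 * Dl K.+1 + (Z + esum_step K)) by rewrite -h; ring.
ring.
Qed.

End NewtonStep.

(** * Affine covariance, and the sign of the leading coefficient at the zeros *)

Section AffineStep.
Variable R : realFieldType.
Implicit Types (x y s : seq R) (A B : {poly R}).

Definition affine_poly (tau z : R) : {poly R} := z%:P + tau *: 'X.

Definition affine_seq (tau z : R) s := [seq tau * (a - z) | a <- s].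

Lemma horner_affine tau z u : (affine_poly tau z).[u] = z + tau * u.
Proof. by rewrite /affine_poly hornerD hornerC hornerZ hornerX. Qed.

Lemma roots_poly_affine tau z s : tau * tau = 1 ->
  roots_poly (affine_seq tau z s) = tau ^+ size s *: (roots_poly s \Po affine_poly tau z).
Proof.
move=> t1; apply: poly_eq_horner => u _.
rewrite hornerZ horner_comp horner_affine !horner_roots_poly.
elim: s => [|a s IH]; first by rewrite !big_nil mulr1.
rewrite /= !big_cons IH exprS.
have -> : u - tau * (a - z) = tau * (z + tau * u - a).
  by rewrite -[in LHS](mul1r u) -t1; ring.
ring.
Qed.

Lemma size_comp_affine A tau z n : (size A <= n.+1)%N -> (size (A \Po affine_poly tau z) <= n.+1)%N.
Proof.
move=> sA; apply: (leq_trans (size_comp_poly_leq _ _)); rewrite ltnS.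
have : (size (affine_poly tau z) <= 2)%N.
  rewrite (leq_trans (size_polyD _ _))// geq_max size_polyC.
  rewrite (leq_trans (size_scale_leq _ _)) ?size_polyX// andbT.
  by case: (z != 0).
move: (size (affine_poly _ _)) => m m2.
have : (m.-1 <= 1)%N by lia.
by move=> /(leq_mul (leqnn (size A).-1)); rewrite muln1; lia.
Qed.

(** The recurrence is covariant under v = tau (u - z) with tau = 1 or tau = -1.
    This makes the zeros positive and treats both ends of their range alike. *)
Lemma step_affine x y A B tau z : tau * tau = 1 -> size y = (size x).+1 ->
  roots_poly y = A * (roots_poly x)^`() + B * roots_poly x ->
  roots_poly (affine_seq tau z y) =
    (A \Po affine_poly tau z) * (roots_poly (affine_seq tau z x))^`()
    + (tau *: (B \Po affine_poly tau z)) * roots_poly (affine_seq tau z x).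
Proof.
move=> t1 sy e; rewrite !roots_poly_affine// e sy derivZ deriv_comp.
have -> : (affine_poly tau z)^`() = tau%:P.
  by rewrite derivD derivC derivZ derivX add0r -alg_polyC.
rewrite comp_polyD !comp_polyM exprS -!mul_polyC rmorphM /=.
ring.
Qed.

Lemma esum_step_affine x A tau z j : esum_step (affine_seq tau z x) (A \Po affine_poly tau z) j
  = \sum_(a <- x) A.[z + tau * (tau * (a - z))] * (tau * (a - z)) ^+ j.
Proof.
by rewrite /esum_step big_map; apply: eq_bigr => a _; rewrite horner_comp horner_affine.
Qed.

(** Under these signs every term of newtonSS is nonnegative, by induction so are
    all increments, and the inequality drops the last sum. *)
Lemma step_ineq x y A B : (size A <= 3)%N -> (size B <= 2)%N -> size y = (size x).+1 ->
  roots_poly y = A * (roots_poly x)^`() + B * roots_poly x ->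
  (forall a, a \in x -> 0 <= a) -> (forall a, a \in x -> A.[a] <= 0) ->
  0 <= dpsum x y 1 ->
  forall K, - K.+2%:R * esum_step x A K <= dpsum x y K.+2 - dpsum x y 1 * dpsum x y K.+1.
Proof.
move=> sA sB sy e x0 Ax D1.
have es j : esum_step x A j <= 0.
  rewrite /esum_step big_seq -oppr_ge0 -sumrN sumr_ge0// => a ax.
  by rewrite -mulNr mulr_ge0 ?oppr_ge0 ?Ax ?exprn_ge0 ?x0.
have pos : forall K, 0 <= dpsum x y K.+1.
  elim/ltn_ind => -[|K] IH //.
  rewrite (newtonSS sA sB sy e) -!addrA addr_ge0//.
    by rewrite mulNr -mulrN mulr_ge0 ?oppr_ge0.
  rewrite addr_ge0// ?mulr_ge0// ?IH// oppr_ge0 -oppr_ge0 -sumrN sumr_ge0// => i _.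
  by rewrite -mulrN mulr_ge0 ?oppr_ge0 ?IH// (leq_trans (ltn_ord i)).
move=> K; rewrite (newtonSS sA sB sy e) [leRHS]addrAC addrK lerDl oppr_ge0 -oppr_ge0 -sumrN sumr_ge0// => i _.
by rewrite -mulrN mulr_ge0 ?oppr_ge0 ?pos.
Qed.

End AffineStep.

Section Interlacing.
Variable R : realFieldType.
Variables (n : nat) (x y : nat -> R) (A B : {poly R}).
Hypothesis sorted : forall k, (1 <= k < n)%N -> x k <= x k.+1.
Hypothesis interlaced : forall k, (1 <= k <= n)%N -> y k <= x k <= y k.+1.
Hypothesis step : \prod_(1 <= k < n.+2) ('X - (y k)%:P) =
  A * (\prod_(1 <= k < n.+1) ('X - (x k)%:P))^`() + B * \prod_(1 <= k < n.+1) ('X - (x k)%:P).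

Lemma sorted_le i j : (1 <= i)%N -> (i <= j <= n)%N -> x i <= x j.
Proof.
move=> i1; elim: j => [|j IH]; first by case: i i1 => // -[].
move=> /andP[]; rewrite leq_eqVlt => /predU1P[->//|ij jn].
by apply: (le_trans (IH _)); [rewrite -ltnS ij ltnW|apply: sorted; lia].
Qed.

(** At a simple zero z of p_x the recurrence gives p_y(z) = A(z) p_x'(z), and
    interlacing gives p_y(z) and p_x'(z) weakly opposite signs. A zero of multiplicity m
    of p_x is by interlacing a zero of multiplicity at least m - 1 of p_y, and
    the same argument works after division by (X - z) ^ (m - 1). *)
Lemma interlaced_sign j : (1 <= j <= n)%N -> A.[x j] <= 0.
Proof.
move=> /andP[j1 jn]; pose z := x j.
pose below k := (0 < k)%N && (x k == z).
have exb : exists k, below k by exists j; rewrite /below j1 /=.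
case: (ex_minnP exb) => -[|f]; first by rewrite /below.
move=> /andP[_ /eqP xf] minf.
pose above k := (0 < k <= n)%N && (x k == z).
have exa : exists k, above k by exists j; rewrite /above j1 jn /=.
have bounda k : above k -> (k <= n)%N by move=> /andP[/andP[]].
case: (ex_maxnP exa bounda) => i /andP[/andP[i1 iN] /eqP xi] maxi.
have fj : (f.+1 <= j)%N by apply: minf; rewrite /below j1 /=.
have ji : (j <= i)%N by apply: maxi; rewrite /above j1 jn /=.
have fi : (f < i)%N by exact: leq_trans fj ji.
have xz k : (f.+1 <= k <= i)%N -> x k = z.
  move=> /andP[fk ki]; apply/eqP; rewrite eq_le -{1}xi -xf !sorted_le//; lia.
have xlt k : (1 <= k <= f)%N -> x k < z.
  move=> /andP[k1 kf]; rewrite lt_neqAle sorted_le ?andbT//; last lia.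
  by apply/negP => /eqP xk; have := minf k; rewrite /below k1 xk eqxx => /(_ isT); lia.
have xgt k : (i < k <= n)%N -> z < x k.
  move=> /andP[ik kn]; rewrite lt_neqAle sorted_le ?andbT//; last lia.
  by apply/negP => /eqP xk; have := maxi k; rewrite /above -xk eqxx kn (leq_trans _ ik) // => /(_ isT); lia.
have yz k : (f.+2 <= k <= i)%N -> y k = z.
  move=> /andP[fk ki]; apply/eqP; rewrite eq_le.
  have k0 : k = k.-1.+1 by lia.
  have /andP[yk _] : y k <= x k <= y k.+1 by apply: interlaced; lia.
  rewrite (le_trans yk) ?xz ?lexx//=; last lia.
  have /andP[_] : y k.-1 <= x k.-1 <= y k.-1.+1 by apply: interlaced; lia.
  by rewrite -k0 xz//; lia.
(* f.+1, ..., i are the indices of the zeros equal to z; q and s are the two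
   polynomials with the common power of 'X - z removed *)
pose q := \prod_(1 <= k < f.+1) ('X - (x k)%:P) * \prod_(i.+1 <= k < n.+1) ('X - (x k)%:P).
pose s := \prod_(1 <= k < f.+1) ('X - (y k)%:P) * ('X - (y f.+1)%:P)
  * (('X - (y i.+1)%:P) * \prod_(i.+1 <= k < n.+1) ('X - (y k.+1)%:P)).
pose m := (i - f)%N.
have px : \prod_(1 <= k < n.+1) ('X - (x k)%:P) = ('X - z%:P) ^+ m * q.
  rewrite (@big_cat_nat _ _ _ f.+1)//=; last lia.
  rewrite (@big_cat_nat _ _ _ i.+1 f.+1)//=; last lia.
  rewrite [\prod_(f.+1 <= k < i.+1) _](_ : _ = ('X - z%:P) ^+ m); first by rewrite /q mulrCA.
  rewrite (eq_big_nat _ _ (F2 := fun=> 'X - z%:P)) ?prodr_const_nat ?subSS//.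
  by move=> k /andP[fk ki]; rewrite xz// fk.
have py : \prod_(1 <= k < n.+2) ('X - (y k)%:P) = ('X - z%:P) ^+ m.-1 * s.
  rewrite (@big_cat_nat _ _ _ f.+2)//=; last lia.
  rewrite (@big_cat_nat _ _ _ i.+1 f.+2)//=; last lia.
  rewrite [\prod_(f.+2 <= k < i.+1) _](_ : _ = ('X - z%:P) ^+ m.-1); last first.
    rewrite (eq_big_nat _ _ (F2 := fun=> 'X - z%:P)).
      by rewrite prodr_const_nat; congr (_ ^+ _); rewrite /m; lia.
    by move=> k /andP[fk ki]; rewrite yz// fk.
  rewrite [\prod_(1 <= k < f.+2) _](@big_nat_recr _ _ _ f.+1)//=.
  rewrite [\prod_(i.+1 <= k < n.+2) _]big_ltn; last lia.
  by rewrite [\prod_(i.+2 <= k < n.+2) _]big_add1 /= /s mulrCA.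
have m1 : m = m.-1.+1 by rewrite /m; lia.
have es : s = A * (m%:R * q + ('X - z%:P) * q^`()) + B * (('X - z%:P) * q).
  have nz : ('X - z%:P) ^+ m.-1 != 0 by rewrite expf_neq0 ?polyXsubC_eq0.
  apply: (mulfI nz); rewrite -py step px derivM deriv_exp derivXsubC mul1r.
  have -> : ('X - z%:P) ^+ m = ('X - z%:P) * ('X - z%:P) ^+ m.-1 :> {poly R} by rewrite -exprS -m1.
  rewrite -[_ *+ m]mulr_natl; move: (('X - z%:P) ^+ m.-1) => w; ring.
have sz : s.[z] = m%:R * A.[z] * q.[z].
  rewrite es !(hornerD, hornerM) hornerN hornerX !hornerC subrr !mul0r mulr0 !addr0.
  by rewrite -polyC_natr hornerC; ring.
have qz : q.[z] != 0.
  rewrite /q hornerM !horner_prod mulf_neq0//.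
    rewrite big_nat_cond prodf_seq_neq0; apply/allP => k _; apply/implyP => /andP[kf _].
    by rewrite hornerXsubC subr_eq0 gt_eqF ?xlt.
  rewrite big_nat_cond prodf_seq_neq0; apply/allP => k _; apply/implyP => /andP[kf _].
  by rewrite hornerXsubC subr_eq0 lt_eqF ?xgt.
have sq : s.[z] * q.[z] <= 0.
  rewrite /s /q !hornerM !horner_prod !hornerXsubC.
  set P1 := \prod_(1 <= k < f.+1) _; set P2 := \prod_(i.+1 <= k < n.+1) _.
  set P3 := \prod_(1 <= k < f.+1) _; set P4 := \prod_(i.+1 <= k < n.+1) _.
  have h1 : 0 <= P1 * P3.
    rewrite /P1 /P3 -big_split /= big_nat_cond prodr_ge0// => k /andP[kf _].
    have /andP[yk _] : y k <= x k <= y k.+1 by apply: interlaced; lia.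
    have xk := xlt k kf.
    by rewrite !hornerXsubC mulr_ge0// subr_ge0 ltW// (le_lt_trans yk).
  have h2 : 0 <= P2 * P4.
    rewrite /P2 /P4 -big_split /= big_nat_cond prodr_ge0// => k /andP[kf _].
    have /andP[_ yk] : y k <= x k <= y k.+1 by apply: interlaced; lia.
    have xk := xgt k kf.
    by rewrite !hornerXsubC mulr_le0// subr_le0 ltW// (lt_le_trans xk).
  have h3 : 0 <= z - y f.+1.
    have /andP[yk _] : y f.+1 <= x f.+1 <= y f.+2 by apply: interlaced; lia.
    by rewrite subr_ge0 -xf.
  have h4 : z - y i.+1 <= 0.
    have /andP[_ yk] : y i <= x i <= y i.+1 by apply: interlaced; lia.
    by rewrite subr_le0 -xi.
  rewrite [leLHS](_ : _ = P1 * P3 * (P2 * P4) * (z - y f.+1) * (z - y i.+1)); last by ring.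
  by rewrite mulr_ge0_le0// mulr_ge0// mulr_ge0.
have sqE : s.[z] * q.[z] = m%:R * (A.[z] * q.[z] ^+ 2) by rewrite sz; ring.
move: sq; rewrite sqE {1}m1 pmulr_rle0 ?ltr0Sn// pmulr_lle0// exprn_even_gt0//.
Qed.

End Interlacing.

(** * Real sequences with slow drift *)

Section SlowSequences.
Variable R : realType.
Implicit Types (u v E F : nat -> R) (l C d e : R).

Lemma cvg0P u : (u n @[n --> \oo] --> (0 : R)) <->
  forall e, 0 < e -> exists N, forall n, (N <= n)%N -> `|u n| <= e.
Proof.
split.
  move=> /cvgrPdist_le h e e0; have [N _ hN] := h e e0.
  by exists N => n Nn; have := hN n Nn; rewrite /= sub0r normrN.
move=> h; apply/cvgrPdist_le => e e0; have [N hN] := h e e0.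
by exists N => // n Nn /=; rewrite sub0r normrN hN.
Qed.

(** Divergence of the harmonic series, by doubling the index. *)
Lemma harmonic_unbounded u d N : 0 < d ->
  (forall n, (N <= n)%N -> d / n%:R <= u n.+1 - u n) ->
  forall C, exists2 n, (N <= n)%N & C < u n.
Proof.
move=> d0 hu; pose M := N.+1.
have grow m k : (M <= m)%N -> (k <= m)%N -> k%:R * (d / (m + m)%:R) <= u (m + k)%N - u m.
  move=> Mm; elim: k => [|k IH] km; first by rewrite addn0 subrr mul0r.
  have := hu (m + k)%N; rewrite -addnS => /(_ ltac:(lia)) h.
  have := IH (ltnW km).
  have : d / (m + m)%:R <= d / (m + k)%:R.
    rewrite ler_pM2l// lef_pV2 ?posrE ?ltr0n ?ler_nat; lia.
  rewrite -(natr1 k); lra.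
have dbl m : (M <= m)%N -> d / 2 <= u (m + m)%N - u m.
  move=> Mm; apply: le_trans (grow m m Mm (leqnn m)).
  have m0 : m%:R != 0 :> R by rewrite pnatr_eq0; lia.
  suff -> : m%:R * (d / (m + m)%:R) = d / 2 by [].
  by rewrite natrD -mulr2n -[m%:R *+ 2]mulr_natl; field.
have it j : u M + j%:R * (d / 2) <= u (2 ^ j * M)%N /\ (M <= 2 ^ j * M)%N.
  elim: j => [|j [IH1 IH2]]; first by rewrite mul0r addr0 mul1n.
  have := dbl _ IH2; rewrite addnn -mul2n mulnA -expnS -(natr1 j) => h; split; last first.
    by rewrite expnS -mulnA; lia.
  lra.
move=> C; pose j := Num.bound ((C - u M) / (d / 2)).
exists (2 ^ j * M)%N; first by have [_] := it j; lia.
have [h _] := it j; apply: lt_le_trans h.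
rewrite -ltrBlDl -ltr_pdivrMr ?divr_gt0//.
exact: unstable.ltr_bound.
Qed.

(** A discrete form of v' = - k v / n. For k > 0 the equation contracts |v|; for
    k < 0 it increases |v| by a multiple of 1 / n as long as |v| stays away from
    0, which a bounded sequence cannot afford. *)
Lemma drift_cvg0 v (k C : R) : k != 0 -> (forall n, `|v n| <= C) ->
  (n%:R * (v n.+1 - v n) + k * v n @[n --> \oo] --> (0 : R)) ->
  (v n @[n --> \oo] --> (0 : R)).
Proof.
move=> k0 vC /cvg0P h; apply/cvg0P => e e0.
have kp : 0 < `|k| by rewrite normr_gt0.
have [N hN] := h (`|k| * (e / 2)) ltac:(by rewrite mulr_gt0 ?divr_gt0).
pose M := maxn N (Num.bound `|k|).+1.
have stepn n : (M <= n)%N -> exists2 r, `|r| <= `|k| * (e / 2) &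
    v n.+1 = (1 - k / n%:R) * v n + r / n%:R /\ 0 < n%:R :> R /\ `|k| <= n%:R.
  move=> Mn; exists (n%:R * (v n.+1 - v n) + k * v n); first by apply: hN; lia.
  have n0 : 0 < n%:R :> R by rewrite ltr0n; lia.
  split; first by field; rewrite gt_eqF.
  split => //; apply: ltW; apply: (lt_le_trans (archi_boundP _)) => //.
  by rewrite ler_nat; lia.
have [kpos|kneg] := ltP 0 k.
  have ka : `|k| = k by rewrite gtr0_norm.
  have up n : (M <= n)%N -> `|v n.+1| <= (1 - k / n%:R) * `|v n| + k * (e / 2) / n%:R.
    move=> Mn; have [r rb [-> [n0 kn]]] := stepn n Mn.
    rewrite (le_trans (ler_normD _ _))// !normrM normfV (gtr0_norm n0) lerD//.
      rewrite ger0_norm// subr_ge0 ler_pdivrMr// mul1r -ka //.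
    by rewrite ler_pM2r ?invr_gt0// -{1}ka.
  have stay n : (M <= n)%N -> `|v n| <= e -> `|v n.+1| <= e.
    move=> Mn vn; apply: (le_trans (up n Mn)).
    have [_ _ [_ [n0 kn]]] := stepn n Mn.
    have q1 : k / n%:R <= 1 by rewrite ler_pdivrMr// mul1r -ka.
    have q0 : 0 <= k / n%:R by rewrite divr_ge0// ltW.
    rewrite mulrAC; move: (k / n%:R) q0 q1 => q q0 q1; nra.
  have [n0 Mn0 vn0] : exists2 n, (M <= n)%N & `|v n| <= e.
    apply: contrapT => /forall2NP big.
    have bigv n : (M <= n)%N -> e < `|v n|.
      by move=> Mn; have [//|/negP] := big n; rewrite -ltNge.
    have dec n : (M <= n)%N -> k * (e / 2) / n%:R <= - `|v n.+1| - - `|v n|.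
      move=> Mn; have := up n Mn; have := bigv n Mn.
      have [_ _ [_ [n0 kn]]] := stepn n Mn.
      have q0 : 0 < k / n%:R by rewrite divr_gt0.
      rewrite !(mulrAC _ _ n%:R^-1); move: (k / n%:R) q0 => q q0; nra.
    have e2 : 0 < k * (e / 2) by rewrite mulr_gt0 ?divr_gt0.
    have [n Mn] := harmonic_unbounded e2 dec 0.
    by have := normr_ge0 (v n); lra.
  exists n0 => n; elim: n => [|n IH].
    by rewrite leqn0 => /eqP <-.
  rewrite leq_eqVlt => /predU1P[<-//|n0n]; apply: stay; first lia.
  exact: IH.
have kn : k < 0 by rewrite lt_neqAle k0.
have ka : `|k| = - k by rewrite ltr0_norm.
have up n : (M <= n)%N -> (1 - k / n%:R) * `|v n| - (- k) * (e / 2) / n%:R <= `|v n.+1|.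
  move=> Mn; have [r rb [-> [n0 _]]] := stepn n Mn.
  have h1 := lerB_normD ((1 - k / n%:R) * v n) (r / n%:R).
  apply: le_trans h1; rewrite !normrM normfV (gtr0_norm n0) lerB//.
    rewrite ler_wpM2r// ger0_norm// subr_ge0 (le_trans _ ler01)// ler_pdivrMr// mul0r ltW//.
  by rewrite ler_pM2r ?invr_gt0// -ka.
exists M => n0 Mn0; rewrite leNgt; apply/negP => big.
have stay n : (n0 <= n)%N -> e < `|v n| -> e < `|v n.+1| /\ - k * (e / 2) / n%:R <= `|v n.+1| - `|v n|.
  move=> n0n bn; have := up n ltac:(lia).
  have [_ _ [_ [n1 _]]] := stepn n ltac:(lia).
  have q0 : 0 < - k / n%:R by rewrite divr_gt0// oppr_gt0.
  have -> : k / n%:R = - (- k / n%:R) by rewrite mulNr opprK.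
  rewrite mulrAC; move: (- k / n%:R) q0 => q q0; nra.
have bign n : (n0 <= n)%N -> e < `|v n|.
  elim: n => [|n IH]; first by rewrite leqn0 => /eqP <-.
  rewrite leq_eqVlt => /predU1P[<-//|n0n].
  by have [] := stay n n0n (IH n0n).
have [n n0n] := @harmonic_unbounded (fun n => `|v n|) (- k * (e / 2)) n0
  ltac:(by rewrite mulr_gt0 ?divr_gt0// oppr_gt0)
  (fun n n0n => (stay n n0n (bign n n0n)).2) C.
by rewrite ltNge vC.
Qed.

(** A nonzero limit would make v grow like e log n. *)
Lemma drift_resonance v e C : (forall n, `|v n| <= C) ->
  (n%:R * (v n.+1 - v n) @[n --> \oo] --> e) -> e = 0.
Proof.
have pos u d : 0 < d -> (forall n, `|u n| <= C) -> ~ (n%:R * (u n.+1 - u n) @[n --> \oo] --> d).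
  move=> d0 uC /cvgrPdist_le h; have [N _ hN] := h (d / 2) ltac:(by rewrite divr_gt0).
  have d2 : 0 < d / 2 by rewrite divr_gt0.
  have inc n : (N.+1 <= n)%N -> d / 2 / n%:R <= u n.+1 - u n.
    move=> Nn; have := hN n ltac:(rewrite /=; lia) => /=.
    have n0 : 0 < n%:R :> R by rewrite ltr0n; lia.
    rewrite ler_norml => /andP[_ h1].
    by rewrite ler_pdivrMr// [leRHS]mulrC; move: h1; set q := n%:R * _ => h1; lra.
  have [n Nn] := harmonic_unbounded d2 inc C.
  by rewrite ltNge (le_trans (ler_norm _)).
move=> vC hv; apply/eqP; case: (ltgtP e 0) => // e0; exfalso.
  apply: (pos (fun n => - v n) (- e)); first by rewrite oppr_gt0.
    by move=> n; rewrite normrN.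
  rewrite (_ : (fun n => _) = (fun n => - (n%:R * (v n.+1 - v n)))); first exact: cvgN.
  by apply/funext => n; ring.
exact: (pos v e).
Qed.

(** Up to o(1), u is bounded with increments o(1 / n). Such a sequence need not
    converge (cos (log (log n)) does not), but the solution of a drift equation
    follows a slow source adiabatically; this is what survives of convergence
    when some drift constant is not positive. *)
Definition slow u := exists E C, [/\ forall n, `|E n| <= C,
  u n - E n @[n --> \oo] --> (0 : R) & n%:R * (E n.+1 - E n) @[n --> \oo] --> (0 : R)].

Lemma cvg0M_bounded u v C : (u n @[n --> \oo] --> (0 : R)) -> (forall n, `|v n| <= C) ->
  (u n * v n @[n --> \oo] --> (0 : R)).
Proof.
move=> /cvg0P u0 vC; apply/cvg0P => e e0.
have C0 : 0 <= C by rewrite (le_trans _ (vC 0%N)).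
have C1 : 0 < C + 1 by rewrite ltr_pwDr.
have [N hN] := u0 (e / (C + 1)) ltac:(by rewrite divr_gt0).
exists N => n Nn; rewrite normrM.
have -> : e = e / (C + 1) * (C + 1) by field; rewrite gt_eqF.
by rewrite ler_pM// ?hN// (le_trans (vC n))// lerDl.
Qed.

Lemma cvgn_bounded u l : (u n @[n --> \oo] --> l) -> exists C, forall n, `|u n| <= C.
Proof.
move=> ul.
have ub : bounded_fun u by apply: cvg_seq_bounded; apply/cvg_ex; exists l.
have [M [_ hM]] := ub.
exists (`|M| + 1) => n; apply: (hM (`|M| + 1)) => //.
by rewrite (le_lt_trans (ler_norm M))// ltrDl.
Qed.

Lemma cvgn_ext u v l : (forall n, u n = v n) -> (v n @[n --> \oo] --> l) -> (u n @[n --> \oo] --> l).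
Proof. by move=> /funext ->. Qed.

Lemma cvgn_shift u l : (u n @[n --> \oo] --> l) -> (u n.+1 @[n --> \oo] --> l).
Proof. by move=> h; rewrite cvg_shiftS. Qed.

Lemma cvgn_near u v l N : (forall n, (N <= n)%N -> u n = v n) ->
  (v n @[n --> \oo] --> l) -> (u n @[n --> \oo] --> l).
Proof.
move=> uv; apply: cvg_trans; apply: near_eq_cvg.
by exists N => // n Nn /=; rewrite uv.
Qed.

Lemma slow_cvg u l : (u n @[n --> \oo] --> l) -> slow u.
Proof.
move=> ul; exists (fun=> l), `|l|; split => //.
  by rewrite -(subrr l); apply: cvgB => //; exact: cvg_cst.
by apply: (cvgn_ext (v := fun=> 0)) => [n|]; [rewrite subrr mulr0|exact: cvg_cst].
Qed.

Lemma slow_cst l : slow (fun=> l).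
Proof. exact: (slow_cvg (@cvg_cst _ _ _ _ _)). Qed.

Lemma slowD u v : slow u -> slow v -> slow (fun n => u n + v n).
Proof.
move=> [E [C [EC uE dE]]] [F [D [FD vF dF]]].
exists (fun n => E n + F n), (C + D); split.
- by move=> n; rewrite (le_trans (ler_normD _ _))// lerD.
- apply: (cvgn_ext (v := fun n => (u n - E n) + (v n - F n))) => [n|]; first by ring.
  by rewrite -(addr0 0); exact: cvgD.
- apply: (cvgn_ext (v := fun n => n%:R * (E n.+1 - E n) + n%:R * (F n.+1 - F n))) => [n|]; first by ring.
  by rewrite -(addr0 0); exact: cvgD.
Qed.

Lemma slowM u v : slow u -> slow v -> slow (fun n => u n * v n).
Proof.
move=> [E [C [EC uE dE]]] [F [D [FD vF dF]]].
exists (fun n => E n * F n), (C * D); split.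
- by move=> n; rewrite normrM ler_pM.
- apply: (cvgn_ext (v := fun n => (u n - E n) * (v n - F n) + (u n - E n) * F n + (v n - F n) * E n)) => [n|]; first by ring.
  rewrite -(addr0 0); apply: cvgD; last exact: cvg0M_bounded EC.
  rewrite -(addr0 0); apply: cvgD; last exact: cvg0M_bounded FD.
  by rewrite -(mulr0 0); exact: cvgM.
- apply: (cvgn_ext (v := fun n => n%:R * (E n.+1 - E n) * F n.+1 + n%:R * (F n.+1 - F n) * E n)) => [n|]; first by ring.
  rewrite -(addr0 0); apply: cvgD; last exact: cvg0M_bounded EC.
  by apply: cvg0M_bounded (fun n => FD n.+1).
Qed.

Lemma slow_scale l u : slow u -> slow (fun n => l * u n).
Proof. by move=> su; exact: slowM (slow_cst l) su. Qed.

Lemma slow_sum (I : Type) (s : seq I) (u : I -> nat -> R) :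
  (forall i, slow (u i)) -> slow (fun n => \sum_(i <- s) u i n).
Proof.
move=> su; elim: s => [|i s IH].
  rewrite (_ : (fun n => _) = fun=> 0); first exact: slow_cst.
  by apply/funext => n; rewrite big_nil.
rewrite (_ : (fun n => _) = fun n => u i n + \sum_(i <- s) u i n); first exact: slowD.
by apply/funext => n; rewrite big_cons.
Qed.

Lemma cvgn_sum (I : Type) (s : seq I) (u : I -> nat -> R) :
  (forall i, exists l : R, u i n @[n --> \oo] --> l) ->
  exists l : R, \sum_(i <- s) u i n @[n --> \oo] --> l.
Proof.
move=> /choice[l cu]; exists (\sum_(i <- s) l i).
by apply: (cvg_big add_continuous) => i _; exact: cu.
Qed.

Lemma slow_ext0 u v : slow u -> (v n - u n @[n --> \oo] --> (0 : R)) -> slow v.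
Proof.
move=> [E [C [EC uE dE]]] vu; exists E, C; split => //.
apply: (cvgn_ext (v := fun n => (v n - u n) + (u n - E n))) => [n|]; first by ring.
by rewrite -(addr0 0); exact: cvgD.
Qed.

Lemma slow_diff0 u : slow u -> (u n.+1 - u n @[n --> \oo] --> (0 : R)).
Proof.
move=> [E [C [EC uE dE]]].
have dE0 : (E n.+1 - E n @[n --> \oo] --> (0 : R)).
  move/cvg0P : dE => h; apply/cvg0P => e e0; have [N hN] := h e e0.
  exists N.+1 => n Nn; apply: le_trans (hN n _); last lia.
  rewrite normrM normr_nat ler_peMl// ler1n; lia.
apply: (cvgn_ext (v := fun n => (u n.+1 - E n.+1) + (E n.+1 - E n) - (u n - E n))) => [n|]; first by ring.
rewrite -(subr0 0); apply: cvgB => //; rewrite -(addr0 0); apply: cvgD => //.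
exact: (cvgn_shift (u := fun n => u n - E n)).
Qed.

Lemma invn_cvg0 : n%:R^-1 @[n --> \oo] --> (0 : R).
Proof. by rewrite -cvg_shiftS; exact: cvg_harmonic. Qed.

Section Tracking.
Variables (psi S D : nat -> R) (rho : R).
Hypothesis rho0 : 0 <= rho.
Hypothesis psi0 : forall n, (0 < n)%N -> 0 < psi n.
Let T n := \sum_(1 <= j < n) psi j.
Hypothesis karamata : T n / (n%:R * psi n) @[n --> \oo] --> (1 + rho)^-1.
Hypothesis SD : forall n, (0 < n)%N -> S n.+1 = S n + psi n * D n.
Let M n := S n / (n%:R * psi n).
Variable CM CD : R.
Hypothesis M_bounded : forall n, `|M n| <= CM.
Hypothesis D_bounded : forall n, `|D n| <= CD.

Let m n := S n / ((1 + rho) * T n).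

Let rho1 : 1 + rho != 0.
Proof. by rewrite gt_eqF// ltr_pwDl. Qed.

Let T_gt0 n : (2 <= n)%N -> 0 < T n.
Proof.
move=> n2; rewrite /T big_ltn//; rewrite ltr_pwDl ?psi0//.
by rewrite big_nat_cond sumr_ge0// => k /andP[/andP[k1 _] _]; rewrite ltW// psi0//; lia.
Qed.

Let ratio : (n%:R * psi n) / T n @[n --> \oo] --> 1 + rho.
Proof.
rewrite -(invrK (1 + rho)).
apply: (cvgn_ext (v := fun n => (T n / (n%:R * psi n))^-1)) => [n|].
  by rewrite invf_div.
by apply: cvgV => //; rewrite invr_neq0.
Qed.

Let ratioS : (n%:R * psi n) / T n.+1 @[n --> \oo] --> 1 + rho.
Proof.
rewrite -(invrK (1 + rho)).
apply: (cvgn_near (N := 1%N) (v := fun n => (T n / (n%:R * psi n) + n%:R^-1)^-1)) => [n n1|].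
  have p0 := psi0 n1; have n0 : 0 < n%:R :> R by rewrite ltr0n.
  have T0 := T_gt0 (n1 : (2 <= n.+1)%N).
  have -> : T n / (n%:R * psi n) + n%:R^-1 = T n.+1 / (n%:R * psi n).
    rewrite /T big_nat_recr//=; field; rewrite !gt_eqF//.
  by rewrite invf_div.
apply: cvgV; first by rewrite invr_neq0.
rewrite -[X in _ --> X]addr0; apply: cvgD => //.
exact: invn_cvg0.
Qed.

Let Mm0 : M n - m n @[n --> \oo] --> (0 : R).
Proof.
apply: (cvgn_near (N := 2%N) (v := fun n => (1 - (n%:R * psi n) / T n / (1 + rho)) * M n)) => [n n2|].
  have n0 : 0 < n%:R :> R by rewrite ltr0n; lia.
  have p0 : 0 < psi n by apply: psi0; lia.
  by rewrite /M /m; field; rewrite rho1 !gt_eqF// T_gt0.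
apply: cvg0M_bounded M_bounded.
rewrite -(subrr 1); apply: cvgB; first exact: cvg_cst.
by rewrite -[X in _ --> X](mulfV rho1); apply: cvgM => //; exact: cvg_cst.
Qed.

Let m_bounded : exists C, forall n, `|m n| <= C.
Proof.
have [C hC] := cvgn_bounded Mm0; exists (C + CM) => n.
rewrite (_ : m n = - (M n - m n) + M n); last by ring.
by rewrite (le_trans (ler_normD _ _))// lerD// normrN.
Qed.

Let drift : n%:R * (m n.+1 - m n) - (D n - (1 + rho) * m n) @[n --> \oo] --> (0 : R).
Proof.
have [C hC] := m_bounded.
apply: (cvgn_near (N := 2%N) (v := fun n => ((n%:R * psi n) / T n.+1 / (1 + rho) - 1)
    * (D n - (1 + rho) * m n))) => [n n2|].
  have n0 : 0 < n%:R :> R by rewrite ltr0n; lia.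
  have p0 : 0 < psi n by apply: psi0; lia.
  have T0 := T_gt0 n2; have T1 : T n.+1 = T n + psi n by rewrite /T big_nat_recr//=; lia.
  rewrite /m SD; last lia.
  by rewrite T1; field; rewrite rho1 !gt_eqF//= addr_gt0.
apply: (cvg0M_bounded (C := CD + (`|1 + rho| * C))) => [|n]; last first.
  by rewrite (le_trans (ler_normB _ _))// lerD// normrM ler_wpM2l.
rewrite -(subrr 1); apply: cvgB; last exact: cvg_cst.
by rewrite -[X in _ --> X](mulfV rho1); apply: cvgM => //; exact: cvg_cst.
Qed.

(** Dividing S by (1 + rho) T instead of n psi n turns SD into the drift equation
    n (m n.+1 - m n) = D n - (1 + rho) m n + o(1). Inserting D n = - c n M n + e n
    gives a drift with constant k = c0 + 1 + rho towards e / k. In the resonant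
    case k = 0 the source converges, and drift_resonance sends its limit to 0. *)
Lemma tracking (c e : nat -> R) (c0 : R) :
  (c n @[n --> \oo] --> c0) -> slow e ->
  (forall n, D n = - c n * M n + e n) ->
  (c0 + 1 + rho != 0 \/ exists l, e n @[n --> \oo] --> l) ->
  [/\ slow M, D n - (1 + rho) * M n @[n --> \oo] --> (0 : R) &
    c0 + 1 + rho != 0 -> (exists l, e n @[n --> \oo] --> l) -> exists l, M n @[n --> \oo] --> l].
Proof.
move=> cc [E [CE [EC eE dE]]] De alt; set k := c0 + 1 + rho.
have [C hC] := m_bounded.
have cM : (c n - c0) * M n @[n --> \oo] --> (0 : R).
  by apply: cvg0M_bounded M_bounded; rewrite -(subrr c0); apply: cvgB => //; exact: cvg_cst.
have mE : n%:R * (m n.+1 - m n) + k * m n - E n @[n --> \oo] --> (0 : R).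
  apply: (cvgn_ext (v := fun n => (n%:R * (m n.+1 - m n) - (D n - (1 + rho) * m n))
     + (e n - E n) - ((c n - c0) * M n + c0 * (M n - m n)))) => [n|].
    by rewrite De /k; ring.
  rewrite -(subr0 0); apply: cvgB.
    by rewrite -(addr0 0); exact: cvgD.
  rewrite -(addr0 0); apply: cvgD => //.
  by rewrite -(mulr0 c0); apply: cvgM => //; exact: cvg_cst.
have [k0|k0] := eqVneq k 0.
  have [l el] : exists l, e n @[n --> \oo] --> l by case: alt => //; rewrite -/k k0 eqxx.
  have dm : n%:R * (m n.+1 - m n) @[n --> \oo] --> l.
    apply: (cvgn_ext (v := fun n => (n%:R * (m n.+1 - m n) + k * m n - E n) + e n - (e n - E n))) => [n|].
      by rewrite k0; ring.
    by rewrite -[X in _ --> X]subr0; apply: cvgB => //; rewrite -[X in _ --> X]add0r; exact: cvgD.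
  have l0 := drift_resonance hC dm; rewrite l0 in dm el.
  split; last by [].
    by exists m, C; split.
  apply: (cvgn_ext (v := fun n => e n - (c n - c0) * M n)) => [n|].
    rewrite De (_ : 1 + rho = k - c0); last by rewrite /k; ring.
    by rewrite k0; ring.
  by rewrite -(subr0 0); exact: cvgB.
have v0 : m n - E n / k @[n --> \oo] --> (0 : R).
  apply: (drift_cvg0 k0 (C := C + CE / `|k|)) => [n|].
    by rewrite (le_trans (ler_normB _ _))// lerD// normrM normfV ler_wpM2r// invr_ge0.
  apply: (cvgn_ext (v := fun n => (n%:R * (m n.+1 - m n) + k * m n - E n)
     - n%:R * (E n.+1 - E n) / k)) => [n|]; first by field.
  rewrite -(subr0 0); apply: cvgB => //.
  by rewrite -(mul0r k^-1); apply: cvgM => //; exact: cvg_cst.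
have V0 : M n - E n / k @[n --> \oo] --> (0 : R).
  apply: (cvgn_ext (v := fun n => (M n - m n) + (m n - E n / k))) => [n|]; first by ring.
  by rewrite -(addr0 0); exact: cvgD.
split.
- exists (fun n => E n / k), (CE / `|k|); split => //.
    by move=> n; rewrite normrM normfV ler_wpM2r// invr_ge0.
  apply: (cvgn_ext (v := fun n => n%:R * (E n.+1 - E n) / k)) => [n|]; first by ring.
  by rewrite -(mul0r k^-1); apply: cvgM => //; exact: cvg_cst.
- apply: (cvgn_ext (v := fun n => (e n - E n) - (c n - c0) * M n - k * (M n - E n / k))) => [n|].
    by rewrite De /k; field.
  rewrite -(subr0 0); apply: cvgB; first by rewrite -(subr0 0); exact: cvgB.
  by rewrite -(mulr0 k); apply: cvgM => //; exact: cvg_cst.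
- move=> _ [l el]; exists (l / k).
  apply: (cvgn_ext (v := fun n => (M n - E n / k) + (e n - (e n - E n)) / k)) => [n|]; first by field.
  rewrite -[X in _ --> X]add0r; apply: cvgD => //.
  apply: cvgM; last exact: cvg_cst.
  by rewrite -[X in _ --> X]subr0; exact: cvgB.
Qed.

End Tracking.

(** Young's inequality for t and 1, with the exponent p. *)
Lemma bernoulli_powR (t p : R) : 0 <= t -> 1 <= p -> 1 + p * (t - 1) <= t `^ p.
Proof.
move=> t0; rewrite le_eqVlt => /predU1P[<-|p1].
  by rewrite powRr1//; lra.
have p0 : 0 < p by lra.
pose q := p / (p - 1).
have q0 : 0 < q by rewrite divr_gt0// subr_gt0.
have pq : p^-1 + q^-1 = 1 by rewrite /q; field; rewrite !gt_eqF// subr_gt0.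
have := @conjugate_powR R t 1 p q t0 ler01 p0 q0 pq.
rewrite mulr1 powR1 div1r => h.
have : p * t <= p * (t `^ p / p + q^-1) by rewrite ler_pM2l.
have -> : p * (t `^ p / p + q^-1) = t `^ p + (p - 1).
  by rewrite /q; field; rewrite !gt_eqF// subr_gt0.
lra.
Qed.

(** Iterating the bound j times leaves q ^ j B plus at most e. *)
Lemma contract_cvg0 (b : nat -> R) (B : R) : (forall n, 0 <= b n <= B) ->
  (forall e, 0 < e -> exists (q : R) N (h : nat -> nat), [/\ 0 <= q < 1,
     forall N', exists N'', forall n, (N'' <= n)%N -> (N' <= h n)%N &
     forall n, (N <= n)%N -> b n <= q * b (h n) + e * (1 - q)]) ->
  b n @[n --> \oo] --> (0 : R).
Proof.
move=> bB H; apply/cvg0P => e e0.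
have [q [N [h [/andP[q0 q1] hoo hb]]]] := H (e / 2) ltac:(by rewrite divr_gt0).
have it j : exists Nj, forall n, (Nj <= n)%N -> b n <= q ^+ j * B + e / 2.
  elim: j => [|j [Nj IH]].
    exists 0%N => n _; rewrite expr0 mul1r; have /andP[_ h1] := bB n.
    by rewrite (le_trans h1)// lerDl divr_ge0// ltW.
  have [N'' hN''] := hoo Nj; exists (maxn N N'') => n nn.
  have h1 := hb n ltac:(lia); have h2 := IH (h n) (hN'' n ltac:(lia)).
  rewrite exprS -[q * _ * B]mulrA; have := ler_wpM2l q0 h2; move: h1; set z := b (h n); set y := q ^+ j * B.
  lra.
have B0 : 0 <= B by have /andP[h1 h2] := bB 0%N; exact: le_trans h2.
have qB : q ^+ n * B @[n --> \oo] --> (0 : R).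
  rewrite -(mul0r B); apply: cvgM; last exact: cvg_cst.
  by apply: cvg_expr; rewrite ger0_norm.
move/cvg0P : qB => /(_ (e / 2) ltac:(by rewrite divr_gt0)) [j hj].
have [Nj hNj] := it j; exists Nj => n nn.
have /andP[b0 _] := bB n; rewrite ger0_norm//.
have := hj j (leqnn j); rewrite ger0_norm ?mulr_ge0 ?exprn_ge0// => h1.
have := hNj n nn; lra.
Qed.

End SlowSequences.

(** * Regularly varying scales *)

Section RegularVariation.
Variables (R : realType) (phi L : nat -> R) (sigma : R).
Hypothesis phi_gt0 : forall n, (0 < n)%N -> 0 < phi n.
Hypothesis phi_incr : forall m n, (0 < m <= n)%N -> phi m <= phi n.
Hypothesis sigma_ge0 : 0 <= sigma.
Hypothesis phi_rv : regularly_varying sigma phi L.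

Lemma powRV (t s : R) : 0 <= t -> t^-1 `^ s = (t `^ s)^-1.
Proof.
by move=> t0; rewrite -[in LHS](powR_inv1 t0) powRAC powR_inv1 ?powR_ge0.
Qed.

Lemma truncn_bounds (t : R) n : 0 <= t ->
  (truncn (n%:R * t))%:R <= n%:R * t < (truncn (n%:R * t)).+1%:R.
Proof. by move=> t0; apply: truncn_itv; rewrite mulr_ge0. Qed.

Lemma truncn_ratio (t : R) : 0 <= t ->
  (truncn (n%:R * t))%:R / n%:R @[n --> \oo] --> t.
Proof.
move=> t0; apply/cvgrPdist_le => e e0.
have /cvg0P/(_ e e0)[N hN] := @invn_cvg0 R.
exists N.+1 => // n Nn /=.
have n0 : 0 < n%:R :> R by rewrite ltr0n; move: Nn => /=; lia.
have /andP[h1 h2] := truncn_bounds n t0.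
have := hN n ltac:(move: Nn => /=; lia).
have i0 : 0 <= n%:R^-1 :> R by rewrite invr_ge0 ltW.
rewrite ger0_norm// => h3; apply: le_trans h3.
have h4 : (truncn (n%:R * t))%:R / n%:R <= t by rewrite ler_pdivrMr// [leRHS]mulrC.
rewrite ger0_norm ?subr_ge0// lerBlDr.
rewrite -(ler_pM2l n0) mulrDr mulfV ?gt_eqF// mulrCA mulfV ?gt_eqF// mulr1.
by move: h2; rewrite -natr1 addrC => /ltW.
Qed.

Lemma truncn_oo (t : R) N : 0 < t -> exists N', forall n, (N' <= n)%N -> (N <= truncn (n%:R * t))%N.
Proof.
move=> t0; exists (Num.bound (N%:R / t)) => n hn.
rewrite truncn_ge_nat; last by rewrite mulr_ge0 ?(ltW t0).
rewrite -ler_pdivrMr//.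
by rewrite ltW// (lt_le_trans (unstable.ltr_bound _))// ler_nat.
Qed.

Lemma phi_truncn (t : R) : 0 < t <= 1 ->
  phi (truncn (n%:R * t)) / phi n @[n --> \oo] --> t `^ sigma.
Proof.
move=> /andP[t0 t1]; have [phiE Lcvg] := phi_rv.
have [N hN] := truncn_oo 1 t0.
apply: (cvgn_near (N := N.+1) (v := fun n => ((truncn (n%:R * t))%:R / n%:R) `^ sigma *
   (L (truncn (n%:R * t)) / L n))) => [n Nn|].
  have m1 := hN n ltac:(lia).
  have n0 : (0 < n)%N by lia.
  rewrite !phiE// powRM ?invr_ge0//.
  rewrite powRV// invfM; set u := n%:R `^ sigma; set v := _ `^ sigma.
  by set l1 := L n; set l2 := L _; move: (u^-1) (l1^-1) => u' l1'; ring.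
rewrite -[X in _ --> X]mulr1; apply: cvgM; last by apply: Lcvg; rewrite t0.
have ct : {for t, continuous (fun s : R => s `^ sigma)}.
  apply: differentiable_continuous; apply/derivable1_diffP; apply: derivable_powR.
  by rewrite in_itv /= t0.
by apply: (continuous_cvg _ ct); apply: truncn_ratio; rewrite ltW.
Qed.

Lemma phi_ratio_le1 m n : (0 < m <= n)%N -> 0 < phi m / phi n <= 1.
Proof.
move=> mn; have n0 : (0 < n)%N by lia.
have m0 : (0 < m)%N by lia.
by rewrite divr_gt0 ?phi_gt0//= ler_pdivrMr ?phi_gt0// mul1r phi_incr.
Qed.

(** By monotonicity phi n lies between phi [t (n + 1)] and phi (n + 1), and the
    ratio of these two tends to t ^ sigma, which is near 1 for t near 1. *)
Lemma phi_succ : phi n / phi n.+1 @[n --> \oo] --> (1 : R).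
Proof.
apply/cvgrPdist_le => e e0.
(* Bernoulli for the exponent 1 + sigma, because sigma itself may be less than 1 *)
have [t [t0 t1 te]] : exists t : R, [/\ 0 < t, t < 1 & 1 - t `^ sigma <= e / 2].
  pose d := Num.min (1 / 2) (e / 2 / (1 + sigma)).
  have d0 : 0 < d by rewrite lt_min !divr_gt0// ltr_pwDl.
  have d1 : d <= 1 / 2 by rewrite ge_min lexx.
  have d2 : d * (1 + sigma) <= e / 2 by rewrite -ler_pdivlMr ?ltr_pwDl// ge_min lexx orbT.
  exists (1 - d); split; [lra|lra|].
  have p1 : 1 <= 1 + sigma by rewrite lerDl.
  have h0 : 0 <= 1 - d by lra.
  have h1 := bernoulli_powR h0 p1.
  have h2 : (1 - d) `^ (1 + sigma) <= (1 - d) `^ sigma.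
    by apply: ger_powR; [apply/andP; split; lra|lra].
  move: h1 h2; set x := _ `^ _; set y := _ `^ _; lra.
have t01 : 0 < t <= 1 by rewrite t0 ltW.
have /cvgrPdist_le/(_ (e / 2)) := phi_truncn t01; rewrite divr_gt0// => /(_ isT)[N _ hN].
have [N1 hN1] := truncn_oo 1 t0.
have [N2 hN2] := truncn_oo 1 (ltac:(by rewrite subr_gt0) : 0 < 1 - t).
exists (maxn N (maxn N1 N2)) => // n Nn /=.
have /= := hN n.+1 ltac:(move: Nn => /=; lia).
have m1 := hN1 n.+1 ltac:(move: Nn => /=; lia).
have m2 := hN2 n.+1 ltac:(move: Nn => /=; lia).
set m := truncn _ in m1 *.
have mn : (m <= n)%N.
  rewrite -ltnS /m truncn_lt_nat; last by rewrite mulr_ge0 ?ltW.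
  by rewrite gtr_pMr// ltr0n.
have [p1 p2] : 0 < phi n.+1 /\ phi m / phi n.+1 <= phi n / phi n.+1.
  by split; [exact: phi_gt0|rewrite ler_pM2r ?invr_gt0 ?phi_gt0// phi_incr// m1].
have n0 : (0 < n)%N by exact: leq_trans m1 mn.
have /andP[_ q1] : 0 < phi n / phi n.+1 <= 1 by apply: phi_ratio_le1; rewrite n0 leqnSn.
rewrite [in X in _ -> X]ger0_norm ?subr_ge0// => /ler_normlP[_ h].
move: p2 q1 h te; set a := phi m / _; set b := phi n / _; set c := t `^ _; lra.
Qed.

Section Karamata.
Variable K : nat.
Let rho := K%:R * sigma.
Let psi n := phi n ^+ K.
Let T n := \sum_(1 <= j < n) psi j.
Let rho0 : 0 <= rho. Proof. by rewrite mulr_ge0. Qed.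
Let psi0 n : (0 < n)%N -> 0 < psi n. Proof. by move=> n0; rewrite exprn_gt0// phi_gt0. Qed.
Let psi_incr m n : (0 < m <= n)%N -> psi m <= psi n.
Proof.
move=> mn; have m0 : (0 < m)%N by lia.
have n0 : (0 < n)%N by lia.
by rewrite /psi lerXn2r ?nnegrE ?phi_incr// ltW// phi_gt0.
Qed.

Let T_split m n : (0 < m <= n)%N ->
  psi m * (n - m)%:R <= T n - T m <= psi n * (n - m)%:R.
Proof.
move=> mn; rewrite /T (@big_cat_nat _ _ _ m 1 n)//=; [|lia|lia].
rewrite addrAC subrr add0r.
have c x : x * (n - m)%:R = \sum_(m <= j < n) x :> R by rewrite sumr_const_nat mulr_natr.
rewrite !c; apply/andP; split; rewrite !big_nat; apply: ler_sum => j jn; apply: psi_incr; lia.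
Qed.

Let T0 : T 1 = 0. Proof. by rewrite /T big_geq. Qed.

Let a n := T n / (n%:R * psi n).

Let a01 n : 0 <= a n <= 1.
Proof.
have [->|n0] := posnP n; first by rewrite /a mul0r invr0 mulr0 lexx ler01.
have p0 := psi0 n0.
have np : 0 < n%:R * psi n by rewrite mulr_gt0// ltr0n.
have /andP[h1 h2] := @T_split 1 n ltac:(lia).
rewrite T0 subr0 in h1 h2; rewrite /a ler_pdivrMr// mul1r divr_ge0 ?(ltW np)//=.
  apply: le_trans h2 _; rewrite mulrC ler_pM2r// ler_nat; lia.
by apply: le_trans h1; rewrite mulr_ge0// ltW// psi0.
Qed.

(** Karamata's theorem for sums. Cutting the sum at [n t] and using that psi is
    monotone bounds a n above by t ^ (1 + rho) a [n t] + (1 - t) and below by the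
    same expression with (1 - t) t ^ rho, up to o(1). By Bernoulli's inequality
    (1 + rho)^-1 is a fixed point of both bounds up to o(1 - t) as t -> 1, so
    contract_cvg0 applies. *)
Lemma karamata : T n / (n%:R * psi n) @[n --> \oo] --> (1 + rho)^-1.
Proof.
pose l := (1 + rho)^-1.
have r1 : 0 < 1 + rho by rewrite ltr_pwDl.
have l01 : 0 < l <= 1 by rewrite /l invr_gt0 r1 invf_le1// lerDl.
have [l0 l1] : 0 < l /\ l <= 1 by move/andP : l01.
suff : `|a n - l| @[n --> \oo] --> (0 : R).
  move=> /cvg0P h; apply/cvgrPdist_le => e e0; have [N hN] := h e e0.
  by exists N => // n Nn /=; rewrite distrC; have := hN n Nn; rewrite normr_id.
apply: (@contract_cvg0 _ _ 1) => [n|e e0].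
  by rewrite normr_ge0 ler_norml; have := a01 n; move: l01 => /andP[? ?] /andP[? ?]; apply/andP; split; lra.
(* with this d the numbers t = 1 - d and tau = t ^ rho satisfy 1 - tau <= e / 2 *)
pose d := Num.min (1 / 2) (e / 2 / (1 + rho)).
have d0 : 0 < d by rewrite lt_min !divr_gt0.
have d1 : d <= 1 / 2 by rewrite ge_min lexx.
have d2 : d * (1 + rho) <= e / 2 by rewrite -ler_pdivlMr// ge_min lexx orbT.
pose t := 1 - d.
have t0 : 0 < t by rewrite /t; lra.
have t1 : t < 1 by rewrite /t; lra.
have t01 : 0 < t <= 1 by rewrite t0 ltW.
pose tau := (t `^ sigma) ^+ K.
have tauE : tau = t `^ rho by rewrite /tau -powR_mulrn ?powR_ge0// -powRrM /rho mulrC.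
have p1 : 1 <= 1 + rho by rewrite lerDl.
have tp : t `^ (1 + rho) = t * tau.
  by rewrite tauE powRD ?powRr1// ?ltW//; apply/implyP => _; rewrite gt_eqF.
have tau0 : 0 < tau by rewrite tauE powR_gt0.
have tau1 : tau <= 1 by rewrite exprn_ile1 ?powR_ge0// -(powRr0 t) ger_powR.
have Y1 : 1 + (1 + rho) * (t - 1) <= t * tau.
  by rewrite -tp bernoulli_powR// ltW.
have Y2 : (1 + rho) * tau * (1 - t) <= 1 - t * tau.
  have ti : 0 <= t^-1 by rewrite invr_ge0 ltW.
  have := bernoulli_powR ti p1.
  have -> : t^-1 `^ (1 + rho) = (t * tau)^-1.
    by rewrite -tp powRV// ltW.
  rewrite -(ler_pM2r (mulr_gt0 t0 tau0)) mulVf ?gt_eqF ?mulr_gt0// => h.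
  rewrite -subr_ge0; move: h; rewrite -subr_ge0.
  by congr (0 <= _); field; rewrite gt_eqF.
have taue : 1 - tau <= e / 2.
  have : t * tau <= tau by rewrite ger_pMl// ltW.
  move: d2 Y1; rewrite /t; lra.
have B1 : l * (t * tau) + (1 - t) - l <= (1 - t) * (1 - tau).
  have : l * ((1 + rho) * tau * (1 - t)) <= l * (1 - t * tau) by rewrite ler_wpM2l//; lra.
  rewrite -!mulrA mulKf ?gt_eqF//; lra.
have B2 : - ((1 - t) * (1 - tau)) <= l * (t * tau) + tau * (1 - t) - l.
  have : l * (1 + (1 + rho) * (t - 1)) <= l * (t * tau) by rewrite ler_wpM2l//; lra.
  rewrite mulrDr mulr1 mulKf ?gt_eqF//; lra.
pose h n := truncn (n%:R * t).
pose x n := (h n)%:R / n%:R : R.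
pose y n := psi (h n) / psi n.
have xt : x n @[n --> \oo] --> t by apply: truncn_ratio; rewrite ltW.
have yt : y n @[n --> \oo] --> tau.
  rewrite /y /psi (_ : (fun n => _) = fun n => (phi (h n) / phi n) ^+ K); last first.
    by apply/funext => n; rewrite exprMn exprVn.
  have := phi_truncn t01; rewrite -/(h _) => hc.
  rewrite /tau; elim: (K) => [|k IH]; first by apply: cvg_cst.
  rewrite (_ : (fun n => _) = fun n => (phi (h n) / phi n) * (phi (h n) / phi n) ^+ k).
    by rewrite exprS; apply: cvgM.
  by apply/funext => n; rewrite exprS.
pose F1 n := l * (x n * y n) + (1 - x n) - l.
pose F2 n := l * (x n * y n) + y n * (1 - x n) - l.
have c1 : F1 n @[n --> \oo] --> l * (t * tau) + (1 - t) - l.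
  apply: cvgB; last exact: cvg_cst.
  apply: cvgD; first by apply: cvgM; [exact: cvg_cst|exact: cvgM].
  by apply: cvgB => //; exact: cvg_cst.
have c2 : F2 n @[n --> \oo] --> l * (t * tau) + tau * (1 - t) - l.
  apply: cvgB; last exact: cvg_cst.
  apply: cvgD; first by apply: cvgM; [exact: cvg_cst|exact: cvgM].
  by apply: cvgM => //; apply: cvgB => //; exact: cvg_cst.
have e2 : 0 < (1 - t) * (e / 2) by rewrite mulr_gt0 ?divr_gt0// subr_gt0.
have /cvgrPdist_le/(_ _ e2)[N1 _ hN1] := c1.
have /cvgrPdist_le/(_ _ e2)[N2 _ hN2] := c2.
have [N3 hN3] := truncn_oo 1 t0.
exists t, (maxn N1 (maxn N2 N3)).+1, h; split; first by rewrite ltW.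
  by move=> N'; have [N'' ?] := truncn_oo N' t0; exists N''.
move=> n nn.
have := ltnW nn; rewrite !geq_max => /and3P[nn1 nn2 nn3].
have n1 : (0 < n)%N by exact: leq_ltn_trans nn.
have /= k1 := hN1 n nn1.
have /= k2 := hN2 n nn2.
have h1 : (0 < h n)%N by exact: hN3.
have n0 : 0 < n%:R :> R by rewrite ltr0n.
have hn : (h n <= n)%N.
  by rewrite -(ler_nat R) (le_trans (ltac:(by have /andP[] := truncn_bounds n (ltW t0)) : (h n)%:R <= n%:R * t))// ger_pMr// ltW.
have ps := psi0 h1; have pn : 0 < psi n by exact: psi0.
have xle : x n <= t by rewrite /x ler_pdivrMr// mulrC; have /andP[] := truncn_bounds n (ltW t0).
have x0 : 0 <= x n by rewrite /x divr_ge0.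
have y0 : 0 <= y n by rewrite /y divr_ge0 ?ltW.
have y1 : y n <= 1 by rewrite /y ler_pdivrMr// mul1r psi_incr// h1.
have /andP[s1 s2] := @T_split (h n) n ltac:(by rewrite h1).
have Tn : a n = a (h n) * (x n * y n) + (T n - T (h n)) / (n%:R * psi n).
  by rewrite /a /x /y; field; rewrite !gt_eqF// ltr0n.
have up : a n <= a (h n) * (x n * y n) + (1 - x n).
  rewrite Tn lerD2l ler_pdivrMr ?mulr_gt0//; apply: le_trans s2 _.
  rewrite natrB// /x le_eqVlt; apply/orP; left; apply/eqP; field; rewrite gt_eqF//.
have lo : a (h n) * (x n * y n) + y n * (1 - x n) <= a n.
  rewrite Tn lerD2l ler_pdivlMr ?mulr_gt0//; apply: le_trans s1.
  rewrite natrB// /x /y le_eqVlt; apply/orP; left; apply/eqP; field; rewrite !gt_eqF//.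
have xy : x n * y n <= t by rewrite (le_trans _ xle)// ler_piMr.
have xy0 : 0 <= x n * y n by rewrite mulr_ge0.
have key : `|a n - l| <= x n * y n * `|a (h n) - l| + (1 - t) * (1 - tau) + (1 - t) * (e / 2).
  have ab := ler_normlP _ _ (lexx `|a (h n) - l|).
  have w1 : (a (h n) - l) * (x n * y n) <= `|a (h n) - l| * (x n * y n) by rewrite ler_wpM2r// ler_norm.
  have w2 : - (a (h n) - l) * (x n * y n) <= `|a (h n) - l| * (x n * y n) by rewrite ler_wpM2r// -normrN ler_norm.
  move: k1 k2 => /ler_normlP[k1 _] /ler_normlP[_ k2].
  move: k1 k2; rewrite /F1 /F2 => k1 k2.
  rewrite ler_norml; apply/andP; split; lra.
apply: (le_trans key).
have : x n * y n * `|a (h n) - l| <= t * `|a (h n) - l| by rewrite ler_wpM2r.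
have : (1 - t) * (1 - tau) <= (1 - t) * (e / 2) by rewrite ler_wpM2l// subr_ge0 ltW.
lra.
Qed.

End Karamata.
End RegularVariation.

(** * Moments of the rescaled zeros *)

Section Moments.
Variables (R : realType) (X Y : nat -> seq R) (A B : nat -> {poly R}) (a b : {poly R}).
Variables (phi : nat -> R) (sigma C : R).
Hypothesis sizeX : forall n, size (X n) = n.
Hypothesis sizeY : forall n, size (Y n) = n.+1.
Hypothesis sizeA : forall n, (size (A n) <= 3)%N.
Hypothesis sizeB : forall n, (size (B n) <= 2)%N.
Hypothesis step : forall n, roots_poly (Y n) =
  (n%:R^-1 *: A n) * (roots_poly (X n))^`() + B n * roots_poly (X n).
Hypothesis cvg_A : forall i, (A n)`_i @[n --> \oo] --> a`_i.
Hypothesis cvg_B : forall i, (B n)`_i @[n --> \oo] --> b`_i.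
Hypothesis phi_gt0 : forall n, (0 < n)%N -> 0 < phi n.
Hypothesis scaling : forall K n, (0 < n)%N ->
  psum K (X n.+1) * phi n.+1 ^+ K = psum K (Y n) * phi n ^+ K.
Hypothesis X_bounded : forall n z, z \in X n -> `|z| <= C.
Hypothesis sigma_ge0 : 0 <= sigma.
Hypothesis karamata_phi : forall K,
  (\sum_(1 <= j < n) phi j ^+ K) / (n%:R * phi n ^+ K) @[n --> \oo] --> (1 + K%:R * sigma)^-1.

Definition moment K n : R := psum K (X n) / n%:R.
Definition increment K n : R := dpsum (X n) (Y n) K.

Let sizenA n : (size (n%:R^-1 *: A n)%R <= 3)%N.
Proof. exact: leq_trans (size_scale_leq _ _) _. Qed.
Let sizeYX n : size (Y n) = (size (X n)).+1.
Proof. by rewrite sizeX sizeY. Qed.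

Lemma moment0 : moment 0 n @[n --> \oo] --> (1 : R).
Proof.
apply: (cvgn_near (N := 1%N) (v := fun=> 1)); last exact: cvg_cst.
move=> n n1; rewrite /moment /psum big_const_seq count_predT iter_addr_0 sizeX divff//.
by rewrite pnatr_eq0 -lt0n.
Qed.

Lemma increment0 n : increment 0 n = 1.
Proof.
rewrite /increment /dpsum /psum !big_const_seq !count_predT !iter_addr_0 sizeX sizeY.
by rewrite -natr1; ring.
Qed.

Lemma C_ge0 : 0 <= C.
Proof.
have x1 : size (X 1) = 1%N by rewrite sizeX.
case: (X 1) (@X_bounded 1%N) x1 => [|z s] // h _.
by rewrite (le_trans (normr_ge0 z))// h// mem_head.
Qed.

Lemma mean_bounded (F : R -> R) D n : 0 <= D -> (forall z, z \in X n -> `|F z| <= D) ->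
  `|(\sum_(z <- X n) F z) / n%:R| <= D.
Proof.
move=> D0 FD; have [->|n0] := posnP n; first by rewrite invr0 mulr0 normr0.
have n1 : 0 < n%:R :> R by rewrite ltr0n.
rewrite normrM normfV (gtr0_norm n1) ler_pdivrMr// (le_trans (ler_norm_sum _ _ _))//.
rewrite big_seq (le_trans (ler_sum _ FD))// -big_seq big_const_seq count_predT iter_addr_0.
by rewrite sizeX mulr_natr.
Qed.

Lemma moment_bounded K n : `|moment K n| <= C ^+ K.
Proof.
apply: mean_bounded => [|z zX]; first by rewrite exprn_ge0// C_ge0.
by rewrite normrX lerXn2r ?nnegrE ?C_ge0//; exact: X_bounded zX.
Qed.

Definition gain j n : R := (A n)`_2 * moment j.+2 n + (A n)`_1 * moment j.+1 n + (A n)`_0 * moment j n.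

Lemma esum_gain j n : esum_step (X n) (n%:R^-1 *: A n) j = gain j n.
Proof.
rewrite /esum_step /gain /moment /psum !mulr_suml !mulr_sumr -!big_split /=.
apply: eq_bigr => z _; rewrite hornerZ (horner_coef_wide _ (sizeA n)) !big_ord_recr big_ord0 /=.
by rewrite !exprS !expr0; ring.
Qed.

Lemma increment1 n : increment 1 n =
  - (1%:R * (A n)`_2) * moment 1 n - ((A n)`_1 * moment 0 n + (B n)`_0).
Proof.
rewrite /increment (newton1 (sizenA n) (sizeB n) (sizeYX n) (step n)) !coefZ /moment.
ring.
Qed.

Lemma incrementSS K n : increment K.+2 n =
  - (K.+2%:R * (A n)`_2) * moment K.+2 n
  + (- K.+2%:R * ((A n)`_1 * moment K.+1 n + (A n)`_0 * moment K n)
     + increment 1 n * increment K.+1 n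
     - \sum_(i < K) increment i.+1 n * gain (K.-1 - i)%N n).
Proof.
rewrite /increment (newtonSS (sizenA n) (sizeB n) (sizeYX n) (step n)) esum_gain /gain.
under eq_bigr => i _ do rewrite esum_gain.
rewrite -/(increment 1 n); ring.
Qed.

(** The drift constant of the moment of order K. *)
Definition kap K : R := K%:R * a`_2 + 1 + K%:R * sigma.

(** kap is affine in K with kap 0 = 1. *)
Lemma kap_lower j K : (j < K)%N -> 0 <= kap K -> 0 < kap j.
Proof.
move=> jK kK.
have K0 : 0 < K%:R :> R by rewrite ltr0n; lia.
rewrite -(pmulr_rgt0 _ K0).
have -> : K%:R * kap j = j%:R * kap K + (K%:R - j%:R) by rewrite /kap; ring.
by rewrite ltr_wpDl ?mulr_ge0// subr_gt0 ltr_nat.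
Qed.

Definition moment_spec K := [/\ slow (moment K),
  increment K n - (1 + K%:R * sigma) * moment K n @[n --> \oo] --> (0 : R) &
  0 < kap K -> exists l : R, moment K n @[n --> \oo] --> l].

(** On the unscaled power sums phi n ^ K * psum K (X n) one step adds
    phi n ^ K * increment K n, so tracking applies with psi = phi ^ K and the
    limit of karamata_phi. *)
Lemma moment_step K (e : nat -> R) : slow e ->
  (forall n, increment K n = - (K%:R * (A n)`_2) * moment K n + e n) ->
  (0 <= kap K -> exists l : R, e n @[n --> \oo] --> l) -> moment_spec K.
Proof.
move=> se De he.
have SE n : (psum K (X n) * phi n ^+ K) / (n%:R * phi n ^+ K) = moment K n.
  have [->|n0] := posnP n.
    by rewrite mul0r /moment invr0 !mulr0.
  have p0 : phi n ^+ K != 0 by rewrite expf_neq0// gt_eqF// phi_gt0.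
  have n1 : n%:R != 0 :> R by rewrite pnatr_eq0; lia.
  by rewrite /moment; field; rewrite n1.
have cA : K%:R * (A n)`_2 @[n --> \oo] --> K%:R * a`_2 by apply: cvgM; [exact: cvg_cst|exact: cvg_A].
have [Cc hc] := cvgn_bounded cA.
have [E [CE [EC eE _]]] := se.
have [Ce hCe] := cvgn_bounded eE.
have eb n : `|e n| <= Ce + CE.
  by rewrite -(subrK (E n) (e n)) (le_trans (ler_normD _ _))// lerD.
have Db n : `|increment K n| <= Cc * C ^+ K + (Ce + CE).
  rewrite De (le_trans (ler_normD _ _))// lerD// normrM normrN ler_pM//.
  exact: moment_bounded.
have rho0 : 0 <= K%:R * sigma by rewrite mulr_ge0.
have psi0 n : (0 < n)%N -> 0 < phi n ^+ K by move=> n0; rewrite exprn_gt0// phi_gt0.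
have SD n : (0 < n)%N -> psum K (X n.+1) * phi n.+1 ^+ K =
    psum K (X n) * phi n ^+ K + phi n ^+ K * increment K n.
  by move=> n0; rewrite scaling// /increment /dpsum; ring.
have := @tracking R (fun n => phi n ^+ K) (fun n => psum K (X n) * phi n ^+ K)
  (increment K) (K%:R * sigma) rho0 psi0 (@karamata_phi K) SD (C ^+ K) _ _ Db
  (fun n => K%:R * (A n)`_2) e _ cA se.
rewrite (_ : (fun n => psum K (X n) * phi n ^+ K / _) = moment K); last exact/funext.
move=> H; have {}H := H ltac:(by move=> n; rewrite SE; exact: moment_bounded).
have De' n : increment K n = - (K%:R * (A n)`_2) *
    (psum K (X n) * phi n ^+ K / (n%:R * phi n ^+ K)) + e n.
  by rewrite De SE.
have alt : kap K != 0 \/ exists l : R, e n @[n --> \oo] --> l.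
  have [/he|k0] := leP 0 (kap K); first by right.
  by left; rewrite lt_eqF.
have {H} [s0 t0 c0] := H De' alt.
split => //.
  by apply: cvgn_ext t0 => n; rewrite SE.
by move=> k0; apply: c0; [rewrite gt_eqF|apply: he; rewrite ltW].
Qed.

(** Induction through Newton's formulas: apart from the leading term they involve
    lower moments and increments only. A resonance kap K = 0 does no harm, for
    then every lower kap j is positive and the source term converges. *)
Lemma moment_all K : moment_spec K.
Proof.
elim/ltn_ind: K => K IH.
(* increments inherit the two properties of the moments *)
have incr_slow j : (j < K)%N -> slow (increment j).
  move=> jK; have [sj tj _] := IH j jK.
  exact: slow_ext0 (slow_scale (1 + j%:R * sigma) sj) tj.
have incr_cvg j : (j < K)%N -> 0 <= kap K -> exists l : R, increment j n @[n --> \oo] --> l.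
  move=> jK kK; have [_ tj cj] := IH j jK; have [l hl] := cj (kap_lower jK kK).
  exists ((1 + j%:R * sigma) * l).
  apply: (cvgn_ext (v := fun n => (increment j n - (1 + j%:R * sigma) * moment j n)
     + (1 + j%:R * sigma) * moment j n)) => [n|]; first by ring.
  rewrite -[X in _ --> X]add0r; apply: cvgD => //; apply: cvgM => //; exact: cvg_cst.
have mom_cvg j : (j < K)%N -> 0 <= kap K -> exists l : R, moment j n @[n --> \oo] --> l.
  by move=> jK kK; have [_ _ cj] := IH j jK; exact: cj (kap_lower jK kK).
have mom_slow j : (j < K)%N -> slow (moment j) by move=> jK; have [] := IH j jK.
have cA i := @cvg_A i; have sA i := slow_cvg (cA i).
case: K => [|[|K]] in IH incr_slow incr_cvg mom_cvg mom_slow *.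
- have m0 := moment0; split; first exact: slow_cvg m0.
    apply: (cvgn_ext (v := fun n => 1 - moment 0 n)) => [n|].
      by rewrite increment0 mul0r addr0 mul1r.
    by rewrite -(subrr 1); apply: cvgB => //; exact: cvg_cst.
  by move=> _; exists 1.
- apply: (@moment_step 1 (fun n => - ((A n)`_1 * moment 0 n + (B n)`_0))).
  + rewrite (_ : (fun n => _) = fun n => -1 * ((A n)`_1 * moment 0 n + (B n)`_0)); last first.
      by apply/funext => n; rewrite mulN1r.
    apply: slow_scale; apply: slowD; last exact: slow_cvg (@cvg_B 0%N).
    by apply: slowM => //; exact: mom_slow.
  + by move=> n; rewrite increment1.
  + move=> k0; have [l hl] := mom_cvg 0%N isT k0.
    exists (- (a`_1 * l + b`_0)); apply: cvgN; apply: cvgD; last exact: cvg_B.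
    exact: cvgM.
- apply: (@moment_step K.+2 _ _ (fun n => incrementSS K n)).
  + apply: slowD.
      apply: slowD; last by apply: slowM; exact: incr_slow.
      apply: slow_scale; apply: slowD; apply: slowM => //; exact: mom_slow.
    rewrite (_ : (fun n => _) = fun n => -1 * \sum_(i < K) increment i.+1 n * gain (K.-1 - i)%N n); last first.
      by apply/funext => n; rewrite mulN1r.
    apply: slow_scale; apply: (@slow_sum R 'I_K _ (fun i n => increment i.+1 n * gain (K.-1 - i)%N n)) => i.
    apply: slowM; first by apply: incr_slow; have := ltn_ord i; lia.
    have iK := ltn_ord i.
    rewrite /gain; apply: slowD; first (apply: slowD);
      apply: slowM => //; apply: mom_slow; lia.
  + move=> kK.
    have [l1 hl1] := mom_cvg K.+1 ltac:(lia) kK.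
    have [l2 hl2] := mom_cvg K ltac:(lia) kK.
    have [i1 hi1] := incr_cvg 1%N ltac:(lia) kK.
    have [i2 hi2] := incr_cvg K.+1 ltac:(lia) kK.
    have [s hs] : exists s : R, \sum_(i < K) increment i.+1 n * gain (K.-1 - i)%N n @[n --> \oo] --> s.
      apply: (@cvgn_sum R 'I_K _ (fun i n => increment i.+1 n * gain (K.-1 - i)%N n)) => i.
      have iK := ltn_ord i.
      have [c1 h1] := incr_cvg i.+1 ltac:(lia) kK.
      have [c2 h2] := mom_cvg (K.-1 - i).+2 ltac:(lia) kK.
      have [c3 h3] := mom_cvg (K.-1 - i).+1 ltac:(lia) kK.
      have [c4 h4] := mom_cvg (K.-1 - i)%N ltac:(lia) kK.
      exists (c1 * (a`_2 * c2 + a`_1 * c3 + a`_0 * c4)).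
      apply: cvgM => //; apply: cvgD; first apply: cvgD; exact: cvgM.
    exists (- K.+2%:R * (a`_1 * l1 + a`_0 * l2) + i1 * i2 - s).
    apply: cvgB => //; apply: cvgD; last exact: cvgM.
    by apply: cvgM; [exact: cvg_cst|apply: cvgD; exact: cvgM].
Qed.

End Moments.

(** * Rigidity in the unstable case *)

Section PolyMeans.
Variables (R : realType) (X Y : nat -> seq R).
Implicit Types (h k : {poly R}).

Definition pmean h n : R := (\sum_(z <- X n) h.[z]) / n%:R.
Definition pincr h n : R := \sum_(z <- Y n) h.[z] - \sum_(z <- X n) h.[z].

Lemma sum_horner (s : seq R) h : \sum_(z <- s) h.[z] = \sum_(i < size h) h`_i * psum i s.
Proof.
under eq_bigr => z _ do rewrite horner_coef.
by rewrite exchange_big /=; apply: eq_bigr => i _; rewrite /psum mulr_sumr.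
Qed.

Lemma pmean_coef h n : pmean h n = \sum_(i < size h) h`_i * moment X i n.
Proof.
rewrite /pmean sum_horner mulr_suml; apply: eq_bigr => i _.
by rewrite /moment mulrA.
Qed.

Lemma pincr_coef h n : pincr h n = \sum_(i < size h) h`_i * increment X Y i n.
Proof.
rewrite /pincr !sum_horner -sumrB; apply: eq_bigr => i _.
by rewrite /increment /dpsum mulrBr.
Qed.

Lemma pmeanD h k n : pmean (h + k) n = pmean h n + pmean k n.
Proof. by rewrite /pmean -mulrDl -big_split /=; under eq_bigr do rewrite hornerD. Qed.

Lemma pmeanZ c h n : pmean (c *: h) n = c * pmean h n.
Proof. by rewrite /pmean mulrA mulr_sumr; under eq_bigr do rewrite hornerZ. Qed.

Lemma pmean_ge0 C h n : (forall z, z \in X n -> `|z| <= C) ->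
  (forall z, `|z| <= C -> 0 <= h.[z]) -> 0 <= pmean h n.
Proof.
move=> XC hp; rewrite /pmean mulr_ge0 ?invr_ge0// big_seq sumr_ge0// => z zX.
exact/hp/XC.
Qed.

Lemma pmeanX K n : pmean 'X^K n = moment X K n.
Proof. by rewrite /pmean /moment /psum; under eq_bigr do rewrite hornerXn. Qed.

Lemma pincrX K n : pincr 'X^K n = increment X Y K n.
Proof. by rewrite /pincr /increment /dpsum /psum; congr (_ - _); apply: eq_bigr => z _; rewrite hornerXn. Qed.

Lemma poly_euler h : 'X * h^`() = \poly_(i < size h) (i%:R * h`_i).
Proof.
apply/polyP => -[|i]; rewrite coefXM coef_poly /=; first by rewrite mul0r; case: ifP.
rewrite coef_deriv mulr_natl; case: ltnP => // hi.
by rewrite nth_default// mul0rn.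
Qed.

(** On 'X^K the map h |-> h + sigma x h' is multiplication by 1 + K sigma. *)
Lemma pincr_self_similar (sigma : R) :
  (forall K, increment X Y K n - (1 + K%:R * sigma) * moment X K n @[n --> \oo] --> (0 : R)) ->
  forall h, pincr h n - pmean (h + sigma *: ('X * h^`())) n @[n --> \oo] --> (0 : R).
Proof.
move=> T h.
have E n : pmean (h + sigma *: ('X * h^`())) n =
    \sum_(i < size h) h`_i * ((1 + i%:R * sigma) * moment X i n).
  rewrite pmeanD pmeanZ pmean_coef.
  have -> : pmean ('X * h^`()) n = \sum_(i < size h) (i%:R * h`_i) * moment X i n.
    rewrite poly_euler /pmean; under eq_bigr => z _ do rewrite horner_poly.
    rewrite exchange_big mulr_suml /=; apply: eq_bigr => i _.
    by rewrite /moment /psum mulrA mulr_sumr.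
  by rewrite mulr_sumr -big_split /=; apply: eq_bigr => i _; ring.
apply: (cvgn_ext (v := fun n => \sum_(i < size h) h`_i *
   (increment X Y i n - (1 + i%:R * sigma) * moment X i n))) => [n|].
  by rewrite pincr_coef E -sumrB; apply: eq_bigr => i _; ring.
have : \sum_(i < size h) h`_i * (increment X Y i n - (1 + i%:R * sigma) * moment X i n)
    @[n --> \oo] --> \sum_(i < size h) h`_i * 0.
  by apply: (cvg_big add_continuous) => i _; apply: cvgM; [exact: cvg_cst|exact: T].
by rewrite (eq_bigr (fun=> 0)) ?big1_eq// => i _; rewrite mulr0.
Qed.

End PolyMeans.

(** Compactness of the segment [-D, D]. *)
Lemma ultra_cvg (R : realType) (T : Type) (U : set_system T) (u : T -> R) (D : R) :
  UltraFilter U -> (forall n, `|u n| <= D) -> exists l : R, u n @[n --> U] --> l.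
Proof.
move=> UU uD; have PU : ProperFilter U by exact: ultra_proper.
have uI : (u @ U) `[- D, D]%classic.
  apply: (@filterE _ U _ (u @^-1` `[- D, D]%classic)) => n /=.
  by rewrite in_itv /= -ler_norml; exact: uD.
have [l [_ lU]] := @segment_compact R (- D) D (u @ U) _ uI.
exists l => V Vl.
have [//|VC] := in_ultra_setVsetC (u @^-1` V) UU.
by have [x [nVx Vx]] := lU (~` V) V VC Vl.
Qed.

(** Log-convexity makes H grow at least like (H 1 / H 0) ^ k, so this ratio cannot
    exceed V. *)
Lemma log_convex_bound (R : realType) (H : nat -> R) (V D : R) : 0 < V ->
  (forall k, 0 <= H k) -> (forall k, H k.+1 ^+ 2 <= H k * H k.+2) ->
  (forall k, H k <= D * V ^+ k) -> H 1%N <= V * H 0%N.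
Proof.
move=> V0 H0 Hc HD; rewrite leNgt; apply/negP => h1.
have h0 : 0 < H 0%N.
  rewrite lt_neqAle H0 andbT eq_sym; apply/negP => /eqP h0.
  have := Hc 0%N; rewrite h0 mul0r leNgt => /negP; apply.
  by rewrite exprn_gt0//; move: h1; rewrite h0 mulr0.
pose q := H 1%N / H 0%N.
have q0 : V < q by rewrite ltr_pdivlMr.
have qp : 0 < q by exact: lt_trans q0.
have grow k : 0 < H k /\ q * H k <= H k.+1.
  elim: k => [|k [IH1 IH2]]; first by rewrite /q divfK ?gt_eqF.
  have h2 : 0 < H k.+1 by apply: lt_le_trans IH2; rewrite mulr_gt0.
  split => //; rewrite -(ler_pM2l IH1); apply: le_trans (Hc k).
  by rewrite mulrA [_ * q]mulrC expr2 ler_pM2r.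
have lower k : H 0%N * q ^+ k <= H k.
  elim: k => [|k IH]; first by rewrite mulr1.
  have [_ h] := grow k; apply: le_trans h.
  by rewrite exprS mulrCA ler_pM2l.
have D0 : 0 < D by have := HD 0%N; rewrite mulr1; exact: lt_le_trans.
have /cvg0P/(_ (H 0%N / (2 * D)))[] : (V / q) ^+ n @[n --> \oo] --> (0 : R).
  by apply: cvg_expr; rewrite ger0_norm ?divr_ge0 ?(ltW V0) ?(ltW qp)// ltr_pdivrMr// mul1r.
  by rewrite divr_gt0// mulr_gt0.
move=> N hN; have := hN N (leqnn N).
rewrite ger0_norm ?exprn_ge0 ?divr_ge0 ?(ltW V0) ?(ltW qp)// exprMn exprVn.
rewrite ler_pdivrMr ?exprn_gt0// mulrAC ler_pdivlMr ?mulr_gt0// => h.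
have h2 := le_trans (lower N) (HD N).
have h3 : 0 < D * V ^+ N by rewrite mulr_gt0// exprn_gt0.
have h4 : V ^+ N * (2 * D) = 2 * (D * V ^+ N) by ring.
by move: h; rewrite h4; lra.
Qed.

Lemma quad_discriminant (R : realFieldType) (p q r : R) : 0 <= p ->
  (forall t, 0 <= r - 2 * t * q + t ^+ 2 * p) -> q ^+ 2 <= p * r.
Proof.
move=> p0 H; have [pe|pn] := eqVneq p 0.
  have r0 : 0 <= r by have := H 0; rewrite pe !mulr0 mul0r subr0 addr0.
  rewrite pe mul0r; have [->|qn] := eqVneq q 0; first by rewrite expr0n.
  have := H ((r + 1) / q); rewrite pe mulr0 addr0.
  have -> : 2 * ((r + 1) / q) * q = 2 * (r + 1) by field.
  by move=> h; exfalso; lra.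
have pp : 0 < p by rewrite lt_neqAle eq_sym pn.
have := H (q / p).
have -> : r - 2 * (q / p) * q + (q / p) ^+ 2 * p = (p * r - q ^+ 2) / p by field.
by rewrite pmulr_lge0 ?invr_gt0// subr_ge0.
Qed.

(** The variance m2 - m ^ 2 comes out at most - (s m) ^ 2. *)
Lemma variance_arith (R : realFieldType) (s m m2 w : R) :
  - w - s * (m2 - (1 + s) * m * m) <= 0 ->
  (1 + 2 * s) * m2 = - 2 * w + ((1 + s) * m) ^+ 2 -> m2 - m ^+ 2 <= 0.
Proof.
move=> h h3; have h5 : 0 <= s ^+ 2 * m ^+ 2 by rewrite mulr_ge0 ?sqr_ge0.
have : m2 - ((1 + s) * m) ^+ 2 + 2 * s * ((1 + s) * m) * m <= 0 by lra.
rewrite exprMn; lra.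
Qed.

Section Rigidity.
Variables (R : realType) (X Y : nat -> seq R) (A B : nat -> {poly R}) (a b : {poly R}).
Variables (phi : nat -> R) (sigma C : R).
Hypothesis sizeX : forall n, size (X n) = n.
Hypothesis sizeY : forall n, size (Y n) = n.+1.
Hypothesis sizeA : forall n, (size (A n) <= 3)%N.
Hypothesis sizeB : forall n, (size (B n) <= 2)%N.
Hypothesis size_a : (size a <= 3)%N.
Hypothesis step : forall n, roots_poly (Y n) =
  (n%:R^-1 *: A n) * (roots_poly (X n))^`() + B n * roots_poly (X n).
Hypothesis cvg_A : forall i, (A n)`_i @[n --> \oo] --> a`_i.
Hypothesis X_bounded : forall n z, z \in X n -> `|z| <= C.
Hypothesis A_neg : forall n z, z \in X n -> (A n).[z] <= 0.
Hypothesis increment1_bounded : forall n, `|increment X Y 1 n| <= C.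
Hypothesis sigma_ge0 : 0 <= sigma.
Hypothesis self_similar : forall K,
  increment X Y K n - (1 + K%:R * sigma) * moment X K n @[n --> \oo] --> (0 : R).
Hypothesis unstable : a`_2 + sigma < 0.

Section UltraLimit.
Variable U : set_system nat.
Hypothesis UU : UltraFilter U.
Hypothesis Uoo : forall u (l : R), u n @[n --> \oo] --> l -> u n @[n --> U] --> l.
Implicit Types (h g f : {poly R}).

Let PU : ProperFilter U := ultra_proper.

Let C0 : 0 <= C := C_ge0 sizeX X_bounded.

Lemma horner_bounded h : exists2 D, 0 <= D & forall z : R, `|z| <= C -> `|h.[z]| <= D.
Proof.
exists (\sum_(i < size h) `|h`_i| * C ^+ i).
  by apply: sumr_ge0 => i _; rewrite mulr_ge0// exprn_ge0.
move=> z zC; rewrite horner_coef (le_trans (ler_norm_sum _ _ _))// ler_sum// => i _.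
by rewrite normrM normrX ler_wpM2l// lerXn2r ?nnegrE.
Qed.

(** Integration against a limit point of the empirical measures of the zeros; the
    ultrafilter selects the same limit point for every polynomial. *)
Definition E h : R := lim (pmean X h n @[n --> U]).

Lemma pmean_ucvg h : pmean X h n @[n --> U] --> E h.
Proof.
have [D D0 hD] := horner_bounded h.
have [l hl] := @ultra_cvg R nat U (pmean X h) D UU
  (fun n => mean_bounded sizeX D0 (fun z zX => hD z (X_bounded zX))).
by rewrite /E (cvg_lim _ hl).
Qed.

Lemma ucvg_eq (u : nat -> R) (l l' : R) : u n @[n --> U] --> l -> u n @[n --> U] --> l' -> l = l'.
Proof. by move=> h h'; rewrite -(cvg_lim (@Rhausdorff R) h) (cvg_lim (@Rhausdorff R) h'). Qed.

Lemma ucvg_ge0 (u : nat -> R) (l : R) : (forall n, 0 <= u n) -> u n @[n --> U] --> l -> 0 <= l.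
Proof.
move=> u0 ul; rewrite -(cvg_lim (@Rhausdorff R) ul); apply: limr_ge.
  by apply/cvg_ex; exists l.
exact: nearW.
Qed.

Lemma ED h g : E (h + g) = E h + E g.
Proof.
apply: (ucvg_eq (@pmean_ucvg (h + g))); under eq_fun do rewrite pmeanD.
by apply: cvgD; exact: pmean_ucvg.
Qed.

Lemma EZ c h : E (c *: h) = c * E h.
Proof.
apply: (ucvg_eq (@pmean_ucvg (c *: h))); under eq_fun do rewrite pmeanZ.
by apply: cvgM; [exact: cvg_cst|exact: pmean_ucvg].
Qed.

Lemma EN h : E (- h) = - E h.
Proof. by rewrite -scaleN1r EZ mulN1r. Qed.

Lemma E1 : E 1 = 1.
Proof.
apply: (ucvg_eq (@pmean_ucvg 1)); rewrite -(expr0 'X).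
under eq_fun do rewrite pmeanX.
by apply: Uoo; exact: moment0 sizeX.
Qed.

Definition pos_on_box f := forall z : R, `|z| <= C -> 0 <= f.[z].

Lemma E_ge0 h : pos_on_box h -> 0 <= E h.
Proof.
move=> hp; apply: ucvg_ge0 (@pmean_ucvg h) => n.
by apply: pmean_ge0 hp => z; exact: X_bounded.
Qed.

Lemma E_le h g : pos_on_box (g - h) -> E h <= E g.
Proof. by move=> /E_ge0; rewrite ED EN subr_ge0. Qed.

Lemma pincr_ucvg h : pincr X Y h n @[n --> U] --> E (h + sigma *: ('X * h^`())).
Proof.
have := Uoo (pincr_self_similar self_similar h).
move=> H; rewrite -[E _]add0r.
rewrite (_ : (fun n => _) = fun n => (pincr X Y h n - pmean X (h + sigma *: ('X * h^`())) n)
   + pmean X (h + sigma *: ('X * h^`())) n).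
  by apply: cvgD => //; exact: pmean_ucvg.
by apply/funext => n; rewrite subrK.
Qed.

Lemma pmeanA_ucvg h : pmean X (A n * h) n @[n --> U] --> E (a * h).
Proof.
have dec (p : {poly R}) : (size p <= 3)%N -> p = p`_0 *: 1 + p`_1 *: 'X + p`_2 *: 'X^2.
  move=> p3; apply/polyP => -[|[|[|i]]]; rewrite !coefD !coefZ coef1 coefX coefXn /=; try ring.
  by rewrite nth_default ?(leq_trans p3)//; ring.
rewrite (dec a size_a) !mulrDl -!scalerAl !ED !EZ.
rewrite (_ : (fun n => _) = fun n => (A n)`_0 * pmean X (1 * h) n + (A n)`_1 * pmean X ('X * h) n
   + (A n)`_2 * pmean X ('X^2 * h) n); last first.
  by apply/funext => n; rewrite {1}(dec (A n) (sizeA n)) !mulrDl -!scalerAl !pmeanD !pmeanZ.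
by apply: cvgD; first apply: cvgD; apply: cvgM; first [exact: pmean_ucvg | exact: Uoo].
Qed.

Section Edge.
Variable tau : R.
Hypothesis tau2 : tau * tau = 1.

Let C1 : R := C + 1.
(** Vp is at least 1 on the box. Its powers concentrate E at the right end of the
    support for tau = 1, and at the left end for tau = -1. *)
Definition Vp : {poly R} := tau *: 'X + C1%:P.

Lemma tau_norm : `|tau| = 1.
Proof.
have : `|tau| ^+ 2 == 1 by rewrite -normrX expr2 tau2 normr1.
by rewrite sqrf_eq1 => /orP[/eqP//|/eqP h]; have := normr_ge0 tau; rewrite h; lra.
Qed.

Lemma Vp_box z : `|z| <= C -> 1 <= Vp.[z] <= 2 * C + 1.
Proof.
move=> zC; rewrite /Vp hornerD hornerZ hornerX hornerC /C1.
have : `|tau * z| <= C by rewrite normrM tau_norm mul1r.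
by rewrite ler_norml => /andP[? ?]; apply/andP; split; lra.
Qed.

Lemma Vp_exp_ge1 k z : `|z| <= C -> 1 <= (Vp ^+ k).[z].
Proof. by move=> /Vp_box/andP[h _]; rewrite horner_exp exprn_ege1. Qed.

Lemma pos_on_boxM f h : pos_on_box f -> pos_on_box h -> pos_on_box (f * h).
Proof. by move=> f0 h0 z zC; rewrite hornerM mulr_ge0 ?f0 ?h0. Qed.

Lemma pos_on_box_Vp k : pos_on_box (Vp ^+ k).
Proof. by move=> z zC; rewrite (le_trans ler01)// Vp_exp_ge1. Qed.

Definition Npow k := E (Vp ^+ k).

Lemma Npow_gt0 k : 0 < Npow k.
Proof.
apply: (lt_le_trans ltr01); rewrite -E1; apply: E_le => z zC.
by rewrite hornerD hornerN hornerC subr_ge0 Vp_exp_ge1.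
Qed.

(** The Cauchy-Schwarz inequality for the weight f. *)
Lemma E_log_convex f : (forall h, pos_on_box h -> 0 <= E (f * h)) ->
  forall k, E (f * Vp ^+ k.+1) ^+ 2 <= E (f * Vp ^+ k) * E (f * Vp ^+ k.+2).
Proof.
move=> fp k; apply: quad_discriminant; first by apply: fp; exact: pos_on_box_Vp.
move=> t; have : 0 <= E (f * (Vp ^+ k * (Vp - t%:P) ^+ 2)).
  apply: fp; apply: pos_on_boxM; first exact: pos_on_box_Vp.
  by move=> z _; rewrite horner_exp sqr_ge0.
have -> : f * (Vp ^+ k * (Vp - t%:P) ^+ 2) =
    f * Vp ^+ k.+2 + (- (2 * t)) *: (f * Vp ^+ k.+1) + t ^+ 2 *: (f * Vp ^+ k).
  by rewrite -!mul_polyC !exprS polyCN !polyCM polyC_exp polyC_natr; ring.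
by rewrite !ED !EZ mulNr.
Qed.

Let ratio k := Npow k.+1 / Npow k.

Let ratio_incr k : ratio k <= ratio k.+1.
Proof.
have pos h : pos_on_box h -> 0 <= E (1 * h) by rewrite mul1r; exact: E_ge0.
have := E_log_convex pos k; rewrite !mul1r -!/(Npow _) => h.
rewrite /ratio ler_pdivrMr ?Npow_gt0// mulrAC ler_pdivlMr ?Npow_gt0//.
by rewrite -expr2 mulrC.
Qed.

Let ratio_ge1 k : 1 <= ratio k.
Proof.
rewrite /ratio ler_pdivlMr ?Npow_gt0// mul1r; apply: E_le => z zC.
have /andP[v1 _] := Vp_box zC.
rewrite exprS hornerD hornerN hornerM subr_ge0 ler_peMl//.
exact: pos_on_box_Vp.
Qed.

Let ratio_le k : ratio k <= 2 * C + 1.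
Proof.
rewrite /ratio ler_pdivrMr ?Npow_gt0// -EZ; apply: E_le => z zC.
have /andP[_ v1] := Vp_box zC.
rewrite exprS hornerD hornerN hornerM hornerZ subr_ge0 ler_wpM2r//.
exact: pos_on_box_Vp.
Qed.

(** The maximum of Vp on the support of E, reached at the point edge below. *)
Definition V0 := lim (ratio k @[k --> \oo]).

Let ratio_cvg : ratio k @[k --> \oo] --> V0.
Proof.
apply: nondecreasing_is_cvgn; first exact/nondecreasing_seqP.
by exists (2 * C + 1) => _ [k _ <-].
Qed.

Lemma ratio_V0 k : Npow k.+1 <= V0 * Npow k.
Proof.
rewrite -ler_pdivrMr ?Npow_gt0//.
apply: (@nondecreasing_cvgn_le _ ratio); first exact/nondecreasing_seqP.
by apply/cvg_ex; exists V0.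
Qed.

Lemma V0_gt0 : 0 < V0.
Proof.
apply: (lt_le_trans ltr01); apply: limr_ge; last exact: nearW.
by apply/cvg_ex; exists V0.
Qed.

Lemma Npow_V0 k : Npow k <= V0 ^+ k.
Proof.
elim: k => [|k IH]; first by rewrite /Npow !expr0 E1.
rewrite exprS; apply: (le_trans (ratio_V0 k)); rewrite ler_wpM2l//.
exact/ltW/V0_gt0.
Qed.

Lemma Npow_shift i : Npow (k + i) / Npow k @[k --> \oo] --> V0 ^+ i.
Proof.
elim: i => [|i IH].
  apply: (cvgn_ext (v := fun=> 1)) => [k|]; last exact: cvg_cst.
  by rewrite addn0 divff// gt_eqF// Npow_gt0.
apply: (cvgn_ext (v := fun k => ratio (k + i)%N * (Npow (k + i) / Npow k))) => [k|].
  by rewrite addnS /ratio; field; rewrite !gt_eqF// Npow_gt0.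
rewrite exprS; apply: cvgM => //.
by rewrite cvg_shiftn.
Qed.

Definition edge := tau * (V0 - C1).

(** In the variable Vp this is Npow_shift, one coefficient at a time. *)
Lemma edge_eval h : E (Vp ^+ k * h) / Npow k @[k --> \oo] --> h.[edge].
Proof.
pose Lp : {poly R} := tau *: 'X - (tau * C1)%:P.
have LV : Lp \Po Vp = 'X.
  rewrite /Lp comp_polyB comp_polyZ comp_polyX comp_polyC /Vp -!mul_polyC polyCM.
  have := congr1 (@polyC R) tau2; rewrite polyCM => t2.
  by rewrite mulrDr mulrA t2 mul1r addrK.
pose g := h \Po Lp.
have hg : h = g \Po Vp by rewrite /g -comp_polyA LV comp_polyXr.
have gh : h.[edge] = g.[V0].
  by rewrite /g horner_comp /Lp hornerD hornerN hornerZ hornerX hornerC /edge mulrBr.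
rewrite gh horner_coef {1}hg.
apply: (cvgn_ext (v := fun k => \sum_(i < size g) g`_i * (Npow (k + i) / Npow k))) => [k|].
  rewrite comp_polyE mulr_sumr.
  have -> : E (\sum_(i < size g) Vp ^+ k * (g`_i *: Vp ^+ i)) = \sum_(i < size g) g`_i * Npow (k + i).
    elim/big_rec2: _ => [|i x y _ <-]; first by have := EZ 0 0; rewrite scale0r mul0r.
    by rewrite ED -scalerAr EZ -exprD.
  by rewrite mulr_suml; apply: eq_bigr => i _; rewrite mulrA.
by apply: (cvg_big add_continuous) => i _; apply: cvgM; [exact: cvg_cst|exact: Npow_shift].
Qed.

(** The functional is carried by the points where Vp <= V0. *)
Lemma edge_support f : (forall h, pos_on_box h -> 0 <= E (f * h)) ->
  forall h, pos_on_box h -> 0 <= E (f * (h * (V0%:P - Vp))).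
Proof.
move=> fp h hp; pose f' := f * h.
have fp' p : pos_on_box p -> 0 <= E (f' * p).
  by move=> pp; rewrite /f' -mulrA; apply: fp; exact: pos_on_boxM.
have [D D0 hD] := horner_bounded f'.
have := @log_convex_bound R (fun k => E (f' * Vp ^+ k)) V0 D V0_gt0
  (fun k => fp' _ (pos_on_box_Vp k)) (E_log_convex fp').
rewrite expr0 mulr1 expr1 => /(_ _)H.
have -> : f * (h * (V0%:P - Vp)) = V0 *: f' + - (f' * Vp).
  by rewrite /f' -mul_polyC; ring.
rewrite ED EZ EN subr_ge0; apply: H => k.
apply: (@le_trans _ _ (D * Npow k)); last by rewrite ler_wpM2l// Npow_V0.
rewrite -EZ; apply: E_le => z zC.
rewrite hornerD hornerN hornerZ hornerM subr_ge0 ler_wpM2r ?pos_on_box_Vp//.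
by rewrite (le_trans (ler_norm _))// hD.
Qed.

Let cbar : R := (1 + sigma) * E 'X.

Lemma pincr_Vp n : pincr X Y Vp n = tau * increment X Y 1 n + C1.
Proof.
rewrite /pincr /Vp /increment /dpsum /psum.
have e (s : seq R) : \sum_(z <- s) (tau *: 'X + C1%:P).[z] = tau * \sum_(z <- s) z ^+ 1 + C1 * (size s)%:R.
  under eq_bigr do rewrite hornerD hornerZ hornerX hornerC.
  rewrite big_split /= -mulr_sumr big_const_seq count_predT iter_addr_0 mulr_natr.
  by congr (_ * _ + _); apply: eq_bigr => z _; rewrite expr1.
by rewrite !e sizeX sizeY -natr1; ring.
Qed.

(** This is step_ineq in the coordinate Vp, in which all zeros are positive and
    the first increment is at least 1. *)
Lemma discrete_edge K n : - K.+2%:R * pmean X (A n * Vp ^+ K) n <=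
  pincr X Y (Vp ^+ K.+2) n - pincr X Y Vp n * pincr X Y (Vp ^+ K.+1) n.
Proof.
pose z := - (tau * C1); pose q := affine_poly tau z.
have vE w : tau * (w - z) = Vp.[w].
  by rewrite /z opprK mulrDr mulrA tau2 mul1r /Vp hornerD hornerZ hornerX hornerC.
have zE w : z + tau * (tau * (w - z)) = w by rewrite mulrA tau2 mul1r addrC subrK.
have dE k : dpsum (affine_seq tau z (X n)) (affine_seq tau z (Y n)) k = pincr X Y (Vp ^+ k) n.
  rewrite /dpsum /psum !big_map /pincr.
  by congr (_ - _); apply: eq_bigr => w _; rewrite vE horner_exp.
have sYX : size (Y n) = (size (X n)).+1 by rewrite sizeX sizeY.
have sA : (size ((n%:R^-1 *: A n) \Po q)%R <= 3)%N.
  by apply: size_comp_affine; exact: leq_trans (size_scale_leq _ _) _.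
have sB : (size (tau *: (B n \Po q))%R <= 2)%N.
  by apply: leq_trans (size_scale_leq _ _) _; exact: size_comp_affine.
have st := step_affine z tau2 sYX (step n).
have := step_ineq sA sB _ st.
rewrite !size_map => /(_ sYX) H.
have {}H := H _ _ _ K.
rewrite !dE in H; rewrite -[Vp in pincr X Y Vp n]expr1.
have -> : pmean X (A n * Vp ^+ K) n = esum_step (affine_seq tau z (X n)) ((n%:R^-1 *: A n) \Po q) K.
  rewrite esum_step_affine /pmean mulr_suml; apply: eq_bigr => w _.
  by rewrite zE vE hornerM hornerZ horner_exp; ring.
apply: H.
- move=> _ /mapP[w wX ->]; rewrite vE.
  by have /andP[h _] := Vp_box (X_bounded wX); rewrite (le_trans ler01).
- move=> _ /mapP[w wX ->]; rewrite horner_comp horner_affine zE hornerZ.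
  by rewrite mulr_ge0_le0 ?invr_ge0// A_neg.
- rewrite expr1 pincr_Vp.
  have : `|tau * increment X Y 1 n| <= C by rewrite normrM tau_norm mul1r.
  by rewrite ler_norml /C1 => /andP[? _]; lra.
Qed.

(** What remains of discrete_edge after division by K, as K grows. *)
Definition drift_poly : {poly R} := - a - sigma *: ('X * ('X - cbar%:P)).

(** In the limit, discrete_edge bounds K E (Vp ^ K * drift_poly) by an expression
    without the factor K. Dividing by K E (Vp ^ K) and letting K grow evaluates
    the drift at the edge. *)
Lemma edge_drift : drift_poly.[edge] <= 0.
Proof.
pose chat := E (Vp + sigma *: ('X * Vp^`())).
have dV : Vp^`() = tau%:P by rewrite derivD derivC derivZ derivX addr0 -alg_polyC.
have chatE : chat = tau * cbar + C1.
  rewrite /chat dV ['X * _]mulrC mul_polyC scalerA !ED !EZ -[C1%:P]alg_polyC EZ E1 /cbar.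
  by ring.
pose Eo : {poly R} := Vp ^+ 2 - chat *: Vp + (chat * sigma * tau) *: 'X.
have main K : K.+2%:R * E (Vp ^+ K * drift_poly) <= E (Vp ^+ K * Eo).
  have l1 : - K.+2%:R * pmean X (A n * Vp ^+ K) n @[n --> U] --> - K.+2%:R * E (a * Vp ^+ K).
    by apply: cvgM; [exact: cvg_cst|exact: pmeanA_ucvg].
  have l2 := pincr_ucvg (h := Vp ^+ K.+2).
  have l3 := pincr_ucvg (h := Vp ^+ K.+1).
  have l4 := pincr_ucvg (h := Vp); rewrite -/chat in l4.
  have := ler_cvg_to l1 (cvgB l2 (cvgM l4 l3)) (nearW _ (discrete_edge K)).
  rewrite !deriv_exp dV /= => /(_ _ _ _ _) h.
  pose P := (Vp ^+ K.+2 + sigma *: ('X * (tau%:P * Vp ^+ K.+1 *+ K.+2)))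
    + - (chat *: (Vp ^+ K.+1 + sigma *: ('X * (tau%:P * Vp ^+ K *+ K.+1))))
    + K.+2%:R *: (a * Vp ^+ K).
  have EP : 0 <= E P. rewrite /P 2!ED EN !EZ; move: h; rewrite mulNr; lra.
  have PE : Vp ^+ K * Eo + - (K.+2%:R *: (Vp ^+ K * drift_poly)) = P.
    have key : 'X - cbar%:P = tau *: (Vp - chat%:P).
      have -> : Vp - chat%:P = tau *: ('X - cbar%:P).
        rewrite chatE /Vp [(tau * cbar + C1)%:P]polyCD polyCM -!mul_polyC.
        by move: (C1%:P) (cbar%:P) => c1 cb; ring.
      by rewrite scalerA tau2 scale1r.
    rewrite /Eo /drift_poly key /P (exprS Vp K.+1) (exprS Vp K) expr2 -!mul_polyC.
    rewrite -[tau%:P * _ *+ K.+2]mulr_natl -[tau%:P * _ *+ K.+1]mulr_natl polyC_natr.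
    rewrite -(natr1 K.+1) -(natr1 K) [(chat * sigma * tau)%:P]polyCM [(chat * sigma)%:P]polyCM.
    move: (chat%:P) (sigma%:P) (tau%:P) (K%:R : {poly R}) (Vp ^+ K) (Vp) => ch sg ta kk vk v.
    ring.
  by rewrite -subr_ge0 -EZ -EN -ED PE.
have c0 : K.+2%:R^-1 * (E (Vp ^+ K * Eo) / Npow K) @[K --> \oo] --> 0 * Eo.[edge].
  apply: cvgM; last exact: edge_eval.
  by apply: (cvgn_shift (u := fun n => n.+1%:R^-1)); exact: cvg_harmonic.
rewrite mul0r in c0.
apply: (ler_cvg_to (edge_eval (h := drift_poly)) c0); apply: nearW => K.
have n0 := Npow_gt0 K.
by rewrite ler_pdivrMr// -mulrA divfK ?gt_eqF// ler_pdivlMl// main.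
Qed.

End Edge.

Let tau1 : (1 : R) * 1 = 1. Proof. by rewrite mulr1. Qed.
Let tauN1 : (-1 : R) * -1 = 1. Proof. by rewrite mulrNN mulr1. Qed.
Let right := edge 1.
Let left := edge (-1).

Lemma right_support f : (forall h, pos_on_box h -> 0 <= E (f * h)) ->
  forall h, pos_on_box h -> 0 <= E (f * (h * (right%:P - 'X))).
Proof.
move=> fp h hp; have := edge_support tau1 fp hp.
rewrite (_ : (V0 1)%:P - Vp 1 = right%:P - 'X)//.
rewrite /Vp /right /edge scale1r mul1r polyCB.
by move: (C + 1)%:P (V0 1)%:P => c v; ring.
Qed.

Lemma left_support f : (forall h, pos_on_box h -> 0 <= E (f * h)) ->
  forall h, pos_on_box h -> 0 <= E (f * (h * ('X - left%:P))).
Proof.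
move=> fp h hp; have := edge_support tauN1 fp hp.
rewrite (_ : (V0 (-1))%:P - Vp (-1) = 'X - left%:P)//.
rewrite /Vp /left /edge scaleN1r mulN1r polyCN polyCB.
by move: (C + 1)%:P (V0 (-1))%:P => c v; ring.
Qed.

Let pos1 : pos_on_box 1. Proof. by move=> z _; rewrite hornerC. Qed.
Let E_pos1 h : pos_on_box h -> 0 <= E (1 * h).
Proof. by rewrite mul1r; exact: E_ge0. Qed.

Lemma E_cst c : E c%:P = c.
Proof. by rewrite -alg_polyC EZ E1 mulr1. Qed.

(** Newton's formula of order 2, combined with self-similarity. *)
Lemma second_moment : (1 + 2 * sigma) * E 'X^2 = - 2 * E a + ((1 + sigma) * E 'X) ^+ 2.
Proof.
have sYX n : size (Y n) = (size (X n)).+1 by rewrite sizeX sizeY.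
have sA n : (size (n%:R^-1 *: A n)%R <= 3)%N by exact: leq_trans (size_scale_leq _ _) _.
have e2 n : pincr X Y 'X^2 n = - 2 * pmean X (A n * 1) n + pincr X Y 'X n * pincr X Y 'X n.
  rewrite pincrX -['X]expr1 pincrX /increment.
  rewrite (newtonSS (sA n) (sizeB n) (sYX n) (step n)) big_ord0 subr0; congr (_ * _ + _).
  rewrite /esum_step /pmean mulr_suml; apply: eq_bigr => z _.
  by rewrite mulr1 hornerZ expr0; ring.
have l2 := pincr_ucvg (h := 'X^2).
have l1 := pincr_ucvg (h := 'X).
have := ucvg_eq l2; under eq_fun do rewrite e2.
have lA : - 2 * pmean X (A n * 1) n @[n --> U] --> - 2 * E (a * 1).
  by apply: cvgM; [exact: cvg_cst|exact: pmeanA_ucvg].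
move=> /(_ _ (cvgD lA (cvgM l1 l1))).
rewrite mulr1 deriv_exp derivX mulr1 mul1r /= !ED !EZ.
rewrite (_ : 'X * ('X *+ 2) = 2 *: 'X^2 :> {poly R}); last by rewrite -mul_polyC polyC_natr; ring.
rewrite EZ expr2; lra.
Qed.

(** The leading coefficient - a_2 - sigma of the drift is positive, so the drift is
    convex. It is nonpositive at both ends of the support, hence so is its mean,
    and with second_moment this forces the variance to vanish. *)
Lemma variance_le0 : E 'X^2 - E 'X ^+ 2 <= 0.
Proof.
pose c := (1 + sigma) * E 'X.
have h1 : (drift_poly).[right] <= 0 by exact: edge_drift tau1.
have h2 : (drift_poly).[left] <= 0 by exact: edge_drift tauN1.
have r1 : E 'X <= right.
  have := right_support E_pos1 pos1; rewrite !mul1r ED EN E_cst subr_ge0 //.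
have r2 : left <= E 'X.
  have := left_support E_pos1 pos1; rewrite !mul1r ED EN E_cst subr_ge0 //.
have r3 : 0 <= E ((right%:P - 'X) * ('X - left%:P)).
  have fp h : pos_on_box h -> 0 <= E ((right%:P - 'X) * h).
    move=> hp; rewrite mulrC -[_ * _]mul1r; exact: right_support.
  by have := left_support fp pos1; rewrite mul1r.
pose g2 := - a`_2 - sigma.
have g20 : 0 < g2 by rewrite /g2 -opprD oppr_gt0.
pose p := drift_poly + g2 *: ((right%:P - 'X) * ('X - left%:P)).
(* the quadratic terms cancel, so p is the chord of the drift between the two edges *)
have [u [v pE]] : exists u v : R, p = u *: 'X + v%:P.
  have dec : a = (a`_0)%:P + a`_1 *: 'X + a`_2 *: 'X^2.
    apply/polyP => -[|[|[|i]]]; rewrite !coefD !coefZ coefC coefX coefXn /=; try ring.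
    by rewrite nth_default ?(leq_trans size_a)//; ring.
  exists (- a`_1 + sigma * c + g2 * (right + left)), (- a`_0 - g2 * right * left).
  apply: poly_eq_horner => t _; rewrite /p /drift_poly {1}dec -/c /g2.
  by rewrite !(hornerD, hornerN, hornerZ, hornerM, hornerC, hornerX, hornerXn); ring.
have p1 : u * right + v <= 0.
  have -> : u * right + v = p.[right] by rewrite pE !(hornerD, hornerZ, hornerC, hornerX).
  have rz : (right%:P - 'X).[right] = 0 by rewrite hornerD hornerN hornerC hornerX subrr.
  have -> : p.[right] = drift_poly.[right] + g2 * ((right%:P - 'X).[right] * ('X - left%:P).[right]).
    by rewrite /p hornerD hornerZ hornerM.
  by rewrite rz; move: drift_poly.[right] h1 => d h1; rewrite mul0r mulr0 addr0.
have p2 : u * left + v <= 0.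
  have -> : u * left + v = p.[left] by rewrite pE !(hornerD, hornerZ, hornerC, hornerX).
  by rewrite /p hornerD hornerZ hornerM hornerXsubC subrr !mulr0 addr0.
have p3 : u * E 'X + v <= 0.
  have [u0|u0] := leP 0 u; first by apply: le_trans p1; rewrite lerD2r ler_wpM2l.
  by apply: le_trans p2; rewrite lerD2r ler_wnM2l// ltW.
have Ep : E p = u * E 'X + v by rewrite pE ED EZ E_cst.
have : E drift_poly <= 0.
  have -> : E drift_poly = E p - g2 * E ((right%:P - 'X) * ('X - left%:P)).
    by rewrite /p ED EZ addrK.
  by rewrite Ep subr_le0 (le_trans p3)// mulr_ge0// ltW.
have -> : E drift_poly = - E a - sigma * (E 'X^2 - (1 + sigma) * E 'X * E 'X).
  rewrite /drift_poly ED !EN EZ mulrBr ED EN -expr2 ['X * _]mulrC mul_polyC EZ //.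
by move=> h; exact: variance_arith h second_moment.
Qed.

End UltraLimit.

(** Otherwise some ultrafilter would see a variance bounded away from 0, against
    variance_le0. *)
Lemma variance_cvg0 : moment X 2 n - moment X 1 n ^+ 2 @[n --> \oo] --> (0 : R).
Proof.
apply/cvg0P => e e0; apply: contrapT => /forallNP H.
pose F : set_system nat := [set S | exists N, forall n, (N <= n)%N ->
  e < `|moment X 2 n - moment X 1 n ^+ 2| -> S n].
have FF : ProperFilter F.
  split; last split.
  - move=> [N hN]; apply: (H N) => n Nn; rewrite leNgt; apply/negP => /(hN n Nn) [].
  - by exists 0%N.
  - move=> S S' [N hN] [N' hN']; exists (maxn N N') => n nn en.
    by split; [apply: hN en|apply: hN' en]; lia.
  - by move=> S S' SS' [N hN]; exists N => n Nn en; apply/SS'/hN.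
have [U [UU FU]] := ultraFilterLemma FF.
have PU : ProperFilter U := ultra_proper.
have Uoo u (l : R) : u n @[n --> \oo] --> l -> u n @[n --> U] --> l.
  move=> ul V Vl; have [N _ hN] := ul V Vl; apply: FU; exists N => n Nn _; exact: hN.
have v0 := variance_le0 UU Uoo.
have vc : moment X 2 n - moment X 1 n ^+ 2 @[n --> U] --> E U 'X^2 - E U 'X ^+ 2.
  have m2 := pmean_ucvg UU (h := 'X^2); have m1 := pmean_ucvg UU (h := 'X).
  rewrite (_ : (fun n => _) = fun n => pmean X 'X^2 n - pmean X 'X n * pmean X 'X n).
    by rewrite expr2; apply: cvgB => //; exact: cvgM.
  by apply/funext => n; rewrite -pmeanX -(pmeanX X 1) expr1 -expr2.
have var_ge0 n : (0 < n)%N -> 0 <= moment X 2 n - moment X 1 n ^+ 2.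
  move=> n0.
  have m0 : moment X 0 n = 1.
    rewrite /moment /psum big_const_seq count_predT iter_addr_0 sizeX divff//.
    by rewrite pnatr_eq0 -lt0n.
  have -> : moment X 2 n - moment X 1 n ^+ 2 = pmean X (('X - (moment X 1 n)%:P) ^+ 2) n.
    rewrite (_ : _ ^+ 2 = 'X^2 + (- 2 * moment X 1 n) *: 'X^1 + moment X 1 n ^+ 2 *: 'X^0).
      by rewrite !pmeanD !pmeanZ !pmeanX m0; ring.
    apply: poly_eq_horner => t _.
    by rewrite horner_exp hornerXsubC !(hornerD, hornerZ, hornerXn); ring.
  apply: pmean_ge0 (X_bounded (n := n)) _ => z _.
  by rewrite horner_exp sqr_ge0.
have : e <= E U 'X^2 - E U 'X ^+ 2.
  rewrite -(cvg_lim (@Rhausdorff R) vc); apply: limr_ge; first by apply/cvg_ex; eexists; exact: vc.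
  apply: FU; exists 1%N => n n1 en; rewrite /= -[leRHS]ger0_norm ?var_ge0//.
  exact: ltW.
by rewrite leNgt (le_lt_trans v0).
Qed.

End Rigidity.

(** * Convergence of all moments *)

Lemma cvgn_sub0 (R : realType) (u : nat -> R) (l : R) :
  u n @[n --> \oo] --> l -> u n - l @[n --> \oo] --> (0 : R).
Proof. by move=> ul; have := cvgB ul (cvg_cst l); rewrite subrr; apply. Qed.

Lemma sqr_cvg0 (R : realType) (u v : nat -> R) : (forall n, u n ^+ 2 <= v n) ->
  v n @[n --> \oo] --> (0 : R) -> u n @[n --> \oo] --> (0 : R).
Proof.
move=> uv /cvg0P h; apply/cvg0P => e e0.
have [N hN] := h (e ^+ 2) ltac:(by rewrite exprn_gt0).
exists N => n Nn; rewrite -[leRHS]ger0_norm ?(ltW e0)// -ler_sqr ?nnegrE// -!normrX.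
rewrite ger0_norm ?sqr_ge0// (le_trans (uv n))// (le_trans (ler_norm _))//.
by rewrite (le_trans (hN n Nn))// ler_norm.
Qed.

(** With increments tending to 0, w cannot jump between the two square roots of d. *)
Lemma sqr_cvg (R : realType) (w : nat -> R) (d : R) :
  w n ^+ 2 @[n --> \oo] --> d -> w n.+1 - w n @[n --> \oo] --> (0 : R) ->
  exists l : R, w n @[n --> \oo] --> l.
Proof.
move=> wd dw.
have aw : `|w n| @[n --> \oo] --> Num.sqrt d.
  apply: (cvgn_ext (v := fun n => Num.sqrt (w n ^+ 2))) => [n|]; first by rewrite sqrtr_sqr.
  by apply: (continuous_cvg _ (@sqrt_continuous R d)).
have [s0|s0] := eqVneq (Num.sqrt d) 0.
  by exists 0; rewrite s0 in aw; apply: norm_cvg0.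
have sp : 0 < Num.sqrt d by rewrite lt_neqAle eq_sym s0 sqrtr_ge0.
set s := Num.sqrt d in aw s0 sp.
have s2 : 0 < s / 2 by rewrite divr_gt0.
have /cvgrPdist_lt/(_ _ s2)[N1 _ hN1] := aw.
have /cvg0P/(_ (s / 2) s2)[N2 hN2] := dw.
pose N := maxn N1 N2.
have big n : (N <= n)%N -> s / 2 < `|w n|.
  move=> Nn; have /= := hN1 n ltac:(rewrite /=; lia).
  by rewrite ltr_norml => /andP[_ ?]; lra.
have same n : (N <= n)%N -> (0 < w n) = (0 < w N).
  elim: n => [|n IH]; first by rewrite leqn0 => /eqP->.
  rewrite leq_eqVlt => /predU1P[->//|Nn]; rewrite -IH//.
  have b1 := big n Nn; have b2 := big n.+1 (leqW Nn).
  have := hN2 n ltac:(lia); rewrite ler_norml => /andP[d1 d2].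
  move: b1 b2 d1 d2; case: (ltP 0 (w n)) => p1; case: (ltP 0 (w n.+1)) => p2 //.
    by rewrite gtr0_norm// ler0_norm//; lra.
  by rewrite ler0_norm// gtr0_norm//; lra.
have [pN|nN] := ltP 0 (w N).
  exists s; apply: (cvgn_near (N := N) (v := fun n => `|w n|)) => // n Nn.
  by rewrite gtr0_norm// same.
exists (- s); apply: (cvgn_near (N := N) (v := fun n => - `|w n|)) => [n Nn|].
  by rewrite ler0_norm ?opprK// leNgt same// -leNgt.
exact: cvgN.
Qed.

Section AllMoments.
Variables (R : realType) (X Y : nat -> seq R) (A B : nat -> {poly R}) (a b : {poly R}).
Variables (phi : nat -> R) (sigma C : R).
Hypothesis sizeX : forall n, size (X n) = n.
Hypothesis sizeY : forall n, size (Y n) = n.+1.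
Hypothesis sizeA : forall n, (size (A n) <= 3)%N.
Hypothesis sizeB : forall n, (size (B n) <= 2)%N.
Hypothesis size_a : (size a <= 3)%N.
Hypothesis step : forall n, roots_poly (Y n) =
  (n%:R^-1 *: A n) * (roots_poly (X n))^`() + B n * roots_poly (X n).
Hypothesis cvg_A : forall i, (A n)`_i @[n --> \oo] --> a`_i.
Hypothesis cvg_B : forall i, (B n)`_i @[n --> \oo] --> b`_i.
Hypothesis phi_gt0 : forall n, (0 < n)%N -> 0 < phi n.
Hypothesis scaling : forall K n, (0 < n)%N ->
  psum K (X n.+1) * phi n.+1 ^+ K = psum K (Y n) * phi n ^+ K.
Hypothesis X_bounded : forall n z, z \in X n -> `|z| <= C.
Hypothesis A_neg : forall n z, z \in X n -> (A n).[z] <= 0.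
Hypothesis increment1_bounded : forall n, `|increment X Y 1 n| <= C.
Hypothesis sigma_ge0 : 0 <= sigma.
Hypothesis karamata_phi : forall K,
  (\sum_(1 <= j < n) phi j ^+ K) / (n%:R * phi n ^+ K) @[n --> \oo] --> (1 + K%:R * sigma)^-1.

Let spec K : moment_spec X Y a sigma K :=
  moment_all sizeX sizeY sizeA sizeB step cvg_A cvg_B phi_gt0 scaling X_bounded sigma_ge0
    karamata_phi K.

Lemma increment_self_similar K :
  increment X Y K n - (1 + K%:R * sigma) * moment X K n @[n --> \oo] --> (0 : R).
Proof. by have [] := spec K. Qed.

(** If a_2 + sigma >= 0 all drift constants are positive. Otherwise the variance
    vanishes: Newton's formula of order 2 makes the mean an approximate root of a
    fixed quadratic polynomial, and as its increments tend to 0 it settles on one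
    root; by Cauchy-Schwarz the moment of order K then follows the K-th power of
    the mean. *)
Lemma moment_cvg K : exists l : R, moment X K n @[n --> \oo] --> l.
Proof.
have [st|un] := leP 0 (a`_2 + sigma).
  have [_ _ h] := spec K; apply: h; rewrite /kap.
  have -> : K%:R * a`_2 + 1 + K%:R * sigma = K%:R * (a`_2 + sigma) + 1 by ring.
  by rewrite ltr_wpDl ?mulr_ge0.
have var0 := variance_cvg0 sizeX sizeY sizeA sizeB size_a step cvg_A X_bounded A_neg
  increment1_bounded sigma_ge0 increment_self_similar un.
set m := moment X 1 in var0 *.
have [l hl] : exists l : R, m n @[n --> \oo] --> l.
  pose q2 := 2 * a`_2 - sigma ^+ 2.
  have q2n : q2 < 0.
    have : 0 <= sigma ^+ 2 by rewrite sqr_ge0.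
    by rewrite /q2; move: un sigma_ge0; move: a`_2 (sigma ^+ 2) => p q; lra.
  have quad : q2 * m n ^+ 2 + 2 * a`_1 * m n + 2 * a`_0 @[n --> \oo] --> (0 : R).
    have bd K0 := moment_bounded sizeX X_bounded K0.
    have A0 i : (A n)`_i - a`_i @[n --> \oo] --> (0 : R).
      exact: cvgn_sub0 (@cvg_A i).
    have m00 : moment X 0 n - 1 @[n --> \oo] --> (0 : R).
      exact: cvgn_sub0 (moment0 sizeX).
    have t1 := increment_self_similar 1; have t2 := increment_self_similar 2.
    apply: (cvgn_ext (v := fun n => - (1 + 2 * sigma + 2 * a`_2) * (moment X 2 n - m n ^+ 2)
      - (increment X Y 2 n - (1 + 2%:R * sigma) * moment X 2 n)
      - 2 * (((A n)`_2 - a`_2) * moment X 2 n + ((A n)`_1 - a`_1) * m n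
             + ((A n)`_0 - a`_0) * moment X 0 n + a`_0 * (moment X 0 n - 1))
      + ((increment X Y 1 n - (1 + 1%:R * sigma) * m n) ^+ 2
         + (increment X Y 1 n - (1 + 1%:R * sigma) * m n) * (2 * (1 + sigma) * m n)))) => [n|].
      have := incrementSS sizeX sizeY sizeA sizeB step 0 n; rewrite big_ord0 subr0 => ->.
      by rewrite /q2 /m; ring.
    have z l : l * 0 = 0 :> R by rewrite mulr0.
    rewrite -[X in _ --> X](_ : - (1 + 2 * sigma + 2 * a`_2) * 0 - 0 - 2 * (0 + 0 + 0 + a`_0 * 0)
      + (0 ^+ 2 + 0) = 0); last by ring.
    apply: cvgD; [apply: cvgB; [apply: cvgB => //|]|apply: cvgD].
    - by apply: cvgM => //; exact: cvg_cst.
    - apply: cvgM; first exact: cvg_cst.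
      apply: cvgD; last by apply: cvgM => //; exact: cvg_cst.
      by apply: cvgD; [apply: cvgD|]; apply: cvg0M_bounded (A0 _) (bd _).
    - by under eq_fun do rewrite expr2; rewrite expr2; exact: cvgM.
    - apply: (cvg0M_bounded (C := `|2 * (1 + sigma)| * C ^+ 1)) => // n.
      by rewrite normrM ler_wpM2l// bd.
  pose k := a`_1 / q2.
  have [l hl] : exists l : R, m n + k @[n --> \oo] --> l.
    apply: (@sqr_cvg _ _ (k ^+ 2 - 2 * a`_0 / q2)).
      apply: (cvgn_ext (v := fun n => (q2 * m n ^+ 2 + 2 * a`_1 * m n + 2 * a`_0) / q2
        + (k ^+ 2 - 2 * a`_0 / q2))) => [n|]; first by rewrite /k; field; rewrite lt_eqF.
      rewrite -[X in _ --> X]add0r; apply: cvgD; last exact: cvg_cst.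
      by have := cvgM quad (cvg_cst q2^-1); rewrite mul0r; apply.
    have [sl _ _] := spec 1.
    apply: (cvgn_ext (v := fun n => m n.+1 - m n)) => [n|]; first by rewrite opprD addrACA subrr addr0.
    exact: slow_diff0 sl.
  exists (l - k); apply: (cvgn_ext (v := fun n => (m n + k) - k)) => [n|]; first by ring.
  by apply: cvgB => //; exact: cvg_cst.
exists (l ^+ K); elim: K => [|K IH]; first by rewrite expr0; exact: moment0 sizeX.
have cov0 : moment X K.+1 n - m n * moment X K n @[n --> \oo] --> (0 : R).
  apply: (sqr_cvg0 (v := fun n => (moment X 2 n - m n ^+ 2) * moment X K.*2 n)) => [n|]; last first.
    exact: cvg0M_bounded var0 (moment_bounded sizeX X_bounded K.*2).
  have [->|n0] := posnP n.
    by rewrite /m /moment invr0 !mulr0 ?mul0r !subr0 ?expr0n.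
  have m0 : moment X 0 n = 1.
    rewrite /moment /psum big_const_seq count_predT iter_addr_0 sizeX divff//.
    by rewrite pnatr_eq0 -lt0n.
  have sq (h : {poly R}) : 0 <= pmean X (h ^+ 2) n.
    apply: pmean_ge0 (X_bounded (n := n)) _ => z _; by rewrite horner_exp sqr_ge0.
  have expand t : ('X^K - t *: ('X - (m n)%:P)) ^+ 2 = 'X^(K.*2) + (- 2 * t) *: 'X^(K.+1)
      + (2 * t * m n) *: 'X^K + t ^+ 2 *: 'X^2 + (- 2 * t ^+ 2 * m n) *: 'X^1
      + (t ^+ 2 * m n ^+ 2) *: 'X^0 :> {poly R}.
    apply: poly_eq_horner => u _; rewrite horner_exp.
    rewrite !(hornerD, hornerN, hornerZ, hornerXn, hornerX, hornerC) -addnn exprD (exprS u K).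
    by move: (u ^+ K) => uK; ring.
  have exp t : moment X K.*2 n - 2 * t * (moment X K.+1 n - m n * moment X K n)
      + t ^+ 2 * (moment X 2 n - m n ^+ 2) = pmean X (('X^K - t *: ('X - (m n)%:P)) ^+ 2) n.
    by rewrite expand !pmeanD !pmeanZ !pmeanX m0 -/m; ring.
  apply: quad_discriminant => [|t]; last by rewrite exp.
  have := sq ('X - (m n)%:P); congr (0 <= _).
  rewrite (_ : _ ^+ 2 = 'X^2 + (- 2 * m n) *: 'X^1 + (m n ^+ 2) *: 'X^0).
    by rewrite !pmeanD !pmeanZ !pmeanX m0 -/m; ring.
  apply: poly_eq_horner => u _.
  by rewrite horner_exp !(hornerD, hornerN, hornerZ, hornerXn, hornerX, hornerC); ring.
apply: (cvgn_ext (v := fun n => (moment X K.+1 n - m n * moment X K n) + m n * moment X K n)) => [n|].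
  by rewrite subrK.
by rewrite exprS -[X in _ --> X]add0r; apply: cvgD => //; exact: cvgM.
Qed.

End AllMoments.

(** * Complex sequences *)

Lemma cvgn_of_sub0 (R : realType) (u : nat -> R) (l : R) :
  u n - l @[n --> \oo] --> (0 : R) -> u n @[n --> \oo] --> l.
Proof.
move=> h; have h2 := cvgD h (cvg_cst l); rewrite add0r in h2.
apply: (@cvgn_ext R u (fun n => u n - l + l)) => [n|]; last exact: h2.
by rewrite subrK.
Qed.

Section ComplexSequences.
Variable R : realType.
Implicit Types (u v : nat -> R[i]) (l m z w : R[i]).

(** The modulus as a real number; the norm of R[i] has values in R[i]. *)
Definition cn z : R := complex.ComplexField.Normc.normc z.

Lemma normr_cn z : `|z| = (cn z)%:C. Proof. by []. Qed.
Lemma cn_ge0 z : 0 <= cn z.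
Proof. by rewrite -ler0c -normr_cn normr_ge0. Qed.
Lemma cnD z w : cn (z + w) <= cn z + cn w.
Proof. by rewrite -lecR rmorphD /= -!normr_cn ler_normD. Qed.
Lemma cnM z w : cn (z * w) = cn z * cn w.
Proof. exact: complex.ComplexField.Normc.normcM. Qed.
Lemma cnN z : cn (- z) = cn z.
Proof. by apply: (@complexI R); rewrite -!normr_cn normrN. Qed.
Lemma cn_distC z w : cn (z - w) = cn (w - z).
Proof. by rewrite -cnN opprB. Qed.
Lemma cnV z : cn z^-1 = (cn z)^-1.
Proof. exact: complex.ComplexField.Normc.normcV. Qed.
Lemma cnR (r : R) : cn r%:C = `|r|.
Proof. by rewrite /cn /= expr0n /= addr0 sqrtr_sqr. Qed.
Lemma cn0 : cn 0 = 0. Proof. by rewrite -(rmorph0 (real_complex R)) cnR normr0. Qed.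
Lemma cn1 : cn 1 = 1. Proof. by rewrite -(rmorph1 (real_complex R)) cnR normr1. Qed.
Lemma cnX z n : cn (z ^+ n) = cn z ^+ n.
Proof. by elim: n => [|n IH]; rewrite ?expr0 ?cn1// !exprS cnM IH. Qed.
Lemma cn_eq0 z : (cn z == 0) = (z == 0).
Proof.
apply/eqP/eqP => [/complex.ComplexField.Normc.eq0_normc//|->]; exact: cn0.
Qed.
Lemma cn_gt0 z : (0 < cn z) = (z != 0).
Proof. by rewrite lt0r cn_ge0 andbT cn_eq0. Qed.
Lemma cnB z w : cn z - cn w <= cn (z - w).
Proof. by rewrite lerBlDr (le_trans _ (cnD _ _)) // subrK. Qed.
Lemma cn_sum (I : Type) (s : seq I) (F : I -> R[i]) :
  cn (\sum_(i <- s) F i) <= \sum_(i <- s) cn (F i).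
Proof.
elim: s => [|x s IH]; rewrite ?big_nil ?cn0// !big_cons.
by rewrite (le_trans (cnD _ _)) // lerD2l.
Qed.
Lemma Re_le_cn z : `|complex.Re z| <= cn z.
Proof. by rewrite -lecR; apply: normc_ge_Re. Qed.
Lemma Im_le_cn z : `|complex.Im z| <= cn z.
Proof.
have := Re_le_cn (z * 'i%C); rewrite ReiNIm normrN cnM => /le_trans; apply.
by rewrite [cn 'i%C]/cn /= expr0n expr1n add0r sqrtr1 mulr1.
Qed.
Lemma cn_le_ReIm z : cn z <= `|complex.Re z| + `|complex.Im z|.
Proof.
rewrite {1}(complexE z) (le_trans (cnD _ _)) // cnM !cnR.
by rewrite [cn 'i%C]/cn /= expr0n expr1n add0r sqrtr1 mul1r.
Qed.
Lemma cn_sqr z : cn z ^+ 2 = complex.Re z ^+ 2 + complex.Im z ^+ 2.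
Proof. by apply: (@complexI R); rewrite add_Re2_Im2 normr_cn rmorphXn. Qed.

(** Convergence in terms of the real modulus; cvgC_of_cn and ccvg_of_cvgC link such
    estimates with the topology of R[i]. *)
Definition ccvg u l := forall e : R, 0 < e -> exists N, forall n, (N <= n)%N -> cn (u n - l) <= e.

Lemma ccvgP u l : ccvg u l <->
  (complex.Re (u n) @[n --> \oo] --> complex.Re l) /\ (complex.Im (u n) @[n --> \oo] --> complex.Im l).
Proof.
split=> [ul|[uRe uIm] e e0].
  split.
    apply: (@cvgn_of_sub0 _ (fun n => complex.Re (u n))).
    apply/cvg0P => e /ul[N uN]; exists N => n /uN; apply: le_trans.
    by rewrite -raddfB Re_le_cn.
  apply: (@cvgn_of_sub0 _ (fun n => complex.Im (u n))).
  apply/cvg0P => e /ul[N uN]; exists N => n /uN; apply: le_trans.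
  by rewrite -raddfB Im_le_cn.
have h1 : complex.Re (u n) - complex.Re l @[n --> \oo] --> (0 : R).
  exact: cvgn_sub0.
have h2 : complex.Im (u n) - complex.Im l @[n --> \oo] --> (0 : R).
  exact: cvgn_sub0.
have e2 : 0 < e / 2 by rewrite divr_gt0.
move/cvg0P/(_ _ e2): h1 => [N1 h1]; move/cvg0P/(_ _ e2): h2 => [N2 h2].
exists (maxn N1 N2) => n; rewrite geq_max => /andP[/h1 + /h2].
have := cn_le_ReIm (u n - l); rewrite !raddfB /=; lra.
Qed.

Lemma ccvg_uniq u l m : ccvg u l -> ccvg u m -> l = m.
Proof.
move=> /ccvgP[ul1 ul2] /ccvgP[um1 um2].
apply/eqP; rewrite eq_complex; apply/andP; split; apply/eqP.
  exact: (@cvg_unique _ (@Rhausdorff R) _ _ _ _ ul1 um1).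
exact: (@cvg_unique _ (@Rhausdorff R) _ _ _ _ ul2 um2).
Qed.

Lemma ccvg_cst l : ccvg (fun=> l) l.
Proof. by move=> e e0; exists 0%N => n _; rewrite subrr cn0 ltW. Qed.

Lemma ccvg_near u v l N : (forall n, (N <= n)%N -> u n = v n) -> ccvg v l -> ccvg u l.
Proof.
move=> uv vl e /vl[M vM]; exists (maxn N M) => n; rewrite geq_max => /andP[Nn Mn].
by rewrite uv // vM.
Qed.

Lemma ccvg_ext u v l : u =1 v -> ccvg v l -> ccvg u l.
Proof. by move=> uv; apply: (@ccvg_near _ _ _ 0%N) => n _; apply: uv. Qed.

Lemma ccvgD u v l m : ccvg u l -> ccvg v m -> ccvg (fun n => u n + v n) (l + m).
Proof.
move=> ul vm e e0; have e2 : 0 < e / 2 by rewrite divr_gt0.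
have [N1 h1] := ul _ e2; have [N2 h2] := vm _ e2.
exists (maxn N1 N2) => n; rewrite geq_max => /andP[/h1 + /h2].
have := cnD (u n - l) (v n - m).
have -> : u n - l + (v n - m) = u n + v n - (l + m) by ring.
lra.
Qed.

Lemma ccvgN u l : ccvg u l -> ccvg (fun n => - u n) (- l).
Proof.
by move=> ul e /ul[N uN]; exists N => n /uN; rewrite -opprD cnN.
Qed.

Lemma ccvgB u v l m : ccvg u l -> ccvg v m -> ccvg (fun n => u n - v n) (l - m).
Proof. by move=> ul /ccvgN vm; apply: ccvgD. Qed.

Lemma ReM z w : complex.Re (z * w) = complex.Re z * complex.Re w - complex.Im z * complex.Im w.
Proof. by case: z => a b; case: w => c d. Qed.
Lemma ImM z w : complex.Im (z * w) = complex.Re z * complex.Im w + complex.Im z * complex.Re w.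
Proof. by case: z => a b; case: w => c d. Qed.

Lemma ccvgM u v l m : ccvg u l -> ccvg v m -> ccvg (fun n => u n * v n) (l * m).
Proof.
move=> /ccvgP[ul1 ul2] /ccvgP[vm1 vm2]; apply/ccvgP; split.
  rewrite ReM; apply: (@cvgn_ext _ _ (fun n => complex.Re (u n) * complex.Re (v n) - complex.Im (u n) * complex.Im (v n))).
    by move=> n; rewrite ReM.
  by apply: cvgB; apply: cvgM.
rewrite ImM; apply: (@cvgn_ext _ _ (fun n => complex.Re (u n) * complex.Im (v n) + complex.Im (u n) * complex.Re (v n))).
  by move=> n; rewrite ImM.
by apply: cvgD; apply: cvgM.
Qed.

Lemma ccvgZ c u l : ccvg u l -> ccvg (fun n => c * u n) (c * l).
Proof. by move=> ul; apply: ccvgM => //; apply: ccvg_cst. Qed.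

Lemma ccvg_sum (I : Type) (s : seq I) (F : I -> nat -> R[i]) (l : I -> R[i]) :
  (forall i, ccvg (F i) (l i)) -> ccvg (fun n => \sum_(i <- s) F i n) (\sum_(i <- s) l i).
Proof.
move=> Fl; elim: s => [|i s IH].
  by rewrite big_nil; apply: (ccvg_ext (v := fun=> 0)) => [n|]; [rewrite big_nil | exact: ccvg_cst].
rewrite big_cons; apply: (ccvg_ext (v := fun n => F i n + \sum_(i <- s) F i n)) => [n|].
  by rewrite big_cons.
exact: ccvgD.
Qed.

Lemma ccvgR (r : nat -> R) (s : R) : (r n @[n --> \oo] --> s) -> ccvg (fun n => (r n)%:C) s%:C.
Proof. by move=> rs; apply/ccvgP; split => //; apply: cvg_cst. Qed.

Lemma ccvg_le u l (D : R) (N : nat) : ccvg u l -> (forall n, (N <= n)%N -> cn (u n) <= D) -> cn l <= D.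
Proof.
move=> ul uD; apply/ler_addgt0Pr => e e0; have [M uM] := ul _ e0.
have h1 := uM _ (leq_maxr N M); have h2 := uD _ (leq_maxl N M).
have := cnB l (u (maxn N M)); rewrite (cn_distC l); lra.
Qed.

Lemma real_cauchy (r : nat -> R) :
  (forall e : R, 0 < e -> exists N, forall n k, (N <= n)%N -> (N <= k)%N -> `|r n - r k| <= e) ->
  exists s : R, r n @[n --> \oo] --> s.
Proof.
move=> h; exists (lim (r n @[n --> \oo])).
have : cvg (r n @[n --> \oo]); last by [].
apply/cauchy_cvgP; apply: cauchy_exP => e e0.
have [|N hN] := h (e / 2); first by rewrite divr_gt0.
exists (r N); exists N => // n /= Nn; rewrite -ball_normE /=.
by apply: le_lt_trans (_ : e / 2 < e); [exact: hN | lra].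
Qed.

(** A uniform limit of convergent sequences is a Cauchy sequence. *)
Lemma ccvg_approx u : (forall e : R, 0 < e -> exists v l,
    ccvg v l /\ exists N, forall n, (N <= n)%N -> cn (u n - v n) <= e) ->
  exists l, ccvg u l.
Proof.
move=> h.
have cauchy e : 0 < e -> exists N, forall n k, (N <= n)%N -> (N <= k)%N -> cn (u n - u k) <= e.
  move=> e0; have e4 : 0 < e / 4 by rewrite divr_gt0.
  have [v [l [vl [N uv]]]] := h _ e4; have [M vM] := vl _ e4.
  exists (maxn N M) => n k; rewrite !geq_max => /andP[/uv n1 /vM n2] /andP[/uv k1 /vM m2].
  have h1 := cnD (u n - v n) (v n - l); have h2 := cnD (u k - v k) (v k - l).
  have := cnD (u n - v n + (v n - l)) (- (u k - v k + (v k - l))).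
  rewrite cnN.
  have -> : u n - v n + (v n - l) - (u k - v k + (v k - l)) = u n - u k by ring.
  lra.
have [|r ur] := @real_cauchy (fun n => complex.Re (u n)).
  move=> e /cauchy[N uN]; exists N => n m Nn Nm.
  by rewrite -raddfB (le_trans (Re_le_cn _)) // uN.
have [|s us] := @real_cauchy (fun n => complex.Im (u n)).
  move=> e /cauchy[N uN]; exists N => n m Nn Nm.
  by rewrite -raddfB (le_trans (Im_le_cn _)) // uN.
by exists (r +i* s); apply/ccvgP.
Qed.

End ComplexSequences.

(** * Polynomial approximation of the Cauchy kernel on a segment *)

(** With r = q ^ 2 and q^-1 = 1 + h, Bernoulli gives q ^ M <= 1 / (k (M + 1)) for
    k = min 1 h, so M.+1 * r ^ M is at most 1 / (k ^ 2 (M + 1)). *)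
Lemma geometric_small (R : realType) (r K e : R) : 0 <= r < 1 -> 0 <= K -> 0 < e ->
  exists M : nat, M.+1%:R * r ^+ M * K <= e.
Proof.
move=> /andP[r0 r1] K0 e0.
have [->|rn0] := eqVneq r 0; first by exists 1%N; rewrite expr1 mulr0 mul0r ltW.
have rgt0 : 0 < r by rewrite lt0r rn0.
set q := sqrtr r; have q0 : 0 < q by rewrite sqrtr_gt0.
have qq : q ^+ 2 = r by rewrite sqr_sqrtr.
have q1 : q < 1 by rewrite -sqrtr1 ltr_sqrt.
set h := q^-1 - 1; have h0 : 0 < h by rewrite subr_gt0 invf_gt1.
set k := minr 1 h; have k0 : 0 < k by rewrite lt_min ltr01.
have kh : k <= h by rewrite ge_min lexx orbT.
have k1 : k <= 1 by rewrite ge_min lexx.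
have bern M : M.+1%:R * k <= (q^-1) ^+ M.
  elim: M => [|M IH]; first by rewrite expr0 mul1r.
  have h1 : 1 + k <= q^-1 by rewrite -lerBrDl.
  have h2 : 1 <= q^-1 ^+ M by rewrite exprn_ege1 // invf_ge1 // ltW.
  rewrite exprS; apply: (@le_trans _ _ ((1 + k) * q^-1 ^+ M)).
    by rewrite -natr1; move: IH h2 k0; nra.
  by apply: ler_wpM2r => //; apply: le_trans h2.
exists (truncn (K / (k ^+ 2 * e))).
set M := truncn _.
have MK : K / (k ^+ 2 * e) < M.+1%:R.
  by rewrite /M truncnS_gt // divr_ge0 // mulr_ge0 ?exprn_ge0 ?(ltW k0) ?(ltW e0).
move: MK; rewrite ltr_pdivrMr ?mulr_gt0 ?exprn_gt0// => MK.
have h2 : M.+1%:R ^+ 2 * k ^+ 2 * r ^+ M <= 1.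
  rewrite -qq -exprM mulnC exprM -!exprMn -[leRHS](expr1n _ 2).
  have : M.+1%:R * k * q ^+ M <= 1.
    have := ler_wpM2r (exprn_ge0 M (ltW q0)) (bern M).
    by rewrite exprVn mulVf // gt_eqF // exprn_gt0.
  by rewrite ler_sqr ?nnegrE ?ler01// !mulr_ge0 ?exprn_ge0 ?(ltW q0) ?(ltW k0).
have M0 : 0 < M.+1%:R :> R by [].
have rM : 0 <= r ^+ M by rewrite exprn_ge0.
have h3 : M.+1%:R * r ^+ M * K <= M.+1%:R * r ^+ M * (M.+1%:R * (k ^+ 2 * e)).
  by apply: ler_wpM2l; rewrite ?mulr_ge0// ltW.
apply: (le_trans h3).
have -> : M.+1%:R * r ^+ M * (M.+1%:R * (k ^+ 2 * e)) = (M.+1%:R ^+ 2 * k ^+ 2 * r ^+ M) * e by ring.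
by rewrite -[leRHS]mul1r ler_wpM2r // ltW.
Qed.

Section Approximation.
Variable R : realType.
Implicit Types (z c : R[i]) (lo hi : R).

Lemma cn_nat n : cn (n%:R : R[i]) = n%:R.
Proof.
have -> : (n%:R : R[i]) = (n%:R)%:C by rewrite (rmorph_nat (real_complex R)).
by rewrite cnR normr_nat.
Qed.

Definition away (d : R) z lo hi := forall y : R, lo <= y <= hi -> d <= cn (z - y%:C).

(** The distance from z to the segment is positive, and remains so for a slightly
    longer segment. *)
Lemma away_enlarge z lo hi : lo <= hi -> ~ real_segment lo hi z ->
  exists2 d : R, 0 < d & away d z (lo - d) (hi + d).
Proof.
move=> lohi zN.
have [im0|imN] := eqVneq (complex.Im z) 0; last first.
  exists `|complex.Im z| => [|y _]; first by rewrite normr_gt0.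
  by apply: le_trans (Im_le_cn _); rewrite raddfB /= subr0.
have zE : z = (complex.Re z)%:C by case: z im0 {zN} => u v /= ->.
set u := complex.Re z in zE.
have Re_le y : `|u - y| <= cn (z - y%:C).
  by apply: le_trans (Re_le_cn _); rewrite raddfB.
have [ulo|] := ltP u lo.
  exists ((lo - u) / 2) => [|y /andP[y1 y2]]; first by rewrite divr_gt0 // subr_gt0.
  apply: le_trans (Re_le y); rewrite distrC ger0_norm; move: y1 ulo; lra.
have [hiu|] := ltP hi u.
  exists ((u - hi) / 2) => [|y /andP[y1 y2]]; first by rewrite divr_gt0 // subr_gt0.
  apply: le_trans (Re_le y); rewrite ger0_norm; move: y2 hiu; lra.
move=> uhi lou; exfalso; apply: zN; exists u; last by rewrite zE.
by rewrite /= in_itv /= lou uhi.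
Qed.

(** With such a centre c the kernel 1 / (z - y) is a geometric series in
    (y - c) / (z - c), uniformly on the whole segment. For real z the far end of
    the segment serves as centre. *)
Lemma geom_center z lo hi d : lo <= hi -> 0 < d -> away d z lo hi ->
  exists c r, [/\ 0 <= r < 1, 0 < cn (z - c) &
    forall y : R, lo <= y <= hi -> cn (y%:C - c) <= r * cn (z - c)].
Proof.
move=> lohi d0 zaw.
set u := complex.Re z; set v := complex.Im z.
have zE : z = u +i* v by rewrite /u /v; case: (z).
have [im0|imN] := eqVneq v 0.
  have zR : z = u%:C by rewrite zE im0.
  have [ulo|lou] := ltP u lo.
    have g0 : 0 < hi - u by move: ulo lohi; lra.
    exists hi%:C, ((hi - lo) / (hi - u)); rewrite zR -rmorphB cnR distrC gtr0_norm//; split => //.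
      by rewrite divr_ge0 ?(ltW g0) ?subr_ge0//= ltr_pdivrMr // mul1r; move: ulo; lra.
    move=> y /andP[y1 y2]; rewrite -rmorphB cnR divfK ?gt_eqF// distrC ger0_norm ?subr_ge0//.
    by rewrite lerD2l lerN2.
  have [hiu|uhi] := ltP hi u.
    have g0 : 0 < u - lo by move: hiu lohi; lra.
    exists lo%:C, ((hi - lo) / (u - lo)); rewrite zR -rmorphB cnR gtr0_norm//; split => //.
      by rewrite divr_ge0 ?(ltW g0) ?subr_ge0//= ltr_pdivrMr // mul1r; move: hiu; lra.
    move=> y /andP[y1 y2]; rewrite -rmorphB cnR divfK ?gt_eqF// ger0_norm ?subr_ge0//.
    by rewrite lerD2r.
  have := zaw u; rewrite lou uhi zR subrr cn0 => /(_ isT); move: d0; lra.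
(* the centre lies on the vertical line through z, across the real axis, and so far
   away that the segment is almost a point seen from there *)
set V := `|v|; have V0 : 0 < V by rewrite normr_gt0.
set B := (hi - u) ^+ 2 + (lo - u) ^+ 2.
have B0 : 0 <= B by rewrite addr_ge0 // sqr_ge0.
set T := B / V; have T0 : 0 <= T by rewrite divr_ge0 // ltW.
have TV : T * V = B by rewrite divfK // gt_eqF.
set c := u +i* (- (sgr v * T)).
have TV0 : 0 < T + V by apply: ltr_wpDl.
have sgv : sgr v ^+ 2 = 1 by rewrite sqr_sg imN.
have vE : v = sgr v * V by rewrite /V -numEsg.
have zc : cn (z - c) = T + V.
  apply/eqP; rewrite -(@eqrXn2 _ 2) ?cn_ge0 ?(ltW TV0)// cn_sqr zE /= subrr expr0n /= add0r.
  rewrite opprK {1}vE -mulrDr exprMn sgv mul1r; apply/eqP; ring.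
set r := sqrtr (T / (T + V)).
have r2 : r ^+ 2 = T / (T + V) by rewrite sqr_sqrtr // divr_ge0 // ltW.
exists c, r; rewrite zc; split => //.
  rewrite sqrtr_ge0 /= -sqrtr1 ltr_sqrt // ltr_pdivrMr // mul1r ltrDl//.
move=> y /andP[y1 y2].
rewrite -(@ler_sqr _ _) ?nnegrE ?cn_ge0 ?mulr_ge0 ?sqrtr_ge0 ?(ltW TV0)//.
rewrite cn_sqr exprMn r2 /= sub0r opprK exprMn sgv mul1r.
have -> : T / (T + V) * (T + V) ^+ 2 = T * V + T ^+ 2.
  rewrite expr2 mulrA divfK ?gt_eqF//; ring.
rewrite lerD2r TV /B.
have [yu|uy] := leP u y.
  by apply: ler_wpDr; rewrite ?sqr_ge0// ler_sqr ?nnegrE ?subr_ge0// ?lerD2r// (le_trans yu).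
apply: ler_wpDl; rewrite ?sqr_ge0//.
rewrite -(sqrrN (y - u)) -(sqrrN (lo - u)) !opprB ler_sqr ?nnegrE ?subr_ge0 ?(ltW uy)//.
  by rewrite lerD2l lerN2.
by rewrite (le_trans y1) // ltW.
Qed.

Lemma expr_lipschitz (w w' : R[i]) (r : R) N : 0 <= r -> cn w <= r -> cn w' <= r ->
  cn (w ^+ N.+1 - w' ^+ N.+1) <= N.+1%:R * r ^+ N * cn (w - w').
Proof.
move=> r0 wr wr'; elim: N => [|N IH]; first by rewrite !expr1 expr0 !mul1r.
have -> : w ^+ N.+2 - w' ^+ N.+2 = w * (w ^+ N.+1 - w' ^+ N.+1) + (w - w') * w' ^+ N.+1.
  by rewrite !exprS; ring.
apply: (le_trans (cnD _ _)); rewrite !cnM cnX.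
have -> : N.+2%:R * r ^+ N.+1 * cn (w - w') =
   r * (N.+1%:R * r ^+ N * cn (w - w')) + cn (w - w') * r ^+ N.+1.
  by rewrite -natr1 exprS; ring.
apply: lerD.
  by apply: ler_pM; rewrite ?cn_ge0.
by apply: ler_wpM2l; rewrite ?cn_ge0// lerXn2r ?nnegrE ?cn_ge0.
Qed.

(** Closeness of the derivatives and a small Lipschitz constant of the error are
    both part of the notion: increments over interlacing zeros see only the
    variation of a function. *)
Definition papprox (F F' : R -> R[i]) lo hi := forall e : R, 0 < e -> exists h : {poly R[i]},
  [/\ forall y, lo <= y <= hi -> cn (F y - h.[y%:C]) <= e,
      forall y, lo <= y <= hi -> cn (F' y - h^`().[y%:C]) <= e &
      forall y y', lo <= y <= hi -> lo <= y' <= hi ->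
        cn (F y - h.[y%:C] - (F y' - h.[y'%:C])) <= e * `|y - y'|].

(** The partial sum h of the geometric series satisfies h (z - X) = 1 - W ^ N. The
    error W ^ N / (z - X) and its derivative are of order N r ^ N. *)
Lemma inv_papprox z lo hi d : lo <= hi -> 0 < d -> away d z lo hi ->
  papprox (fun y => (z - y%:C)^-1) (fun y => (z - y%:C)^-1 ^+ 2) lo hi.
Proof.
move=> lohi d0 zaw e e0.
have [c [r [r01 D0 cr]]] := geom_center lohi d0 zaw.
set D := cn (z - c) in D0 cr.
have zc0 : z - c != 0 by rewrite -cn_gt0.
set K := d^-1 + (D * d)^-1 + d^-1 ^+ 2.
have d'0 : 0 <= d^-1 by rewrite invr_ge0 ltW.
have Dd0 : 0 <= (D * d)^-1 by rewrite invr_ge0 mulr_ge0 // ltW.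
have K0 : 0 <= K by rewrite /K !addr_ge0 ?exprn_ge0.
have [M MK] := geometric_small r01 K0 e0.
move: r01 => /andP[r0 r1].
set N := M.+1 in MK.
pose W : {poly R[i]} := (z - c)^-1 *: ('X - c%:P).
pose w (y : R) := (y%:C - c) / (z - c).
have Wy (y : R) : W.[y%:C] = w y by rewrite /W hornerZ !hornerE /w mulrC.
pose h := (z - c)^-1 *: \sum_(j < N) W ^+ j.
have wr y : lo <= y <= hi -> cn (w y) <= r.
  by move=> /cr h1; rewrite cnM cnV ler_pdivrMr.
have zy0 y : lo <= y <= hi -> z - y%:C != 0.
  by move=> /zaw h1; rewrite -cn_gt0 (lt_le_trans d0).
have zw y : z - y%:C = (z - c) * (1 - w y).
  by rewrite /w mulrBr mulr1 mulrCA divff // mulr1; ring.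
have hE : h * (z%:P - 'X) = 1 - W ^+ N.
  have -> : z%:P - 'X = (z - c) *: (1 - W).
    rewrite scalerBr scalerA divff // scale1r -mul_polyC mulr1 polyCB; ring.
  rewrite /h -scalerAl -scalerAr scalerA mulVf // scale1r mulrC.
  by rewrite -[1 - W ^+ N]opprB subrX1 -mulNr opprB.
have rem y : lo <= y <= hi -> (z - y%:C)^-1 - h.[y%:C] = w y ^+ N * (z - y%:C)^-1.
  move=> yb; have := congr1 (fun p => p.[y%:C]) hE.
  rewrite hornerM !hornerD !hornerN !hornerC hornerX horner_exp Wy => hy.
  have -> : h.[y%:C] = (1 - w y ^+ N) / (z - y%:C) by rewrite -hy mulfK // zy0.
  by rewrite mulrBl mul1r opprB addrC subrK.
have rem' y : lo <= y <= hi -> (z - y%:C)^-1 ^+ 2 - h^`().[y%:C] =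
    w y ^+ N * (z - y%:C)^-1 * (z - y%:C)^-1 + N%:R * w y ^+ M / (z - c) * (z - y%:C)^-1.
  move=> yb; have := congr1 (fun p => p^`().[y%:C]) hE.
  have dW : W^`() = ((z - c)^-1)%:P.
    by rewrite /W derivZ derivB derivX derivC subr0 -mul_polyC mulr1.
  rewrite derivM !derivB !derivC derivX deriv_exp dW !sub0r mulrN1.
  rewrite !(hornerD, hornerN, hornerM, hornerC, hornerX, hornerMn, horner_exp) Wy => hy.
  have hh : h^`().[y%:C] = (h.[y%:C] - N%:R * w y ^+ M / (z - c)) / (z - y%:C).
    apply: (canRL (mulfK (zy0 _ yb))).
    have hy' : h^`().[y%:C] * (z - y%:C) - h.[y%:C] = - (N%:R * w y ^+ M / (z - c)).
      by rewrite hy -mulr_natl; ring.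
    by rewrite -[LHS](subrK h.[y%:C]) hy' addrC.
  have := rem y yb; set i := (z - y%:C)^-1; rewrite hh -/i => ry.
  rewrite -ry; ring.
have wN y : lo <= y <= hi -> cn (w y ^+ M) <= r ^+ M.
  by move=> /wr h1; rewrite cnX lerXn2r // nnegrE ?cn_ge0.
have rN : r ^+ N <= N%:R * r ^+ M.
  rewrite /N exprS ler_wpM2r ?exprn_ge0// (le_trans (ltW r1)) // ler1n //.
set k := N%:R * r ^+ M in MK rN.
have k0 : 0 <= k by rewrite mulr_ge0 // exprn_ge0.
have wNN y : lo <= y <= hi -> cn (w y ^+ N) <= k.
  by move=> /wr h1; apply: le_trans rN; rewrite cnX lerXn2r // nnegrE ?cn_ge0.
have iy y : lo <= y <= hi -> cn (z - y%:C)^-1 <= d^-1.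
  by move=> /zaw h1; rewrite cnV lef_pV2 // posrE // (lt_le_trans d0).
have DE : cn (z - c)^-1 = D^-1 by rewrite cnV.
have kK1 : k * d^-1 <= e.
  apply: le_trans MK; apply: ler_wpM2l => //.
  by rewrite /K -addrA lerDl addr_ge0 // exprn_ge0.
have kK2 : k * (D * d)^-1 + k * d^-1 ^+ 2 <= e.
  apply: le_trans MK; rewrite -mulrDr; apply: ler_wpM2l => //.
  by rewrite /K -addrA lerDr.
exists h; split.
- move=> y yb; rewrite rem // cnM; apply: le_trans kK1.
  by apply: ler_pM; rewrite ?cn_ge0// ?wNN // iy.
- move=> y yb; rewrite rem' //; apply: (le_trans (cnD _ _)); apply: le_trans kK2.
  rewrite addrC; apply: lerD.
    rewrite !cnM DE invfM mulrA; apply: ler_pM; rewrite ?mulr_ge0 ?cn_ge0 ?invr_ge0 ?(ltW D0) ?iy//.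
    apply: ler_wpM2r; rewrite ?invr_ge0 ?(ltW D0)// /k.
    by rewrite cn_nat; apply: ler_wpM2l => //; apply: wN.
  rewrite !cnM -mulrA -expr2; apply: ler_pM; rewrite ?exprn_ge0 ?cn_ge0 ?wNN//.
  by rewrite lerXn2r ?nnegrE ?cn_ge0 ?iy.
- move=> y y' yb yb'; rewrite !rem //.
  have -> : w y ^+ N * (z - y%:C)^-1 - w y' ^+ N * (z - y'%:C)^-1 =
    (w y ^+ N - w y' ^+ N) * (z - y%:C)^-1 + w y' ^+ N * ((y%:C - y'%:C) * ((z - y%:C)^-1 * (z - y'%:C)^-1)).
    have := zy0 _ yb; have := zy0 _ yb'; move: (w y ^+ N) (w y' ^+ N) => p q n1 n2.
    by field; rewrite n1 n2.
  apply: (le_trans (cnD _ _)).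
  have wd : cn (w y - w y') = D^-1 * `|y - y'|.
    have -> : w y - w y' = (z - c)^-1 * (y - y')%:C by rewrite /w rmorphB /=; ring.
    by rewrite cnM DE cnR.
  apply: (@le_trans _ _ ((k * (D * d)^-1 + k * d^-1 ^+ 2) * `|y - y'|)); last first.
    by apply: ler_wpM2r.
  rewrite [leRHS]mulrDl; apply: lerD.
    rewrite cnM.
    apply: (@le_trans _ _ (k * (D^-1 * `|y - y'|) * d^-1)); last first.
      by rewrite invfM le_eqVlt; apply/orP; left; apply/eqP; ring.
    apply: ler_pM; rewrite ?cn_ge0 ?iy//.
    by rewrite -wd; apply: expr_lipschitz; rewrite ?wr.
  rewrite !cnM -rmorphB cnR.
  apply: (@le_trans _ _ (k * (`|y - y'| * (d^-1 * d^-1)))); last first.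
    by rewrite le_eqVlt; apply/orP; left; apply/eqP; ring.
  apply: ler_pM; rewrite ?mulr_ge0 ?cn_ge0 ?wNN//.
  by apply: ler_wpM2l => //; apply: ler_pM; rewrite ?cn_ge0 ?iy.
Qed.

End Approximation.

(** * Means and increments over interlacing zeros *)

Fixpoint interlacing (R : realType) (y : R) (s t : seq R) : Prop :=
  match s, t with
  | [::], [::] => True
  | x :: s', y' :: t' => [/\ y <= x, x <= y' & interlacing y' s' t']
  | _, _ => False
  end.

Section Interlacing.
Variable R : realType.
Implicit Types (s t : seq R) (F : R -> R[i]).

(** Pairing each x with the next y bounds the difference of the sums by the total
    length of the gaps. *)
Lemma interlacing_sum F (e : R) (P : R -> Prop) y s t : interlacing y s t ->
  (forall u, u \in s -> P u) -> (forall u, u \in y :: t -> P u) -> 0 <= e ->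
  (forall u v, P u -> P v -> cn (F u - F v) <= e * `|u - v|) ->
  cn (\sum_(v <- t) F v - \sum_(u <- s) F u) <= e * (last y t - y).
Proof.
move=> + + + e0 lipF; elim: s t y => [|x s IH] [|y' t] y //=.
  by rewrite !big_nil !subrr cn0 mulr0.
move=> [yx xy' il] Ps Pt; rewrite !big_cons.
have -> : F y' + \sum_(v <- t) F v - (F x + \sum_(u <- s) F u) =
  (F y' - F x) + (\sum_(v <- t) F v - \sum_(u <- s) F u) by ring.
apply: (le_trans (cnD _ _)).
have -> : e * (last y' t - y) = e * (y' - y) + e * (last y' t - y') by ring.
apply: lerD.
  apply: (@le_trans _ _ (e * `|y' - x|)).
    by apply: lipF; [apply: Pt; rewrite !inE eqxx orbT | apply: Ps; rewrite inE eqxx].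
  by apply: ler_wpM2l => //; rewrite ger0_norm ?subr_ge0// lerD2l lerN2.
apply: IH => // u us; first by apply: Ps; rewrite inE us orbT.
by apply: Pt; move: us; rewrite !inE => /orP[->|->]; rewrite !orbT.
Qed.

(** Each factor |z - y'| / |z - x| is at least exp (- (y' - y) / d), and the gaps
    add up to the length of the whole range. *)
Lemma interlacing_prod (z : R[i]) (d : R) y s t : interlacing y s t -> 0 < d ->
  (forall u, u \in y :: t -> d <= cn (z - u%:C)) ->
  expR (- ((last y t - y) / d)) * \prod_(u <- s) cn (z - u%:C) <= \prod_(v <- t) cn (z - v%:C).
Proof.
move=> + d0; elim: s t y => [|x s IH] [|y' t] y //=.
  by rewrite !big_nil subrr mul0r oppr0 expR0 mulr1.
move=> [yx xy' il] far; rewrite !big_cons.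
have -> : - ((last y' t - y) / d) = - ((y' - y) / d) + - ((last y' t - y') / d) by ring.
rewrite expRD mulrACA; apply: ler_pM.
- by rewrite mulr_ge0 ?expR_ge0 ?cn_ge0.
- by rewrite mulr_ge0 ?expR_ge0 ?prodr_ge0// => u _; apply: cn_ge0.
- have fy' : d <= cn (z - y'%:C) by apply: far; rewrite !inE eqxx orbT.
  rewrite expRN mulrC ler_pdivrMr ?expR_gt0//.
  have h1 := expR_ge1Dx ((y' - y) / d).
  have h2 : cn (z - x%:C) <= cn (z - y'%:C) + (y' - y).
    have := cnD (z - y'%:C) (y' - x)%:C; rewrite cnR ger0_norm ?subr_ge0// rmorphB.
    have -> : z - y'%:C + (y'%:C - x%:C) = z - x%:C by ring.
    by move/le_trans; apply; rewrite lerD2l lerD2l lerN2.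
  apply: (le_trans h2); apply: le_trans (ler_wpM2l (cn_ge0 _) h1).
  rewrite mulrDr mulr1 lerD2l mulrCA -[leLHS]mulr1; apply: ler_wpM2l.
    by rewrite subr_ge0 (le_trans yx).
  by rewrite ler_pdivlMr // mul1r.
- apply: IH => // u us; apply: far; move: us; rewrite !inE => /orP[->|->]; rewrite !orbT //.
Qed.

End Interlacing.

Section ComplexMeans.
Variables (R : realType) (X Y : nat -> seq R) (sigma lo hi : R).
Hypothesis lo_hi : lo <= hi.
Hypothesis sizeX : forall n, size (X n) = n.
Hypothesis moments : forall K, exists l : R, moment X K n @[n --> \oo] --> l.
Hypothesis self_similar : forall K,
  increment X Y K n - (1 + K%:R * sigma) * moment X K n @[n --> \oo] --> (0 : R).
Hypothesis X_box : forall n x, x \in X n -> lo <= x <= hi.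
Hypothesis Y_box : forall d : R, 0 < d -> exists N, forall n y, (N <= n)%N -> y \in Y n ->
  lo - d <= y <= hi + d.
Hypothesis XY : forall n, exists y t, Y n = y :: t /\ interlacing y (X n) t.
Implicit Types (F G : R -> R[i]) (h : {poly R[i]}) (z : R[i]).

Definition cmean F n : R[i] := (n%:R)^-1 * \sum_(x <- X n) F x.
Definition cincr F n : R[i] := \sum_(y <- Y n) F y - \sum_(x <- X n) F x.

Lemma cmean_le F (D : R) n : 0 <= D -> (forall x, x \in X n -> cn (F x) <= D) -> cn (cmean F n) <= D.
Proof.
move=> D0 FD; rewrite /cmean cnM cnV cn_nat.
have [->|n0] := posnP n; first by rewrite invr0 mul0r.
rewrite mulrC ler_pdivrMr ?ltr0n// (le_trans (cn_sum _ _))//.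
rewrite -{2}(sizeX n) big_seq (le_trans (ler_sum _ FD)) // -big_seq.
by rewrite big_const_seq count_predT iter_addr_0 mulr_natr.
Qed.

Lemma cmeanB F G n : cmean F n - cmean G n = cmean (fun x => F x - G x) n.
Proof. by rewrite /cmean -mulrBr sumrB. Qed.
Lemma cmeanZ c F n : c * cmean F n = cmean (fun x => c * F x) n.
Proof. by rewrite /cmean mulrCA mulr_sumr. Qed.
Lemma cmeanD F G n : cmean F n + cmean G n = cmean (fun x => F x + G x) n.
Proof. by rewrite /cmean -mulrDr big_split. Qed.

Lemma sum_chorner (s : seq R) h :
  \sum_(x <- s) h.[x%:C] = \sum_(i < size h) h`_i * (psum i s)%:C.
Proof.
under eq_bigr => x _ do rewrite horner_coef.
rewrite exchange_big /=; apply: eq_bigr => i _; rewrite /psum rmorph_sum /= mulr_sumr.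
by apply: eq_bigr => x _; rewrite rmorphXn.
Qed.

Lemma cmean_coef h n : cmean (fun x => h.[x%:C]) n = \sum_(i < size h) h`_i * (moment X i n)%:C.
Proof.
rewrite /cmean sum_chorner mulr_sumr; apply: eq_bigr => i _.
by rewrite /moment rmorphM /= fmorphV rmorph_nat; ring.
Qed.

Lemma cincr_coef h n : cincr (fun x => h.[x%:C]) n = \sum_(i < size h) h`_i * (increment X Y i n)%:C.
Proof.
rewrite /cincr !sum_chorner -sumrB; apply: eq_bigr => i _.
by rewrite /increment /dpsum rmorphB /=; ring.
Qed.

Lemma cmean_poly_cvg h : exists l, ccvg (cmean (fun x => h.[x%:C])) l.
Proof.
have [l hl] := choice moments.
exists (\sum_(i < size h) h`_i * (l i)%:C).
apply: (ccvg_ext (v := fun n => \sum_(i < size h) h`_i * (moment X i n)%:C)) => [n|].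
  exact: cmean_coef.
by apply: ccvg_sum => i; apply: ccvgZ; apply: ccvgR.
Qed.

Lemma cmean_cvg F : (forall e : R, 0 < e -> exists h : {poly R[i]},
    forall y, lo <= y <= hi -> cn (F y - h.[y%:C]) <= e) ->
  exists l, ccvg (cmean F) l.
Proof.
move=> Fh; apply: ccvg_approx => e e0; have [h hF] := Fh e e0.
have [l hl] := cmean_poly_cvg h.
exists (cmean (fun x => h.[x%:C])), l; split=> //; exists 0%N => n _.
by rewrite cmeanB; apply: cmean_le => [|x /X_box]; [rewrite ltW | exact: hF].
Qed.

(** Monomial by monomial, this is the self-similarity hypothesis. *)
Lemma cincr_poly h :
  ccvg (fun n => cincr (fun x => h.[x%:C]) n - cmean (fun x => h.[x%:C] + sigma%:C * (x%:C * h^`().[x%:C])) n) 0.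
Proof.
have xh (t : R[i]) : t * h^`().[t] = \sum_(i < size h) i%:R * h`_i * t ^+ i.
  rewrite mulrC -hornerMX.
  rewrite (@horner_coef_wide _ (size h)).
    apply: eq_bigr => i _; congr (_ * _); rewrite coefMX coef_deriv.
    by case: i => -[|i] /= _; [rewrite mul0r | rewrite mulr_natl].
  have [->|h0] := eqVneq h 0; first by rewrite deriv0 mul0r.
  rewrite (leq_trans (size_polyMleq _ _)) // size_polyX addn2 /=.
  by have := lt_size_deriv h0.
have mE n : cmean (fun x => h.[x%:C] + sigma%:C * (x%:C * h^`().[x%:C])) n =
    \sum_(i < size h) h`_i * ((1 + i%:R * sigma) * moment X i n)%:C.
  transitivity (cmean (fun x => h.[x%:C]) n + sigma%:C * cmean (fun x => x%:C * h^`().[x%:C]) n).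
    by rewrite cmeanZ cmeanD.
  rewrite cmean_coef /cmean; under [X in sigma%:C * (_ * X)]eq_bigr => x _ do rewrite xh.
  rewrite exchange_big /= !mulr_sumr -big_split /=; apply: eq_bigr => i _.
  rewrite -mulr_sumr /moment /psum !(rmorphM, rmorphD, rmorph1, rmorph_nat, fmorphV) /= rmorph_sum /=.
  under [X in sigma%:C * (_ * (_ * X))]eq_bigr => x _ do rewrite -rmorphXn.
  by move: (\sum_(_ <- _) _) => S; ring.
rewrite -(_ : \sum_(i < size h) h`_i * 0%:C = 0); last by rewrite big1 // => i _; rewrite mulr0.
apply: (ccvg_ext (v := fun n => \sum_(i < size h) h`_i *
   (increment X Y i n - (1 + i%:R * sigma) * moment X i n)%:C)) => [n|].
  rewrite mE cincr_coef -sumrB; apply: eq_bigr => i _;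
  by rewrite (rmorphB (real_complex R) (increment X Y i n)) mulrBr.
by apply: ccvg_sum => i; apply: ccvgZ; apply: ccvgR.
Qed.

(** For the error F - h of a C^1-approximation, the increment is controlled by its
    size and its Lipschitz constant times the length of the range, whatever the
    number of zeros. *)
Lemma cincr_cvg F F' d : 0 < d -> papprox F F' (lo - d) (hi + d) ->
  ccvg (fun n => cincr F n - cmean (fun x => F x + sigma%:C * (x%:C * F' x)) n) 0.
Proof.
move=> d0 ap e e0.
have [N YN] := Y_box d0.
set C := `|lo| + `|hi|; have C0 : 0 <= C by rewrite addr_ge0.
have XC x : lo <= x <= hi -> `|x| <= C.
  move=> /andP[x1 x2]; have h1 := ler_norm (- lo); have h2 := ler_norm hi.
  rewrite normrN in h1; have h3 := normr_ge0 lo; have h4 := normr_ge0 hi.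
  by rewrite ler_norml /C; move: x1 x2 h1 h2 h3 h4; move: `|lo| `|hi| => p q; lra.
set len := (hi + d) - (lo - d).
have len0 : 0 <= len by rewrite /len; move: lo_hi d0; lra.
set K := 2 + len + `|sigma| * C.
have K1 : 0 < K by rewrite /K ltr_wpDr ?mulr_ge0// ltr_wpDr.
have e1 : 0 < e / 2 / K by rewrite !divr_gt0.
have [h [hF hF' hlip]] := ap _ e1.
set e' := e / 2 / K in e1 hF hF' hlip.
have e'0 : 0 <= e' by rewrite ltW.
have eK : e' * K = e / 2 by rewrite divfK // gt_eqF.
have e2 : 0 < e / 2 by rewrite divr_gt0.
have [M hM] := cincr_poly h e2.
exists (maxn N M) => n; rewrite geq_max => /andP[Nn /hM]; rewrite !subr0 => hn.
have Xe x : x \in X n -> lo - d <= x <= hi + d.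
  by move=> /X_box; move: d0; lra.
have Ye y : y \in Y n -> lo - d <= y <= hi + d by apply: YN.
pose D x := F x - h.[x%:C].
have -> : cincr F n - cmean (fun x => F x + sigma%:C * (x%:C * F' x)) n =
  (cincr (fun x => h.[x%:C]) n - cmean (fun x => h.[x%:C] + sigma%:C * (x%:C * h^`().[x%:C])) n)
  + (cincr D n - cmean (fun x => D x + sigma%:C * (x%:C * (F' x - h^`().[x%:C]))) n).
  rewrite addrACA -opprD cmeanD; congr (_ - _).
    by rewrite /cincr /D !sumrB; ring.
  by rewrite /cmean; congr (_ * _); apply: eq_bigr => x _; rewrite /D; ring.
apply: (le_trans (cnD _ _)).
suff : cn (cincr D n - cmean (fun x => D x + sigma%:C * (x%:C * (F' x - h^`().[x%:C]))) n) <= e' * K.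
  move: hn; rewrite eK; lra.
apply: (le_trans (cnD _ _)); rewrite cnN.
have -> : e' * K = (e' + e' * len) + (e' + e' * (`|sigma| * C)) by rewrite /K; ring.
apply: lerD.
  have [y [t [Yn il]]] := XY n.
  rewrite /cincr Yn big_cons -addrA; apply: (le_trans (cnD _ _)); apply: lerD.
    by apply: hF; apply: Ye; rewrite Yn inE eqxx.
  apply: (le_trans (interlacing_sum (P := fun u => lo - d <= u <= hi + d) il _ _ e'0 hlip)).
  - exact: Xe.
  - by move=> u; rewrite -Yn; apply: Ye.
  - apply: ler_wpM2l => //; rewrite /len.
    have /Ye/andP[] : last y t \in Y n by rewrite Yn mem_last.
    have /Ye/andP[] : y \in Y n by rewrite Yn inE eqxx.
    lra.
apply: cmean_le => [|x xX]; first exact: (addr_ge0 e'0 (mulr_ge0 e'0 (mulr_ge0 (normr_ge0 _) C0))).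
apply: (le_trans (cnD _ _)); apply: lerD; first exact/hF/Xe.
rewrite !cnM !cnR (mulrC e') -mulrA; apply: ler_wpM2l => //.
apply: ler_pM; rewrite ?cn_ge0//; first exact/XC/(X_box xX).
exact/hF'/Xe.
Qed.

End ComplexMeans.

(** * The Stieltjes transform and the limit ratio of consecutive polynomials *)

Definition climit (R : realType) (u : nat -> R[i]) : R[i] := xget 0 [set l | ccvg u l].

Lemma climitP (R : realType) (u : nat -> R[i]) : (exists l, ccvg u l) -> ccvg u (climit u).
Proof. by move=> [l ul]; apply: (xgetI (P := [set l | ccvg u l]) 0 ul). Qed.

Lemma climit_eq (R : realType) (u : nat -> R[i]) l : ccvg u l -> climit u = l.
Proof. by move=> ul; apply: (@ccvg_uniq _ u) => //; apply: climitP; exists l. Qed.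

(** (S p)' = S' p + S p' for the logarithmic derivative S. *)
Lemma second_log_deriv (F : fieldType) (s : seq F) z : z \notin s ->
  (roots_poly s)^`()^`().[z] = (roots_poly s).[z] *
     ((\sum_(a <- s) (z - a)^-1) ^+ 2 - \sum_(a <- s) (z - a)^-1 ^+ 2).
Proof.
elim: s => [|a s IH] zs.
  by rewrite /roots_poly !big_nil !derivC horner0 expr0n subrr mulr0.
move: zs; rewrite inE negb_or => /andP[za zs].
have := IH zs; have := log_deriv_roots_poly zs.
rewrite /roots_poly !big_cons -/(roots_poly s); move: (roots_poly s) => q.
rewrite derivM derivXsubC mul1r derivD derivM derivXsubC mul1r.
rewrite !hornerD !hornerM !hornerXsubC => -> ->.
move: (\sum_(_ <- _) _) (\sum_(_ <- _) _) => S1 S2.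
by field; rewrite subr_eq0.
Qed.

Section Stieltjes.
Variables (R : realType) (X Y : nat -> seq R) (sigma lo hi : R).
Hypothesis lo_hi : lo <= hi.
Hypothesis sizeX : forall n, size (X n) = n.
Hypothesis moments : forall K, exists l : R, moment X K n @[n --> \oo] --> l.
Hypothesis self_similar : forall K,
  increment X Y K n - (1 + K%:R * sigma) * moment X K n @[n --> \oo] --> (0 : R).
Hypothesis X_box : forall n x, x \in X n -> lo <= x <= hi.
Hypothesis Y_box : forall d : R, 0 < d -> exists N, forall n y, (N <= n)%N -> y \in Y n ->
  lo - d <= y <= hi + d.
Hypothesis XY : forall n, exists y t, Y n = y :: t /\ interlacing y (X n) t.
Implicit Types (z : R[i]).

Definition stieltjes (k : nat) z : R[i] := climit (cmean X (fun y => (z - y%:C)^-1 ^+ k)).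

Lemma cmean_ext (F F' : R -> R[i]) n : F =1 F' -> cmean X F n = cmean X F' n.
Proof. by move=> e; rewrite /cmean; congr (_ * _); apply: eq_bigr => x _. Qed.

Lemma away_box z d e : 0 < e -> away d z (lo - e) (hi + e) -> away d z lo hi.
Proof. by move=> e0 h y hy; apply: h; move: hy e0; lra. Qed.

Lemma stieltjes_approx z : ~ real_segment lo hi z ->
  papprox (fun y => (z - y%:C)^-1) (fun y => (z - y%:C)^-1 ^+ 2) lo hi.
Proof.
move=> /(away_enlarge lo_hi)[d d0 zaw].
exact: (inv_papprox lo_hi d0 (away_box d0 zaw)).
Qed.

Lemma stieltjes1_cvg z : ~ real_segment lo hi z ->
  ccvg (cmean X (fun y => (z - y%:C)^-1)) (stieltjes 1 z).
Proof.
move=> /stieltjes_approx ap; apply: climitP; apply: (cmean_cvg sizeX moments X_box) => e e0.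
by have [h [h1 _ _]] := ap e e0; exists h.
Qed.

Lemma stieltjes2_cvg z : ~ real_segment lo hi z ->
  ccvg (cmean X (fun y => (z - y%:C)^-1 ^+ 2)) (stieltjes 2 z).
Proof.
move=> /stieltjes_approx ap; apply: climitP; apply: (cmean_cvg sizeX moments X_box) => e e0.
by have [h [_ h1 _]] := ap e e0; exists h^`().
Qed.

(** The image of 1 / (z - y) under h |-> h + sigma y h', integrated: y / (z - y) ^ 2
    equals z / (z - y) ^ 2 - 1 / (z - y). *)
Definition incr_limit z := stieltjes 1 z + sigma%:C * (z * stieltjes 2 z - stieltjes 1 z).

Lemma incr_inv_cvg z : ~ real_segment lo hi z ->
  ccvg (cincr X Y (fun y => (z - y%:C)^-1)) (incr_limit z).
Proof.
move=> zN; have [d d0 zaw] := away_enlarge lo_hi zN.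
have lohi' : lo - d <= hi + d by move: lo_hi d0; lra.
have := cincr_cvg lo_hi sizeX self_similar X_box Y_box XY d0 (inv_papprox lohi' d0 zaw).
set m := cmean X _ => c0.
have mc : ccvg m (incr_limit z).
  apply: (ccvg_ext (v := fun n => cmean X (fun y => (z - y%:C)^-1) n + sigma%:C *
    (z * cmean X (fun y => (z - y%:C)^-1 ^+ 2) n - cmean X (fun y => (z - y%:C)^-1) n))) => [n|].
    rewrite !cmeanZ cmeanB cmeanZ cmeanD /m /cmean; congr (_ * _).
    rewrite big_seq [RHS]big_seq; apply: eq_bigr => x /X_box xb.
    have zx : z - x%:C != 0.
      rewrite -cn_gt0 (lt_le_trans d0) // zaw //; move: xb d0; lra.
    by move: (sigma%:C) (x%:C) zx => s t zx; field.
  apply: ccvgD; first exact: stieltjes1_cvg.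
  apply: ccvgZ; apply: ccvgB; last exact: stieltjes1_cvg.
  by apply: ccvgZ; exact: stieltjes2_cvg.
apply: (ccvg_ext (v := fun n => (cincr X Y (fun y => (z - y%:C)^-1) n - m n) + m n)) => [n|].
  by rewrite subrK.
by rewrite -[X in ccvg _ X]add0r; exact: ccvgD.
Qed.

Variables (A B : nat -> {poly R[i]}) (a b : {poly R[i]}).
Hypothesis sizeA : forall n, (size (A n) <= 3)%N.
Hypothesis sizeB : forall n, (size (B n) <= 2)%N.
Hypothesis size_a : (size a <= 3)%N.
Hypothesis size_b : (size b <= 2)%N.
Let cs (s : seq R) := [seq x%:C | x <- s].
Hypothesis step_C : forall n, roots_poly (cs (Y n)) =
  ((n%:R : R[i])^-1 *: A n) * (roots_poly (cs (X n)))^`() + B n * roots_poly (cs (X n)).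
Hypothesis cvg_A : forall i, ccvg (fun n => (A n)`_i) a`_i.
Hypothesis cvg_B : forall i, ccvg (fun n => (B n)`_i) b`_i.

(** The limit of p_Y(z) / p_X(z); ratio_limit' is its derivative in z. *)
Definition ratio_limit z := a.[z] * stieltjes 1 z + b.[z].
Definition ratio_limit' z := a^`().[z] * stieltjes 1 z - a.[z] * stieltjes 2 z + b^`().[z].

Lemma cpoly_cvg (P : nat -> {poly R[i]}) (p : {poly R[i]}) N z :
  (forall n, (size (P n) <= N)%N) -> (size p <= N)%N ->
  (forall i, ccvg (fun n => (P n)`_i) p`_i) -> ccvg (fun n => (P n).[z]) p.[z].
Proof.
move=> sP sp Pp; rewrite (horner_coef_wide _ sp).
apply: (ccvg_ext (v := fun n => \sum_(i < N) (P n)`_i * z ^+ i)) => [n|].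
  by rewrite (horner_coef_wide _ (sP n)).
by apply: ccvg_sum => i; apply: ccvgM => //; exact: ccvg_cst.
Qed.

Lemma cpoly_deriv_cvg (P : nat -> {poly R[i]}) (p : {poly R[i]}) N z :
  (forall n, (size (P n) <= N)%N) -> (size p <= N)%N ->
  (forall i, ccvg (fun n => (P n)`_i) p`_i) -> ccvg (fun n => (P n)^`().[z]) p^`().[z].
Proof.
move=> sP sp Pp.
have sz (q : {poly R[i]}) : (size q^`() <= size q)%N.
  by have [->|/lt_size_deriv/ltnW//] := eqVneq q 0; rewrite deriv0.
apply: (@cpoly_cvg _ _ N) => [n||i].
- exact: leq_trans (sz _) (sP n).
- exact: leq_trans (sz _) sp.
- rewrite coef_deriv -mulr_natl.
  apply: (ccvg_ext (v := fun n => i.+1%:R * (P n)`_i.+1)) => [n|]; last exact: ccvgZ.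
  by rewrite coef_deriv mulr_natl.
Qed.

(** The quotient p_Y(z) / p_X(z), read off the recurrence. *)
Definition step_ratio n z : R[i] := (A n).[z] * cmean X (fun y => (z - y%:C)^-1) n + (B n).[z].

Lemma step_ratio_cvg z : ~ real_segment lo hi z -> ccvg (fun n => step_ratio n z) (ratio_limit z).
Proof.
move=> zN; apply: ccvgD; last exact: (@cpoly_cvg _ _ 2).
by apply: ccvgM; [exact: (@cpoly_cvg _ _ 3) | exact: stieltjes1_cvg].
Qed.

Let notin_cs z (s : seq R) d : 0 < d -> (forall y, y \in s -> d <= cn (z - y%:C)) -> z \notin cs s.
Proof.
move=> d0 far; apply/negP => /mapP[y ys zy].
by have := far y ys; rewrite zy subrr cn0 leNgt d0.
Qed.

Lemma roots_ratio n z d : 0 < d -> (forall x, x \in X n -> d <= cn (z - x%:C)) ->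
  (roots_poly (cs (Y n))).[z] = (roots_poly (cs (X n))).[z] * step_ratio n z.
Proof.
move=> d0 far; rewrite step_C hornerD !hornerM hornerZ log_deriv_roots_poly ?(notin_cs d0)//.
by rewrite big_map /step_ratio /cmean; ring.
Qed.

(** Differentiate the recurrence and divide by p_X, using p_X' = S p_X and
    p_X'' = (S ^ 2 - S_2) p_X: subtracting S p_Y removes the terms of order n. *)
Lemma roots_ratio_deriv n z d : 0 < d -> (forall x, x \in X n -> d <= cn (z - x%:C)) ->
  (forall y, y \in Y n -> d <= cn (z - y%:C)) ->
  step_ratio n z * cincr X Y (fun y => (z - y%:C)^-1) n =
  (A n)^`().[z] * cmean X (fun y => (z - y%:C)^-1) n
  - (A n).[z] * cmean X (fun y => (z - y%:C)^-1 ^+ 2) n + (B n)^`().[z].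
Proof.
move=> d0 farX farY.
have zX := notin_cs d0 farX; have zY := notin_cs d0 farY.
have p0 : (roots_poly (cs (X n))).[z] != 0.
  rewrite horner_roots_poly big_map prodf_seq_neq0; apply/allP => x /farX xf /=.
  by rewrite -cn_gt0 (lt_le_trans d0).
have h1 := congr1 (fun p => p^`().[z]) (step_C n).
rewrite /= (log_deriv_roots_poly zY) (roots_ratio d0 farX) in h1.
rewrite derivD !derivM derivZ !(hornerD, hornerM, hornerZ) in h1.
rewrite (log_deriv_roots_poly zX) (second_log_deriv zX) !big_map in h1.
apply: (mulfI p0); rewrite /cincr mulrBr mulrBr mulrA h1.
rewrite /step_ratio /cmean.
have [n0|n0] := posnP n.
  have -> : X n = [::] by apply: size0nil; rewrite sizeX.
  by rewrite !big_nil n0 invr0; ring.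
have nn : (n%:R : R[i]) != 0 by rewrite pnatr_eq0 -lt0n.
move: (\sum_(_ <- X n) _) (\sum_(_ <- X n) _) => S1 S2.
by field.
Qed.

(** The logarithmic derivative of the ratio p_Y / p_X is the increment of
    1 / (z - y), whose limit is known from self-similarity. *)
Lemma ratio_limit_deriv z : ~ real_segment lo hi z ->
  ratio_limit' z = ratio_limit z * incr_limit z.
Proof.
move=> zN; have [d d0 zaw] := away_enlarge lo_hi zN.
have [N YN] := Y_box d0.
apply: (@ccvg_uniq _ (fun n => step_ratio n z * cincr X Y (fun y => (z - y%:C)^-1) n)); last first.
  by apply: ccvgM; [exact: step_ratio_cvg | exact: incr_inv_cvg].
apply: (ccvg_near (N := N)) => [n Nn|].
  apply: (roots_ratio_deriv d0) => [x /X_box|y /(YN _ _ Nn)] h; apply: zaw => //.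
  by move: h d0; lra.
apply: ccvgD; last exact: (@cpoly_deriv_cvg _ _ 2).
apply: ccvgB; apply: ccvgM.
- exact: (@cpoly_deriv_cvg _ _ 3).
- exact: stieltjes1_cvg.
- exact: (@cpoly_cvg _ _ 3).
- exact: stieltjes2_cvg.
Qed.

(** By interlacing_prod the quotients p_Y(z) / p_X(z) stay away from 0. *)
Lemma ratio_limit_neq0 z : ~ real_segment lo hi z -> ratio_limit z != 0.
Proof.
move=> zN; have [d d0 zaw] := away_enlarge lo_hi zN.
have [N YN] := Y_box d0.
set len := (hi + d) - (lo - d).
have bound n : (N <= n)%N -> d * expR (- (len / d)) <= cn (step_ratio n z).
  move=> Nn.
  have farX x : x \in X n -> d <= cn (z - x%:C).
    by move=> /X_box h; apply: zaw; move: h d0; lra.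
  have farY y : y \in Y n -> d <= cn (z - y%:C) by move=> /(YN _ _ Nn); apply: zaw.
  have [y [t [Yn il]]] := XY n.
  have := roots_ratio d0 farX; rewrite !horner_roots_poly !big_map => /(congr1 (@cn R)).
  rewrite cnM.
  have cn_prod (s : seq R) : cn (\prod_(x <- s) (z - x%:C)) = \prod_(x <- s) cn (z - x%:C).
    by elim: s => [|x s IH]; rewrite ?big_nil ?cn1// !big_cons cnM IH.
  rewrite !cn_prod Yn big_cons => hE.
  have px : 0 < \prod_(x <- X n) cn (z - x%:C).
    by rewrite big_seq prodr_gt0 // => x /farX; apply: lt_le_trans.
  rewrite -(ler_pM2l px) -hE mulrC -mulrA.
  apply: ler_pM; rewrite ?(ltW d0) ?mulr_ge0 ?expR_ge0 ?(ltW px)//.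
    by apply: farY; rewrite Yn inE eqxx.
  apply: le_trans (interlacing_prod il d0 _); last by move=> u; rewrite -Yn; apply: farY.
  rewrite ler_wpM2r ?(ltW px)// ler_expR lerN2 ler_pM2r ?invr_gt0//.
  have /(YN _ _ Nn)/andP[] : last y t \in Y n by rewrite Yn mem_last.
  have /(YN _ _ Nn)/andP[] : y \in Y n by rewrite Yn inE eqxx.
  rewrite /len; lra.
apply/eqP => D0; have := step_ratio_cvg zN; rewrite D0.
set c := d * expR _ in bound; have c0 : 0 < c by rewrite mulr_gt0 ?expR_gt0.
have c2 : 0 < c / 2 by rewrite divr_gt0.
move=> /(_ _ c2)[M hM].
have := hM _ (leq_maxr N M); have := bound _ (leq_maxl N M); rewrite subr0; lra.
Qed.

End Stieltjes.

(** * Dilated transforms *)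

Section Dilation.
Variables (R : realType) (X : nat -> seq R) (lo hi C : R).
Hypothesis lo_hi : lo <= hi.
Hypothesis sizeX : forall n, size (X n) = n.
Hypothesis moments : forall K, exists l : R, moment X K n @[n --> \oo] --> l.
Hypothesis X_box : forall n x, x \in X n -> lo <= x <= hi.
Hypothesis box_C : forall y : R, lo <= y <= hi -> `|y| <= C.
Implicit Types (z : R[i]) (th : R).

Definition clear z th d := forall y : R, lo <= y <= hi -> d <= cn (z - (th * y)%:C).

(** The Stieltjes transform of the zeros dilated by th. Unlike
    th^-1 * stieltjes 1 (z / th) it makes sense at th = 0. *)
Definition dilated th z : R[i] := climit (cmean X (fun y => (z - (th * y)%:C)^-1)).
(** The derivative of dilated in th. *)
Definition dilated' th z : R[i] := climit (cmean X (fun y => y%:C * (z - (th * y)%:C)^-1 ^+ 2)).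

Lemma clear_div z th d : 0 < th -> 0 < d -> clear z th d -> ~ real_segment lo hi (z / th%:C).
Proof.
move=> th0 d0 cl [r]; rewrite /= in_itv /= => /cl h zE; move: h.
have thn : th%:C != 0 by rewrite -cn_gt0 cnR gtr0_norm.
have -> : z - (th * r)%:C = 0 by rewrite rmorphM /= zE mulrC divfK // subrr.
by rewrite cn0 leNgt d0.
Qed.

Lemma dilated_scale z th d : 0 < th -> 0 < d -> clear z th d ->
  ccvg (cmean X (fun y => (z - (th * y)%:C)^-1)) (th%:C^-1 * stieltjes X 1 (z / th%:C)) /\
  ccvg (cmean X (fun y => y%:C * (z - (th * y)%:C)^-1 ^+ 2))
    (th%:C^-1 ^+ 2 * (z / th%:C * stieltjes X 2 (z / th%:C) - stieltjes X 1 (z / th%:C))).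
Proof.
move=> th0 d0 cl; have wN := clear_div th0 d0 cl.
have thn : th%:C != 0 by rewrite -cn_gt0 cnR gtr0_norm.
have c1 := stieltjes1_cvg lo_hi sizeX moments X_box wN.
have c2 := stieltjes2_cvg lo_hi sizeX moments X_box wN.
have zE y : z - (th * y)%:C = th%:C * (z / th%:C - y%:C).
  by rewrite rmorphM /= mulrBr mulrCA divff // mulr1.
split.
  apply: (ccvg_ext (v := fun n => th%:C^-1 * cmean X (fun y => (z / th%:C - y%:C)^-1) n) _ (ccvgZ _ c1)) => n; rewrite cmeanZ; apply: cmean_ext => y.
  by rewrite zE invfM.
apply: ccvg_ext (ccvgZ (th%:C^-1 ^+ 2) (ccvgB (ccvgZ (z / th%:C) c2) c1)) => n.
rewrite !cmeanZ cmeanB cmeanZ /cmean; congr (_ * _).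
rewrite big_seq [RHS]big_seq; apply: eq_bigr => y /X_box yb.
have := cl y yb; rewrite zE => h.
have wy : z / th%:C - y%:C != 0.
  by apply: contraTneq h => ->; rewrite mulr0 cn0 -ltNge.
move: (z / th%:C) wy => w wy; field; apply/andP; split; [exact: wy | exact: thn].
Qed.

Lemma dilated_cvg z th d : 0 <= th -> 0 < d -> clear z th d ->
  ccvg (cmean X (fun y => (z - (th * y)%:C)^-1)) (dilated th z) /\
  ccvg (cmean X (fun y => y%:C * (z - (th * y)%:C)^-1 ^+ 2)) (dilated' th z).
Proof.
rewrite le_eqVlt => /predU1P[<-|th0] d0 cl; last first.
  by have [h1 h2] := dilated_scale th0 d0 cl; split; apply: climitP; eexists; eassumption.
split; apply: climitP; apply: (cmean_cvg sizeX moments X_box) => e e0.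
  exists (z^-1)%:P => y _; rewrite hornerC mul0r rmorph0 subr0 subrr cn0 ltW //.
exists ((z^-1 ^+ 2) *: 'X) => y _; rewrite hornerZ hornerX mul0r rmorph0 subr0.
by rewrite (mulrC (y%:C)) subrr cn0 ltW.
Qed.

Lemma dilatedE z th d : 0 < th -> 0 < d -> clear z th d ->
  dilated th z = th%:C^-1 * stieltjes X 1 (z / th%:C) /\
  dilated' th z = th%:C^-1 ^+ 2 * (z / th%:C * stieltjes X 2 (z / th%:C) - stieltjes X 1 (z / th%:C)).
Proof.
move=> th0 d0 cl; have [h1 h2] := dilated_scale th0 d0 cl.
by split; apply: climit_eq.
Qed.

Let C0 : 0 <= C.
Proof. by apply: le_trans (box_C (y := lo) _); rewrite // lexx. Qed.

Let i_lip z th th' d y : 0 < d -> clear z th d -> clear z th' d -> lo <= y <= hi ->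
  [/\ z - (th * y)%:C != 0, z - (th' * y)%:C != 0, cn (z - (th * y)%:C)^-1 <= d^-1 &
   cn (z - (th' * y)%:C)^-1 <= d^-1].
Proof.
move=> d0 cl cl' yb; have h := cl _ yb; have h' := cl' _ yb.
by split; rewrite -?cn_gt0 ?(lt_le_trans d0)// cnV lef_pV2 // posrE // (lt_le_trans d0).
Qed.

Lemma inv_diff (u v : R[i]) : u != 0 -> v != 0 -> u^-1 - v^-1 = (v - u) * (u^-1 * v^-1).
Proof. by move=> u0 v0; field; rewrite u0 v0. Qed.

Lemma mean_dilated_lipschitz z th th' d n : 0 < d -> clear z th d -> clear z th' d ->
  cn (cmean X (fun y => (z - (th' * y)%:C)^-1) n - cmean X (fun y => (z - (th * y)%:C)^-1) n)
   <= C * d^-1 ^+ 2 * `|th' - th|.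
Proof.
move=> d0 cl cl'; rewrite cmeanB; apply: (cmean_le sizeX) => [|y /X_box yb].
  by rewrite !mulr_ge0 // invr_ge0 ltW.
have [n1 n2 b1 b2] := i_lip d0 cl cl' yb.
rewrite inv_diff //.
have -> : z - (th * y)%:C - (z - (th' * y)%:C) = ((th' - th) * y)%:C.
  by rewrite !(rmorphM, rmorphB); ring.
rewrite !cnM !cnR normrM.
have -> : C * d^-1 ^+ 2 * `|th' - th| = `|th' - th| * C * (d^-1 * d^-1) by ring.
by apply: ler_pM; rewrite ?mulr_ge0 ?cn_ge0//; [apply: ler_wpM2l => //; exact: box_C
 | apply: ler_pM; rewrite ?cn_ge0].
Qed.

Lemma mean_dilated_taylor z th th' d n : 0 < d -> clear z th d -> clear z th' d ->
  cn (cmean X (fun y => (z - (th' * y)%:C)^-1) n - cmean X (fun y => (z - (th * y)%:C)^-1) n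
      - (th' - th)%:C * cmean X (fun y => y%:C * (z - (th * y)%:C)^-1 ^+ 2) n)
   <= C ^+ 2 * d^-1 ^+ 3 * `|th' - th| ^+ 2.
Proof.
move=> d0 cl cl'; rewrite cmeanZ !cmeanB; apply: (cmean_le sizeX) => [|y /X_box yb].
  by rewrite !mulr_ge0 // ?exprn_ge0 // invr_ge0 ltW.
have [n1 n2 b1 b2] := i_lip d0 cl cl' yb.
have -> : (z - (th' * y)%:C)^-1 - (z - (th * y)%:C)^-1 -
    (th' - th)%:C * (y%:C * (z - (th * y)%:C)^-1 ^+ 2)
  = ((th' - th) * y)%:C * ((th' - th) * y)%:C *
     ((z - (th * y)%:C)^-1 * (z - (th * y)%:C)^-1 * (z - (th' * y)%:C)^-1).
  move: n1 n2; rewrite !(rmorphM, rmorphB) /=.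
  by move: (th%:C) (th'%:C) (y%:C) => s s' t n1 n2; field; rewrite n1 n2.
rewrite !cnM !cnR !normrM.
have -> : C ^+ 2 * d^-1 ^+ 3 * `|th' - th| ^+ 2
  = ((`|th' - th| * C) * (`|th' - th| * C)) * (d^-1 * d^-1 * d^-1) by ring.
have yC := box_C yb.
have h1 : `|th' - th| * `|y| <= `|th' - th| * C by apply: ler_wpM2l.
by apply: ler_pM; rewrite ?mulr_ge0 ?cn_ge0//; apply: ler_pM; rewrite ?mulr_ge0 ?cn_ge0//;
  apply: ler_pM; rewrite ?cn_ge0.
Qed.

Lemma mean_dilated'_lipschitz z th th' d n : 0 < d -> clear z th d -> clear z th' d ->
  cn (cmean X (fun y => y%:C * (z - (th' * y)%:C)^-1 ^+ 2) n -
      cmean X (fun y => y%:C * (z - (th * y)%:C)^-1 ^+ 2) n)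
   <= 2 * C ^+ 2 * d^-1 ^+ 3 * `|th' - th|.
Proof.
move=> d0 cl cl'; rewrite cmeanB; apply: (cmean_le sizeX) => [|y /X_box yb].
  by rewrite !mulr_ge0 // ?exprn_ge0 // invr_ge0 ltW.
have [n1 n2 b1 b2] := i_lip d0 cl cl' yb.
have -> : y%:C * (z - (th' * y)%:C)^-1 ^+ 2 - y%:C * (z - (th * y)%:C)^-1 ^+ 2
  = y%:C * ((th' - th) * y)%:C * ((z - (th * y)%:C)^-1 * (z - (th' * y)%:C)^-1
     * ((z - (th * y)%:C)^-1 + (z - (th' * y)%:C)^-1)).
  move: n1 n2; rewrite !(rmorphM, rmorphB) /=.
  by move: (th%:C) (th'%:C) (y%:C) => s s' t n1 n2; field; rewrite n1 n2.
rewrite !cnM !cnR !normrM.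
have -> : 2 * C ^+ 2 * d^-1 ^+ 3 * `|th' - th|
  = C * (`|th' - th| * C) * (d^-1 * d^-1 * (d^-1 + d^-1)) by ring.
have yC := box_C yb.
have h1 : `|th' - th| * `|y| <= `|th' - th| * C by apply: ler_wpM2l.
have h2 : cn ((z - (th * y)%:C)^-1 + (z - (th' * y)%:C)^-1) <= d^-1 + d^-1.
  by rewrite (le_trans (cnD _ _)) // lerD.
by apply: ler_pM; rewrite ?mulr_ge0 ?cn_ge0//; apply: ler_pM; rewrite ?mulr_ge0 ?cn_ge0//;
  apply: ler_pM; rewrite ?cn_ge0.
Qed.

Section Pair.
Variables (z : R[i]) (th th' d : R).
Hypotheses (th0 : 0 <= th) (th0' : 0 <= th') (d0 : 0 < d).
Hypotheses (cl : clear z th d) (cl' : clear z th' d).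

Lemma dilated_lipschitz :
  cn (dilated th' z - dilated th z) <= C * d^-1 ^+ 2 * `|th' - th|.
Proof.
have [h1 _] := dilated_cvg th0 d0 cl; have [h2 _] := dilated_cvg th0' d0 cl'.
apply: (ccvg_le (N := 0) (ccvgB h2 h1)) => n _; exact: mean_dilated_lipschitz.
Qed.

Lemma dilated_taylor :
  cn (dilated th' z - dilated th z - (th' - th)%:C * dilated' th z)
   <= C ^+ 2 * d^-1 ^+ 3 * `|th' - th| ^+ 2.
Proof.
have [h1 h3] := dilated_cvg th0 d0 cl; have [h2 _] := dilated_cvg th0' d0 cl'.
apply: (ccvg_le (N := 0) (ccvgB (ccvgB h2 h1) (ccvgZ _ h3))) => n _; exact: mean_dilated_taylor.
Qed.

Lemma dilated'_lipschitz :
  cn (dilated' th' z - dilated' th z) <= 2 * C ^+ 2 * d^-1 ^+ 3 * `|th' - th|.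
Proof.
have [_ h1] := dilated_cvg th0 d0 cl; have [_ h2] := dilated_cvg th0' d0 cl'.
apply: (ccvg_le (N := 0) (ccvgB h2 h1)) => n _; exact: mean_dilated'_lipschitz.
Qed.

End Pair.

(** The means are equicontinuous in th, so the dilation factor may vary with n. *)
Lemma dilated_moving z (th : R) (ths : nat -> R) (m : nat -> nat) d : 0 < d -> 0 <= th ->
  clear z th d -> (forall n, clear z (ths n) d) ->
  (ths n @[n --> \oo] --> th) -> (forall N, exists M, forall n, (M <= n)%N -> (N <= m n)%N) ->
  ccvg (fun n => cmean X (fun y => (z - (ths n * y)%:C)^-1) (m n)) (dilated th z).
Proof.
move=> d0 th0 cl cls ths_cvg mo e e0.
have [h1 _] := dilated_cvg th0 d0 cl.
have e2 : 0 < e / 2 by rewrite divr_gt0.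
have [N hN] := h1 _ e2; have [M hM] := mo N.
set K := C * d^-1 ^+ 2; have K0 : 0 <= K by rewrite !mulr_ge0 // invr_ge0 ltW.
have K1 : 0 < K + 1 by rewrite ltr_wpDl.
have e3 : 0 < e / 2 / (K + 1) by rewrite divr_gt0.
have /cvg0P/(_ _ e3)[P hP] := cvgn_sub0 ths_cvg.
exists (maxn M P) => n; rewrite geq_max => /andP[/hM/hN n1 /hP n2].
have := mean_dilated_lipschitz (m n) d0 cl (cls n); rewrite -/K => n3.
have n4 : K * `|ths n - th| <= e / 2.
  move: n2; rewrite ler_pdivlMr // => n2; apply: le_trans n2.
  by rewrite mulrC ler_wpM2l // lerDl.
rewrite -(subrK (cmean X (fun y => (z - (th * y)%:C)^-1) (m n)) (cmean X _ (m n))) -addrA.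
apply: (le_trans (cnD _ _)); move: n1 n3 n4; lra.
Qed.

Lemma dilated_infinity z th : 0 <= th <= 1 -> C < cn z ->
  cn (z * dilated th z - 1) <= C / (cn z - C).
Proof.
move=> /andP[th0 th1] zC; set d := cn z - C; have d0 : 0 < d by rewrite subr_gt0.
have tyC y : lo <= y <= hi -> cn (th * y)%:C <= C.
  move=> /box_C h; rewrite cnR normrM ger0_norm // -[leRHS]mul1r.
  by apply: ler_pM.
have cl : clear z th d.
  move=> y /tyC h; have := cnB z (th * y)%:C; rewrite /d; move: h; lra.
have [h1 _] := dilated_cvg th0 d0 cl.
apply: (ccvg_le (N := 1) (ccvgB (ccvgZ z h1) (ccvg_cst 1))) => n n1.
have n0 : (n%:R : R[i]) != 0 by rewrite pnatr_eq0 -lt0n.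
have -> : 1 = cmean X (fun=> 1) n.
  rewrite /cmean big_const_seq count_predT sizeX iter_addr_0 mulVf //.
rewrite cmeanZ cmeanB; apply: (cmean_le sizeX) => [|y /X_box yb].
  by rewrite divr_ge0 // ltW.
have h := cl y yb.
have nz : z - (th * y)%:C != 0 by rewrite -cn_gt0 (lt_le_trans d0).
have -> : z / (z - (th * y)%:C) - 1 = (th * y)%:C / (z - (th * y)%:C) by move: ((th * y)%:C) nz => t nz; field.
rewrite cnM cnV; apply: ler_pM; rewrite ?invr_ge0 ?cn_ge0 ?tyC//.
by rewrite lef_pV2 // posrE // (lt_le_trans d0).
Qed.

End Dilation.

(** * Complex derivatives and the fundamental theorem of calculus *)

Section Topology.
Variable R : realType.
Local Notation C := (R[i]^o).

Lemma posC (e : C) : 0 < e -> exists2 r : R, 0 < r & e = r%:C.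
Proof.
by case: e => r s; rewrite ltcE /= => /andP[/eqP -> r0]; exists r.
Qed.

Lemma cvgC_of_cn (T : Type) (F : set_system T) (FF : Filter F) (u : T -> C) (l : C) :
  (forall e : R, 0 < e -> F [set x | cn (u x - l) < e]) -> u x @[x --> F] --> l.
Proof.
move=> h; apply/cvgrPdist_lt => e /posC[r r0 ->].
apply: filterS (h r r0) => x /= hx.
by rewrite distrC normr_cn ltcR.
Qed.

Lemma cn_of_cvgC (T : Type) (F : set_system T) (FF : Filter F) (u : T -> C) (l : C) :
  u x @[x --> F] --> l -> forall e : R, 0 < e -> F [set x | cn (u x - l) < e].
Proof.
move=> /cvgrPdist_lt h e e0.
have e0' : (0 : C) < e%:C by rewrite ltcR.
by apply: filterS (h _ e0') => x /=; rewrite distrC normr_cn ltcR.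
Qed.

(** Differentiability with a quadratic remainder. It is stable under the usual
    rules by elementary estimates and implies complex differentiability. *)
Definition cderiv (F : R[i] -> R[i]) z (F' : R[i]) := exists K d : R, [/\ 0 <= K, 0 < d &
  forall w, cn (w - z) <= d -> cn (F w - F z - (w - z) * F') <= K * cn (w - z) ^+ 2].

Lemma cderiv_derive (F : C -> C) (z F' : C) : cderiv F z F' -> derivable F z 1 /\ (F^`())%classic z = F'.
Proof.
move=> [K [d [K0 d0 h]]].
have quot (p t : R[i]) : t != 0 -> t^-1 * p - F' = t^-1 * (p - t * F') by move=> tn0; field.
have key : h^-1 *: (F (h *: 1 + z) - F z) @[h --> (0 : C)^'] --> (F' : C).
  apply: cvgC_of_cn => e e0.
  set r := minr d (e / (K + 1)).
  have K1 : 0 < K + 1 by rewrite ltr_wpDl.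
  have r0 : 0 < r by rewrite lt_min d0 divr_gt0.
  have r0' : (0 : C) < r%:C by rewrite ltcR.
  exists (r%:C) => // t /=; rewrite sub0r normrN normr_cn ltcR => tr tn0.
  have tz : t *: (1 : C) + z = t + z by rewrite /GRing.scale /= mulr1.
  rewrite tz.
  have := h (t + z); rewrite addrK => /(_ _)/wrap[|h1].
    by rewrite (le_trans (ltW tr)) // ge_min lexx.
  have -> : t^-1 *: (F (t + z) - F z) - F' = t^-1 * (F (t + z) - F z - t * F').
    exact: quot.
  have t0 : 0 < cn t by rewrite cn_gt0.
  rewrite cnM cnV mulrC ltr_pdivrMr //; apply: (le_lt_trans h1).
  rewrite expr2 mulrA ltr_pM2r //.
  have : cn t < e / (K + 1) by rewrite (lt_le_trans tr) // ge_min lexx orbT.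
  rewrite ltr_pdivlMr //; move: t0 K0; move: (cn t) => s; nra.
split; first by apply/cvg_ex; exists F'.
by rewrite derive1E; apply: cvg_lim.
Qed.

Lemma cderiv_cst (c z : R[i]) : cderiv (fun=> c) z 0.
Proof.
exists 0, 1; split => // w _; rewrite subrr mulr0 subr0 cn0 mul0r //.
Qed.

Lemma cderiv_id (z : R[i]) : cderiv id z 1.
Proof.
by exists 0, 1; split => // w _; rewrite mulr1 subrr cn0 mul0r.
Qed.

Lemma cderivD F G z (F' G' : R[i]) : cderiv F z F' -> cderiv G z G' ->
  cderiv (fun w => F w + G w) z (F' + G').
Proof.
move=> [K1 [d1 [K10 d10 h1]]] [K2 [d2 [K20 d20 h2]]].
exists (K1 + K2), (minr d1 d2); split; rewrite ?addr_ge0 ?lt_min ?d10//.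
move=> w; rewrite le_min => /andP[/h1 + /h2].
have := cnD (F w - F z - (w - z) * F') (G w - G z - (w - z) * G').
have -> : F w - F z - (w - z) * F' + (G w - G z - (w - z) * G') =
  F w + G w - (F z + G z) - (w - z) * (F' + G') by ring.
rewrite mulrDl; lra.
Qed.

Lemma cderivM F G z (F' G' : R[i]) : cderiv F z F' -> cderiv G z G' ->
  cderiv (fun w => F w * G w) z (F' * G z + F z * G').
Proof.
move=> [K1 [d1 [K10 d10 h1]]] [K2 [d2 [K20 d20 h2]]].
set M1 := cn F' + K1 * d1; set M2 := cn G' + K2 * d2.
have M10 : 0 <= M1 by rewrite addr_ge0 ?cn_ge0 ?mulr_ge0 // ltW.
have M20 : 0 <= M2 by rewrite addr_ge0 ?cn_ge0 ?mulr_ge0 // ltW.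
exists (cn (F z) * K2 + cn (G z) * K1 + M1 * M2), (minr d1 d2); split.
- by rewrite !addr_ge0 ?mulr_ge0 ?cn_ge0.
- by rewrite lt_min d10.
move=> w; rewrite le_min => /andP[w1 w2].
have r1 := h1 w w1; have r2 := h2 w w2.
set h := w - z in w1 w2 r1 r2 *; set s1 := F w - F z - h * F' in r1; set s2 := G w - G z - h * G' in r2.
have -> : F w * G w - F z * G z - h * (F' * G z + F z * G') =
   F z * s2 + G z * s1 + (h * F' + s1) * (h * G' + s2) by rewrite /s1 /s2; ring.
have b1 : cn (h * F' + s1) <= cn h * M1.
  apply: (le_trans (cnD _ _)); rewrite cnM /M1 mulrDr lerD2l; apply: (le_trans r1).
  rewrite expr2 mulrCA; apply: ler_wpM2l; rewrite ?cn_ge0//.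
  by apply: ler_wpM2l.
have b2 : cn (h * G' + s2) <= cn h * M2.
  apply: (le_trans (cnD _ _)); rewrite cnM /M2 mulrDr lerD2l; apply: (le_trans r2).
  rewrite expr2 mulrCA; apply: ler_wpM2l; rewrite ?cn_ge0//.
  by apply: ler_wpM2l.
apply: (le_trans (cnD _ _)); rewrite [leRHS]mulrDl; apply: lerD; last first.
  rewrite cnM; have -> : M1 * M2 * cn h ^+ 2 = (cn h * M1) * (cn h * M2) by ring.
  by apply: ler_pM; rewrite ?cn_ge0.
by apply: (le_trans (cnD _ _)); rewrite [leRHS]mulrDl; apply: lerD; rewrite cnM -mulrA;
  apply: ler_wpM2l; rewrite ?cn_ge0.
Qed.

Lemma cderiv_scale F c z (F' : R[i]) : cderiv F (c * z) F' -> cderiv (fun w => F (c * w)) z (c * F').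
Proof.
move=> [K [d [K0 d0 h]]].
have c1 : 0 < cn c + 1 by rewrite ltr_wpDl ?cn_ge0.
exists (K * cn c ^+ 2), (d / (cn c + 1)); split; rewrite ?mulr_ge0 ?exprn_ge0 ?cn_ge0 ?divr_gt0//.
move=> w; rewrite ler_pdivlMr // => wz.
have -> : (w - z) * (c * F') = (c * w - c * z) * F' by ring.
rewrite -mulrA -exprMn -cnM mulrBr; apply: h; rewrite -mulrBr cnM.
by apply: le_trans wz; rewrite mulrC; apply: ler_wpM2l; rewrite ?cn_ge0// lerDl.
Qed.

Lemma cderiv_near F G z (F' : R[i]) (e : R) : 0 < e ->
  (forall w, cn (w - z) <= e -> F w = G w) -> cderiv G z F' -> cderiv F z F'.
Proof.
move=> e0 FG [K [r [K0 r0 h]]]; exists K, (minr e r); split; rewrite ?lt_min ?e0//.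
move=> w; rewrite le_min => /andP[we wr]; rewrite !FG ?subrr ?cn0 ?(ltW e0)//.
exact: h.
Qed.

Lemma cderiv_horner (p : {poly R[i]}) z : cderiv (fun w => p.[w]) z p^`().[z].
Proof.
elim/poly_ind: p => [|p c IH].
  rewrite deriv0 horner0.
  apply: (@cderiv_near _ (fun=> 0) _ _ 1) => // [w _|]; first by rewrite horner0.
  exact: cderiv_cst.
rewrite derivMXaddC hornerD hornerMX.
apply: (@cderiv_near _ (fun w => p.[w] * w + c) _ _ 1) => // [w _|].
  by rewrite hornerMXaddC.
rewrite -[_ + _]addr0; apply: cderivD; last exact: cderiv_cst.
rewrite addrC -[p.[z]]mulr1; apply: cderivM => //; exact: cderiv_id.
Qed.

End Topology.

Section StieltjesDerivative.
Variables (R : realType) (X : nat -> seq R) (lo hi : R) (a b : {poly R[i]}).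
Hypothesis lo_hi : lo <= hi.
Hypothesis sizeX : forall n, size (X n) = n.
Hypothesis moments : forall K, exists l : R, moment X K n @[n --> \oo] --> l.
Hypothesis X_box : forall n x, x \in X n -> lo <= x <= hi.

Lemma away_notin (z : R[i]) d : 0 < d -> away d z lo hi -> ~ real_segment lo hi z.
Proof.
move=> d0 aw [r]; rewrite /= in_itv /= => /aw + zr; rewrite zr subrr cn0; move: d0; lra.
Qed.

Lemma cderiv_stieltjes z : ~ real_segment lo hi z -> cderiv (stieltjes X 1) z (- stieltjes X 2 z).
Proof.
move=> zN; have [d d0 aw'] := away_enlarge lo_hi zN; have aw := away_box d0 aw'.
exists (d^-1 ^+ 2 * (d / 2)^-1), (d / 2); split => [||w wz].
- by rewrite mulr_ge0 ?exprn_ge0 ?invr_ge0 ?divr_ge0 ?(ltW d0).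
- by rewrite divr_gt0.
have d2 : 0 < d / 2 by rewrite divr_gt0.
have aww : away (d / 2) w lo hi.
  move=> y /aw h; have := cnB (z - y%:C) (z - w).
  have -> : z - y%:C - (z - w) = w - y%:C by ring.
  by rewrite (cn_distC z w); move: h wz; lra.
have wN := away_notin d2 aww.
have c1 := stieltjes1_cvg lo_hi sizeX moments X_box zN.
have c2 := stieltjes2_cvg lo_hi sizeX moments X_box zN.
have c3 := stieltjes1_cvg lo_hi sizeX moments X_box wN.
rewrite mulrN opprK.
apply: (ccvg_le (N := 0) (ccvgD (ccvgB c3 c1) (ccvgZ (w - z) c2))) => n _.
rewrite cmeanZ cmeanB cmeanD; apply: (cmean_le sizeX) => [|y /X_box yb].
  by rewrite !mulr_ge0 ?exprn_ge0 ?invr_ge0 ?divr_ge0 ?(ltW d0) ?cn_ge0.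
have h1 := aw y yb; have h2 := aww y yb.
have n1 : z - y%:C != 0 by rewrite -cn_gt0 (lt_le_trans d0).
have n2 : w - y%:C != 0 by rewrite -cn_gt0 (lt_le_trans d2).
have -> : (w - y%:C)^-1 - (z - y%:C)^-1 + (w - z) * (z - y%:C)^-1 ^+ 2 =
  ((z - y%:C)^-1 ^+ 2 * (w - y%:C)^-1) * (w - z) ^+ 2.
  by move: (y%:C) n1 n2 => t n1 n2; field; rewrite n1 n2.
rewrite cnM (cnM (_ ^+ 2)) !cnX !cnV; apply: ler_wpM2r; rewrite ?exprn_ge0 ?cn_ge0//.
apply: ler_pM; rewrite ?exprn_ge0 ?invr_ge0 ?cn_ge0//.
  by rewrite lerXn2r ?nnegrE ?invr_ge0 ?cn_ge0 ?(ltW d0)// lef_pV2 // posrE (lt_le_trans d0).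
by rewrite lef_pV2 // posrE // (lt_le_trans d2).
Qed.

Lemma cderiv_ratio z : ~ real_segment lo hi z ->
  cderiv (ratio_limit X a b) z (ratio_limit' X a b z).
Proof.
move=> zN; rewrite /ratio_limit /ratio_limit'.
apply: cderivD; last exact: cderiv_horner.
rewrite -mulrN; apply: cderivM; first exact: cderiv_horner.
exact: cderiv_stieltjes.
Qed.

End StieltjesDerivative.

Section RealCalculus.
Variable R : realType.

(** A chain rule: k is, near t0, a function of tau with derivative k', known only
    through its Taylor estimate on the range of tau. *)
Lemma is_derive_quadratic (tau k : R -> R) (t0 tau' k' M : R) :
  is_derive t0 1 tau tau' ->
  (\forall t \near t0, `|k t - k t0 - (tau t - tau t0) * k'| <= M * `|tau t - tau t0| ^+ 2) ->
  is_derive t0 1 k (tau' * k').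
Proof.
move=> dtau near_t.
have taucvg : h^-1 *: (tau (h *: 1 + t0) - tau t0) @[h --> 0^'] --> tau'.
  by have [dt <-] := dtau; exact: dt.
have idcvg : h @[h --> (0 : R)^'] --> (0 : R) by apply: cvg_within_filter; exact: cvg_id.
have prod0 : `|h^-1 *: (tau (h *: 1 + t0) - tau t0)| ^+ 2 * `|h| @[h --> (0 : R)^'] --> (0 : R).
  have := cvgM (cvgM (cvg_norm taucvg) (cvg_norm taucvg)) (cvg_norm idcvg).
  by rewrite normr0 mulr0; apply.
have rem0 : h^-1 *: (k (h *: 1 + t0) - k t0) - h^-1 *: (tau (h *: 1 + t0) - tau t0) * k'
   @[h --> (0 : R)^'] --> (0 : R).
  apply/norm_cvg0P.
  apply: (@squeeze_cvgr _ _ _ _ (fun=> 0) (fun h => M * (`|h^-1 *: (tau (h *: 1 + t0) - tau t0)| ^+ 2 * `|h|))); last 2 first.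
  - exact: cvg_cst.
  - by have := cvgM (cvg_cst M) prod0; rewrite mulr0; apply.
  have near0 : \forall h \near (0 : R)^', `|k (h *: 1 + t0) - k t0 - (tau (h *: 1 + t0) - tau t0) * k'| <= M * `|tau (h *: 1 + t0) - tau t0| ^+ 2.
    have shift : h *: (1 : R) + t0 @[h --> (0 : R)^'] --> t0.
      rewrite -[X in _ --> X]add0r; apply: cvgD; last exact: cvg_cst.
      under eq_fun do rewrite /GRing.scale /= mulr1.
      exact: idcvg.
    exact: shift near_t.
  near=> h; rewrite normr_ge0 /=.
  have h0 : h != 0 by near: h; exact: nbhs_dnbhs_neq.
  have key : `|k (h *: 1 + t0) - k t0 - (tau (h *: 1 + t0) - tau t0) * k'| <= M * `|tau (h *: 1 + t0) - tau t0| ^+ 2.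
    by near: h.
  rewrite /GRing.scale /= in key *.
  rewrite -mulrA -mulrBr normrM normfV ler_pdivrMl ?normr_gt0//.
  apply: (le_trans key); rewrite normrM normfV.
  have hn : `|h| != 0 by rewrite normr_eq0.
  move: (`|tau _ - _|) => T.
  by rewrite le_eqVlt; apply/orP; left; apply/eqP; field.
have key : h^-1 *: (k (h *: 1 + t0) - k t0) @[h --> (0 : R)^'] --> tau' * k'.
  have Bcvg : h^-1 *: (tau (h *: 1 + t0) - tau t0) * k' @[h --> (0 : R)^'] --> tau' * k'.
    by apply: cvgM => //; exact: cvg_cst.
  rewrite (_ : (fun h : R => _) = (fun h : R => (h^-1 *: (k (h *: 1 + t0) - k t0) -
      h^-1 *: (tau (h *: 1 + t0) - tau t0) * k') + h^-1 *: (tau (h *: 1 + t0) - tau t0) * k')); last first.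
    by apply/funext => h; rewrite subrK.
  by rewrite -[X in _ --> X]add0r; apply: cvgD.
apply: DeriveDef; first by apply/cvg_ex; exists (tau' * k').
exact: cvg_lim key.
Unshelve. all: by end_near. Qed.

Lemma powR_within_continuous (sigma s : R) : 0 <= sigma ->
  {within `[0, s], continuous (fun t : R => t `^ sigma)}.
Proof.
rewrite le_eqVlt => /predU1P[<-|sigma0].
  have -> : (fun t : R => t `^ 0) = (fun=> 1) by apply/funext => t; rewrite powRr0.
  by apply/subspace_continuousP => t _; exact: cvg_cst.
apply/subspace_continuousP => t /=; rewrite in_itv /= => /andP[t0 _].
have [tp|] := ltP 0 t.
  apply: cvg_within_filter; apply: differentiable_continuous; apply/derivable1_diffP.
  by apply: ex_derive; exact: is_derive1_powR.
move=> t_le0; have -> : t = 0 by apply/eqP; rewrite eq_le t_le0.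
rewrite /from_subspace /= powR0 ?gt_eqF//; apply/cvgrPdist_lt => e e0.
pose d := e `^ sigma^-1; have d0 : 0 < d by exact: powR_gt0.
exists d => //= u /=; rewrite sub0r normrN => ud; rewrite in_itv /= => /andP[u0 _].
rewrite sub0r normrN ger0_norm ?powR_ge0//.
have -> : e = d `^ sigma by rewrite /d -powRrM mulVf ?gt_eqF// powRr1 // ltW.
rewrite gt0_ltr_powR // ?nnegrE ?(ltW d0)//.
by apply: le_lt_trans ud; exact: ler_norm.
Qed.

(** A point is negligible: the values at 0 of the two functions may differ. *)
Lemma integral_off0 (g q : R -> R) (s : R) : 0 <= s ->
  lebesgue_measure.-integrable `[0, s] (EFin \o q) ->
  (forall t, 0 < t <= s -> g t = q t) ->
  lebesgue_measure.-integrable `[0, s] (fun t => (g t)%:E) /\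
  \int[lebesgue_measure]_(t in `[0, s]) g t = \int[lebesgue_measure]_(t in `[0, s]) q t.
Proof.
move=> s0 iq gq.
have mD : measurable (`[0, s] `\` [set 0] : set (measurableTypeR R)) by apply: measurableD.
have gqD : {in `[0, s] `\` [set 0], (fun t => (q t)%:E) =1 (fun t => (g t)%:E)}.
  move=> t; rewrite inE /= in_itv /= => -[/andP[t0 ts] /eqP tn0].
  by rewrite gq // ts lt0r t0 tn0.
have iD : lebesgue_measure.-integrable (`[0, s] `\` [set 0]) (EFin \o q).
  by apply: (integrableS _ mD _ iq) => // t [].
have igD := eq_integrable mD _ _ gqD iD.
have split0 : `[0, s]%classic = [set 0] `|` (`[0, s] `\` [set (0 : R)]).
  by rewrite setDUK // => t /= ->; rewrite in_itv /= lexx s0.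
have m0 : measurable ([set 0] : set (measurableTypeR R)) by exact: measurable_set1.
have mg := (measurable_funU _ m0 mD).2 (conj (measurable_fun_set1 _) (measurable_int _ igD)).
rewrite -split0 in mg.
have N0 : lebesgue_measure [set (0 : R)] = 0%E by rewrite lebesgue_measure_set1.
have ig : lebesgue_measure.-integrable `[0, s] (fun t => (g t)%:E).
  by apply/(negligible_integrable (N := [set 0] : set (measurableTypeR R))).
split=> //; rewrite /Rintegral; congr fine.
rewrite (negligible_integral (N := [set 0] : set (measurableTypeR R))) // [RHS](negligible_integral (N := [set 0] : set (measurableTypeR R))) //.
by apply: eq_integral => t /gqD.
Qed.

Lemma ftc_within (F q : R -> R) (s : R) : 0 < s ->
  {within `[0, s], continuous F} -> {within `[0, s], continuous q} ->
  (forall t, 0 < t < s -> is_derive t 1 F (q t)) ->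
  lebesgue_measure.-integrable `[0, s] (EFin \o q) /\
  \int[lebesgue_measure]_(t in `[0, s]) q t = F s - F 0.
Proof.
move=> s0 cF cq dF; split.
  by apply: continuous_compact_integrable => //; exact: segment_compact.
have [cFoo F0 Fs] := (continuous_within_itvP F s0).1 cF.
rewrite /Rintegral (@continuous_FTC2 _ q F 0 s) //.
- split=> // t; rewrite in_itv /= => /dF h; exact: ex_derive.
- by move=> t; rewrite in_itv /= => /dF h; rewrite derive1E derive_val.
Qed.

End RealCalculus.

(** * The limit function and its integral equation *)

Section LimitAlong.
Variables (R : realType) (P : nat -> {poly R[i]}) (phi : nat -> R) (I : set (R[i]^o)).
Local Notation C := (R[i]^o).

Lemma limit_along_pointwise (Lambda : set nat) (f : R -> C -> C) (t : R) (z : C) :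
  limit_along P phi I Lambda f -> 0 <= t <= 1 -> ~ I z ->
  forall e : R, 0 < e -> exists N, forall n, (N <= n)%N -> Lambda n ->
    cn (rescaled_log_deriv P phi n (t, z) - f t z) < e.
Proof.
move=> limf t01 zI e e0.
have sub : [set z] `<=` ~` I by move=> w ->.
have cvgf := limf _ (@compact_set1 _ z) sub.
pose E : set (C * C) := [set xy | ball xy.1 (e%:C : C) xy.2].
have entE : entourage E by apply: (entourage_ball _ (PosNum (_ : (0 : C) < e%:C))); rewrite ltcR.
have /cvgf [N _ hN] : nbhs ((fun tx => f tx.1 tx.2) : {uniform` `[0, 1] `*` [set z] -> C})
    [set h | forall y, (`[0, 1] `*` [set z]) y -> E (f y.1 y.2, h y)].
  by apply/uniform_nbhs; exists E; split.
exists N => n Nn Ln; have := hN n Nn Ln (t, z).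
rewrite /E /= -ball_normE /= => /(_ _)/wrap[|].
  by split => //=; rewrite in_itv.
by rewrite distrC normr_cn ltcR.
Qed.

(** Uniform convergence on {z} already determines the limit, and Lambda contains
    arbitrarily large indices. *)
Lemma limit_along_unique (Lambda : set nat) (f : R -> C -> C) (t : R) (z l : C) :
  infinite_set Lambda -> limit_along P phi I Lambda f -> 0 <= t <= 1 -> ~ I z ->
  ccvg (fun n => rescaled_log_deriv P phi n (t, z)) l -> f t z = l.
Proof.
move=> infL limf t01 zI ul; apply/eqP; rewrite -subr_eq0 -cn_eq0 eq_le cn_ge0 andbT.
apply/ler_addgt0Pr => e e0; rewrite add0r.
have e2 : 0 < e / 2 by rewrite divr_gt0.
have [N hN] := limit_along_pointwise limf t01 zI e2; have [M hM] := ul _ e2.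
have [n Ln nNM] : exists2 n, Lambda n & (maxn N M <= n)%N.
  apply: contrapT => none; apply: infL; apply: (sub_finite_set _ (finite_II (maxn N M))) => n Ln /=.
  by rewrite ltnNge; apply/negP => h; apply: none; exists n.
move: nNM; rewrite geq_max => /andP[/hN/(_ Ln) h1 /hM h2].
have := cnD (f t z - rescaled_log_deriv P phi n (t, z)) (rescaled_log_deriv P phi n (t, z) - l).
rewrite (cn_distC (f t z)) addrA subrK; move: h1 h2; lra.
Qed.

End LimitAlong.

Section LimitTransform.
Variables (R : realType) (X Y : nat -> seq R) (sigma lo hi C lo' hi' : R).
Hypothesis lo_hi : lo <= hi.
Hypothesis sizeX : forall n, size (X n) = n.
Hypothesis moments : forall K, exists l : R, moment X K n @[n --> \oo] --> l.
Hypothesis self_similar : forall K,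
  increment X Y K n - (1 + K%:R * sigma) * moment X K n @[n --> \oo] --> (0 : R).
Hypothesis X_box : forall n x, x \in X n -> lo <= x <= hi.
Hypothesis Y_box : forall d : R, 0 < d -> exists N, forall n y, (N <= n)%N -> y \in Y n ->
  lo - d <= y <= hi + d.
Hypothesis XY : forall n, exists y t, Y n = y :: t /\ interlacing y (X n) t.
Hypothesis box_C : forall y : R, lo <= y <= hi -> `|y| <= C.
Variables (A B : nat -> {poly R[i]}) (a b : {poly R[i]}) (lam : R[i]).
Hypothesis sizeA : forall n, (size (A n) <= 3)%N.
Hypothesis sizeB : forall n, (size (B n) <= 2)%N.
Hypothesis size_a : (size a <= 3)%N.
Hypothesis size_b : (size b <= 2)%N.
Hypothesis step_C : forall n, roots_poly [seq x%:C | x <- Y n] =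
  ((n%:R : R[i])^-1 *: A n) * (roots_poly [seq x%:C | x <- X n])^`() + B n * roots_poly [seq x%:C | x <- X n].
Hypothesis cvg_A : forall i, ccvg (fun n => (A n)`_i) a`_i.
Hypothesis cvg_B : forall i, ccvg (fun n => (B n)`_i) b`_i.
Hypothesis lam0 : lam != 0.
Hypothesis sigma_ge0 : 0 <= sigma.
Variable ok : R -> Prop.
Hypothesis ok01 : forall th, ok th -> 0 <= th <= 1.
Hypothesis ok_pow : forall t, 0 <= t <= 1 -> ok (t `^ sigma).
Hypothesis lo_hi' : lo' <= hi'.
Hypothesis ok_clear : forall z, ~ real_segment lo' hi' z ->
  exists2 d : R, 0 < d & forall th, ok th -> clear lo hi z th d.

(** The limit function: P_[nt] has about n t zeros, and they are the rescaled zeros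
    of its own degree dilated by phi [nt] / phi n, which tends to t ^ sigma. *)
Definition transform t (z : R[i]) : R[i] := t%:C * dilated X (t `^ sigma) z.
(** The derivative of transform in t. *)
Definition transform' t (z : R[i]) : R[i] :=
  dilated X (t `^ sigma) z + (sigma * t `^ sigma)%:C * dilated' X (t `^ sigma) z.

Lemma transform0 z : transform 0 z = 0.
Proof. by rewrite /transform mul0r. Qed.

Variable f : R -> R[i]^o -> R[i]^o.
Hypothesis f_transform : forall t z, 0 <= t <= 1 -> ~ real_segment lo' hi' z -> f t z = transform t z.

Let notin_div t z : 0 < t <= 1 -> ~ real_segment lo' hi' z ->
  [/\ (t `^ sigma)%:C != 0, exists2 d : R, 0 < d & clear lo hi z (t `^ sigma) d &
   ~ real_segment lo hi (z / (t `^ sigma)%:C)].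
Proof.
move=> /andP[t0 t1] zN; have th0 : 0 < t `^ sigma by exact: powR_gt0.
have [d d0 cl] := ok_clear zN.
have clt : clear lo hi z (t `^ sigma) d by apply/cl/ok_pow; rewrite (ltW t0).
split; first by rewrite -cn_gt0 cnR gtr0_norm.
  by exists d.
exact: clear_div th0 d0 clt.
Qed.

(** Since transform t z = t th^-1 G (z / th) with th = t ^ sigma, the powers of t
    combine to a common factor th. *)
Lemma denominatorE t z : 0 < t <= 1 -> ~ real_segment lo' hi' z ->
  denominator (lam *: a) (lam *: b) sigma f t z =
    lam * (t `^ sigma)%:C * ratio_limit X a b ((t `^ sigma)%:C^-1 * z).
Proof.
move=> t01 zN; have [thn [d d0 cl] _] := notin_div t01 zN.
move/andP: (t01) => [t0 t1].
have th0 : 0 < t `^ sigma by exact: powR_gt0.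
have yE : z * (t `^ (- sigma))%:C = (t `^ sigma)%:C^-1 * z.
  by rewrite powRN fmorphV mulrC.
rewrite /denominator /ratio_limit; cbv zeta; rewrite f_transform ?(ltW t0)// /transform.
have [-> _] := dilatedE lo_hi sizeX moments X_box th0 d0 cl.
rewrite yE !hornerZ (mulrC z).
have pw : (t `^ (2 * sigma - 1))%:C * t%:C = (t `^ sigma)%:C * (t `^ sigma)%:C.
  have nz (r : R) : (r == 0) ==> (t != 0) by rewrite gt_eqF // implybT.
  have e1 : t `^ (2 * sigma - 1) * t = t `^ (2 * sigma - 1) * t `^ 1 by rewrite powRr1 // ltW.
  rewrite -!rmorphM /= e1 -!powRD ?nz//.
  by congr (_ `^ _)%:C; ring.
move: (stieltjes X 1 _) (b.[_]) => G v.
move: (a.[_]) => u.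
have -> : (t `^ (2 * sigma - 1))%:C * (lam * u) * (t%:C * ((t `^ sigma)%:C^-1 * G)) =
   ((t `^ (2 * sigma - 1))%:C * t%:C) * (lam * u * (t `^ sigma)%:C^-1 * G) by ring.
by rewrite pw; move: (t `^ sigma)%:C thn => s thn; field.
Qed.

Lemma denominator_deriv t z : 0 < t <= 1 -> ~ real_segment lo' hi' z ->
  cderiv (denominator (lam *: a) (lam *: b) sigma f t) z
     (lam * ratio_limit' X a b (z / (t `^ sigma)%:C)).
Proof.
move=> t01 zN; have [thn _ wN] := notin_div t01 zN.
have [d d0 aw] := away_enlarge lo_hi' zN.
have d2 : 0 < d / 2 by rewrite divr_gt0.
apply: (@cderiv_near _ _ (fun w => lam * (t `^ sigma)%:C * ratio_limit X a b ((t `^ sigma)%:C^-1 * w)) _ _ (d / 2)) => // [w wz|].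
  rewrite denominatorE // => -[r]; rewrite /= in_itv /= => r01 wr.
  have := aw r _; rewrite wr -(cn_distC w) => /(_ _)/wrap[|h]; last by move: wz h d0; lra.
  by move: r01 d0; lra.
have -> : lam * ratio_limit' X a b (z / (t `^ sigma)%:C) =
   0 * ratio_limit X a b ((t `^ sigma)%:C^-1 * z) +
   lam * (t `^ sigma)%:C * ((t `^ sigma)%:C^-1 * ratio_limit' X a b (z / (t `^ sigma)%:C)).
  by rewrite mul0r add0r; move: (t `^ sigma)%:C thn => s thn; rewrite -mulrA mulVKf.
apply: (@cderivM _ (fun=> lam * (t `^ sigma)%:C)); first exact: cderiv_cst.
apply: cderiv_scale; rewrite (mulrC _ z).
exact: (cderiv_ratio a b lo_hi sizeX moments X_box wN).
Qed.

Lemma denominator_neq0 t z : 0 < t <= 1 -> ~ real_segment lo' hi' z ->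
  denominator (lam *: a) (lam *: b) sigma f t z != 0.
Proof.
move=> t01 zN; have [thn _ wN] := notin_div t01 zN.
rewrite denominatorE // !mulf_neq0 // mulrC.
exact: (ratio_limit_neq0 lo_hi sizeX moments X_box Y_box XY sizeA sizeB size_a size_b step_C cvg_A cvg_B wN).
Qed.

(** The factors of ratio_limit cancel by ratio_limit' = ratio_limit * incr_limit,
    which leaves th^-1 * incr_limit (z / th). *)
Lemma integrandE t z : 0 < t <= 1 -> ~ real_segment lo' hi' z ->
  integrand (lam *: a) (lam *: b) sigma f t z = transform' t z.
Proof.
move=> t01 zN; have [thn [d d0 cl] wN] := notin_div t01 zN.
have [t0 t1] := andP t01.
have th0 : 0 < t `^ sigma by exact: powR_gt0.
rewrite /integrand; have [_ ->] := cderiv_derive (denominator_deriv t01 zN).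
rewrite denominatorE // (mulrC _ z).
have := ratio_limit_deriv lo_hi sizeX moments self_similar X_box Y_box XY sizeA sizeB size_a size_b step_C cvg_A cvg_B wN.
have := ratio_limit_neq0 lo_hi sizeX moments X_box Y_box XY sizeA sizeB size_a size_b step_C cvg_A cvg_B wN.
rewrite /transform' /incr_limit.
have [-> ->] := dilatedE lo_hi sizeX moments X_box th0 d0 cl.
rewrite rmorphM /=; set w := z / (t `^ sigma)%:C.
move: (ratio_limit' X a b w) => D'; move: (ratio_limit X a b w) => D D0 ->.
rewrite /w; move: (stieltjes X 1 _) (stieltjes X 2 _) => G G2.
move: (sigma%:C) (t `^ sigma)%:C thn => s th thn.
by field; rewrite D0 thn lam0.
Qed.

Lemma lipschitz_powR_within (k : R -> R) (K s : R) : s <= 1 ->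
  (forall th th', ok th -> ok th' -> `|k th' - k th| <= K * `|th' - th|) ->
  {within `[0, s], continuous (fun t => k (t `^ sigma))}.
Proof.
move=> s1 lip; apply/subspace_continuousP => t ts; apply/cvgrPdist_le => e e0.
have K1 : 0 < `|K| + 1 by rewrite ltr_wpDl.
have e1 : 0 < e / (`|K| + 1) by rewrite divr_gt0.
have := (subspace_continuousP _ _).1 (@powR_within_continuous R sigma s sigma_ge0) t ts.
move=> /cvgrPdist_le/(_ _ e1); rewrite /from_subspace /prop_near1 /nbhs /= /within /=.
have okp u : u \in `[0, s] -> ok (u `^ sigma).
  by rewrite in_itv /= => /andP[u0 us]; apply: ok_pow; rewrite u0 (le_trans us).
apply: filterS => u hu us; have := lip _ _ (okp u us) (okp t ts); move/le_trans; apply.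
have := hu us; rewrite ler_pdivlMr //; apply: le_trans.
by rewrite mulrC; apply: ler_wpM2l => //; rewrite (le_trans (ler_norm _)) // lerDl.
Qed.

Section Component.
Variable pr : R[i] -> R.
Hypothesis prB : forall u v, pr (u - v) = pr u - pr v.
Hypothesis prD : forall u v, pr (u + v) = pr u + pr v.
Hypothesis prZ : forall (r : R) u, pr (r%:C * u) = r * pr u.
Hypothesis pr_le : forall u, `|pr u| <= cn u.

(** The integrand is the t-derivative of transform, by the chain rule through
    th = t ^ sigma and the Taylor estimate of dilated. *)
Lemma transform_ftc s z : 0 < s <= 1 -> ~ real_segment lo' hi' z ->
  lebesgue_measure.-integrable `[0, s] (EFin \o (fun t => pr (transform' t z))) /\
  \int[lebesgue_measure]_(t in `[0, s]) pr (transform' t z) = pr (transform s z).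
Proof.
move=> /andP[s0 s1] zN; have [d d0 cl] := ok_clear zN.
have ok0 th : ok th -> 0 <= th by move=> /ok01/andP[].
pose k th := pr (dilated X th z); pose k' th := pr (dilated' X th z).
have ck : {within `[0, s], continuous (fun t => k (t `^ sigma))}.
  apply: (lipschitz_powR_within (K := C * d^-1 ^+ 2)) => // th th' o o'.
  rewrite /k -prB; apply: (le_trans (pr_le _)).
  exact: (dilated_lipschitz lo_hi sizeX moments X_box box_C (ok0 _ o) (ok0 _ o') d0 (cl _ o) (cl _ o')).
have ck' : {within `[0, s], continuous (fun t => k' (t `^ sigma))}.
  apply: (lipschitz_powR_within (K := 2 * C ^+ 2 * d^-1 ^+ 3)) => // th th' o o'.
  rewrite /k' -prB; apply: (le_trans (pr_le _)).
  exact: (dilated'_lipschitz lo_hi sizeX moments X_box box_C (ok0 _ o) (ok0 _ o') d0 (cl _ o) (cl _ o')).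
have cpow := @powR_within_continuous R sigma s sigma_ge0.
have FE t : pr (transform t z) = t * k (t `^ sigma) by rewrite /transform prZ.
have qE t : pr (transform' t z) = k (t `^ sigma) + sigma * t `^ sigma * k' (t `^ sigma).
  by rewrite /transform' prD prZ.
have [] := @ftc_within R (fun t => pr (transform t z)) (fun t => pr (transform' t z)) s s0.
- apply/subspace_continuousP => t ts; rewrite /from_subspace.
  under eq_fun do rewrite FE.
  rewrite FE; apply: cvgM; first by apply: cvg_within_filter; exact: cvg_id.
  by have /subspace_continuousP/(_ t ts) := ck.
- apply/subspace_continuousP => t ts; rewrite /from_subspace.
  under eq_fun do rewrite qE.
  rewrite qE; apply: cvgD; first by have /subspace_continuousP/(_ t ts) := ck.
  apply: cvgM; last by have /subspace_continuousP/(_ t ts) := ck'.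
  apply: cvgM; first exact: cvg_cst.
  by have /subspace_continuousP/(_ t ts) := cpow.
- move=> t /andP[t0 ts].
  have t1 : t < 1 by exact: lt_le_trans ts s1.
  have okt : ok (t `^ sigma) by apply: ok_pow; rewrite !ltW.
  have dk : is_derive t 1 (fun u => k (u `^ sigma)) (sigma * t `^ (sigma - 1) * k' (t `^ sigma)).
    apply: (is_derive_quadratic (M := C ^+ 2 * d^-1 ^+ 3) (is_derive1_powR sigma t0)).
    have near_t : \forall u \near t, u \in `]0, 1[.
      by apply: near_in_itvoo; rewrite in_itv /= t0.
    apply: filterS near_t => u; rewrite in_itv /= => /andP[u0 u1].
    have oku : ok (u `^ sigma) by apply: ok_pow; rewrite !ltW.
    rewrite /k /k' -prZ -!prB; apply: (le_trans (pr_le _)).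
    exact: (dilated_taylor lo_hi sizeX moments X_box box_C (ok0 _ okt) (ok0 _ oku) d0 (cl _ okt) (cl _ oku)).
  have -> : (fun t => pr (transform t z)) = (fun u => u) * (fun u => k (u `^ sigma)).
    by apply/funext => u; rewrite FE.
  rewrite qE.
  have tt : t * t `^ (sigma - 1) = t `^ sigma.
    have nz (r : R) : (r == 0) ==> (t != 0) by rewrite (gt_eqF t0) implybT.
    have {1}-> : t = t `^ 1 by rewrite powRr1 // ltW.
    by rewrite -powRD ?nz//; congr (_ `^ _); ring.
  apply: is_derive_eq; rewrite /GRing.scale /= mulr1 -tt; ring.
- move=> iq ->; split => //.
  by rewrite FE [pr (transform 0 z)]FE mul0r subr0 -FE.
Qed.

End Component.

Lemma transform_integral s z : 0 <= s <= 1 -> ~ real_segment lo' hi' z ->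
  cintegrable `[0, s] (fun t => integrand (lam *: a) (lam *: b) sigma f t z) /\
  f s z = cintegral `[0, s] (fun t => integrand (lam *: a) (lam *: b) sigma f t z).
Proof.
move=> s01 zN; have [s0 s1] := andP s01; rewrite f_transform //.
have main (pr : R[i] -> R) : (forall u v, pr (u - v) = pr u - pr v) ->
    (forall u v, pr (u + v) = pr u + pr v) -> (forall (r : R) u, pr (r%:C * u) = r * pr u) ->
    (forall u, `|pr u| <= cn u) ->
  lebesgue_measure.-integrable `[0, s] (fun t => (pr (integrand (lam *: a) (lam *: b) sigma f t z))%:E) /\
  \int[lebesgue_measure]_(t in `[0, s]) pr (integrand (lam *: a) (lam *: b) sigma f t z) = pr (transform s z).
  move=> prB prD prZ pr_le.
  pose q t : R := if s == 0 then 0 else pr (transform' t z).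
  have [iq q_int] : lebesgue_measure.-integrable `[0, s] (EFin \o q) /\
      \int[lebesgue_measure]_(t in `[0, s]) q t = pr (transform s z).
    rewrite /q; have [s_eq0|sn0] := eqVneq s 0.
      split; first exact: integrable0.
      have pr0 : pr 0 = 0 by have := prB 0 0; rewrite !subrr.
      by rewrite s_eq0 transform0 pr0 /Rintegral integral0.
    by apply: transform_ftc => //; rewrite lt0r sn0 s0.
  have [|ig ge] := integral_off0 s0 iq (g := fun t => pr (integrand (lam *: a) (lam *: b) sigma f t z)).
    move=> t /andP[t0 ts]; rewrite /q ifF; last by rewrite gt_eqF // (lt_le_trans t0).
    by rewrite integrandE // t0 (le_trans ts).
  by split; [exact: ig | rewrite ge].
have [||r u||i1 e1] := main (@complex.Re R); [exact: raddfB | exact: raddfD | | exact: Re_le_cn |].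
  by rewrite ReM /= mul0r subr0.
have [||r u||i2 e2] := main (@complex.Im R); [exact: raddfB | exact: raddfD | | exact: Im_le_cn |].
  by rewrite ImM /= mul0r addr0.
split; first by split.
by rewrite /cintegral e1 e2; case: (transform s z).
Qed.

(** z / (z - th y) tends to 1 uniformly on the segment as z tends to infinity. *)
Lemma transform_infinity s : 0 <= s <= 1 ->
  (z * f s z : R[i]^o) @[z --> cinfty_nbhs] --> (s%:C : R[i]^o).
Proof.
move=> s01; have [s0 s1] := andP s01.
have C0 : 0 <= C by apply: le_trans (box_C (y := lo) _); rewrite // lexx.
have FF : Filter (cinfty_nbhs : set_system (R[i]^o)).
  split; first by exists 0.
    move=> U V [M1 h1] [M2 h2]; exists (maxr M1 M2) => z; rewrite normr_cn ltcR gt_max => /andP[z1 z2].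
    by split; [apply: h1 | apply: h2]; rewrite normr_cn ltcR.
  by move=> U V UV [M h]; exists M => z /h /UV.
apply: cvgC_of_cn => e e0.
exists (C + C / e + `|lo'| + `|hi'|) => z; rewrite normr_cn ltcR => zM /=.
have Ce : 0 <= C / e by rewrite divr_ge0 // ltW.
have zC : C / e < cn z - C by have := normr_ge0 lo'; have := normr_ge0 hi'; move: zM; lra.
have zN : ~ real_segment lo' hi' z.
  move=> [r]; rewrite /= in_itv /= => /andP[r1 r2] rz; move: zM; rewrite -rz cnR.
  have : `|r| <= `|lo'| + `|hi'|.
    have := ler_norm (- lo'); rewrite normrN; have := ler_norm hi'.
    have := normr_ge0 lo'; have := normr_ge0 hi'; move: r1 r2; rewrite ler_norml.
    by move: `|lo'| `|hi'| => p q; lra.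
  move: Ce C0; lra.
rewrite f_transform // /transform.
have -> : z * (s%:C * dilated X (s `^ sigma) z) - s%:C = s%:C * (z * dilated X (s `^ sigma) z - 1) by ring.
rewrite cnM cnR ger0_norm //.
have h := dilated_infinity lo_hi sizeX moments X_box box_C (ok01 (ok_pow s01)) (_ : C < cn z).
apply: le_lt_trans (ler_piMl (cn_ge0 _) s1) _; apply: le_lt_trans (h _) _.
  by move: zC Ce; lra.
rewrite ltr_pdivrMr; last by move: zC Ce; lra.
by rewrite mulrC -ltr_pdivrMr.
Qed.

Variables (P : nat -> {poly R[i]}) (phi : nat -> R).
Hypothesis P0 : P 0%N = 1.
Hypothesis P_roots : forall n, (0 < n)%N -> exists2 c : R[i], c != 0 &
  P n = c *: roots_poly [seq (phi n * y)%:C | y <- X n].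
Hypothesis phi_gt0 : forall n, (0 < n)%N -> 0 < phi n.
Hypothesis phi_truncn_cvg : forall t : R, 0 < t <= 1 ->
  phi (truncn (n%:R * t)) / phi n @[n --> \oo] --> t `^ sigma.
Hypothesis ok_ratio : forall m n, (0 < m <= n)%N -> ok (phi m / phi n).

(** The logarithmic derivative of P m is the sum of 1 / (w - x) over its zeros;
    at w = phi n * z it becomes a mean over the zeros on the scale phi m. *)
Lemma rescaled_log_derivE n t z : (0 < n)%N -> (0 < truncn (n%:R * t))%N -> 0 < t <= 1 ->
  ~ real_segment lo' hi' z ->
  rescaled_log_deriv P phi n (t, z) = ((truncn (n%:R * t))%:R / n%:R)%:C *
    cmean X (fun y => (z - (phi (truncn (n%:R * t)) / phi n * y)%:C)^-1) (truncn (n%:R * t)).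
Proof.
move=> n0 m0 /andP[t0 t1] zN; rewrite /rescaled_log_deriv /=; set m := truncn _ in m0 *.
have nR0 : 0 < n%:R :> R by rewrite ltr0n.
have mn : (m <= n)%N.
  rewrite -(ler_nat R); apply: (@le_trans _ _ (n%:R * t)).
    by rewrite truncn_le mulr_ge0 // ltW.
  by rewrite ler_piMr // ltW.
have [d d0 cl] := ok_clear zN.
have clm := cl _ (ok_ratio (introT andP (conj m0 mn))).
have phin := phi_gt0 n0; have phinC : (phi n)%:C != 0 :> R[i] by rewrite -cn_gt0 cnR gtr0_norm.
have factor y : (phi n)%:C * z - (phi m * y)%:C = (phi n)%:C * (z - (phi m / phi n * y)%:C).
  rewrite mulrBr; congr (_ - _); rewrite -rmorphM; congr (_%:C).
  by rewrite mulrA mulrCA divff ?gt_eqF// mulr1.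
have [c c0 ->] := P_roots m0.
have notin : (phi n)%:C * z \notin [seq (phi m * y)%:C | y <- X m].
  apply/negP => /mapP[y yX zy]; have := clm y (X_box yX).
  have /eqP : (phi n)%:C * z - (phi m * y)%:C = 0 by rewrite zy subrr.
  by rewrite factor mulf_eq0 (negbTE phinC) /= => /eqP ->; rewrite cn0 leNgt d0.
rewrite derivZ !hornerZ log_deriv_roots_poly // big_map.
have pz0 : (roots_poly [seq (phi m * y)%:C | y <- X m]).[(phi n)%:C * z] != 0.
  rewrite horner_roots_poly prodf_seq_neq0; apply/allP => u uX /=.
  by rewrite subr_eq0; apply: contraNneq notin => ->.
have -> : \sum_(y <- X m) ((phi n)%:C * z - (phi m * y)%:C)^-1 =
    (phi n)%:C^-1 * \sum_(y <- X m) (z - (phi m / phi n * y)%:C)^-1.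
  by rewrite mulr_sumr; apply: eq_bigr => y _; rewrite factor invfM.
rewrite /cmean !(rmorphM, fmorphV, rmorph_nat) /=.
have mC : (m%:R : R[i]) != 0 by rewrite pnatr_eq0 -lt0n.
have nC : (n%:R : R[i]) != 0 by rewrite pnatr_eq0 -lt0n.
move: (roots_poly _).[_] pz0 => p p0; move: (\sum_(_ <- _) _) => S.
by move: (phi n)%:C phinC => s s0; field; rewrite p0 c0 nC mC s0.
Qed.

Lemma rescaled_log_deriv_cvg t z : 0 <= t <= 1 -> ~ real_segment lo' hi' z ->
  ccvg (fun n => rescaled_log_deriv P phi n (t, z)) (transform t z).
Proof.
move=> /andP[+ t1] zN; rewrite le_eqVlt => /predU1P[<-|t0].
  rewrite transform0; apply: (ccvg_ext (v := fun=> 0)) => [n|]; last exact: ccvg_cst.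
  by rewrite /rescaled_log_deriv /= mulr0 truncn0 P0 derivC horner0 mul0r mulr0.
have t01 : 0 < t <= 1 by rewrite t0.
have [d d0 cl] := ok_clear zN.
have okt : ok (t `^ sigma) by apply: ok_pow; rewrite ltW.
have [N hN] := truncn_oo 1 t0.
pose m n := maxn 1 (truncn (n%:R * t)).
pose ths n := if (N.+1 <= n)%N then phi (truncn (n%:R * t)) / phi n else t `^ sigma.
have mn n : (N.+1 <= n)%N -> (0 < truncn (n%:R * t) <= n)%N.
  move=> Nn; rewrite hN ?(ltnW Nn)//= -(ler_nat R); apply: (@le_trans _ _ (n%:R * t)).
    by rewrite truncn_le mulr_ge0 // ltW.
  by rewrite ler_piMr.
have okths n : ok (ths n) by rewrite /ths; case: ifP => // /mn; apply: ok_ratio.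
have ths_cvg : ths n @[n --> \oo] --> t `^ sigma.
  by apply: (cvgn_near (N := N.+1) _ (phi_truncn_cvg t01)) => n Nn; rewrite /ths Nn.
have moving := dilated_moving lo_hi sizeX moments X_box box_C d0 (_ : 0 <= t `^ sigma) (cl _ okt) (fun n => cl _ (okths n)) ths_cvg (m := fun n => truncn (n%:R * t)).
have ratio_cvg := ccvgR (truncn_ratio sigma_ge0 (ltW t0)).
apply: (ccvg_near (N := N.+1) _ (ccvgM ratio_cvg (moving _ _))) => [n Nn||K].
- rewrite rescaled_log_derivE ?(leq_trans _ Nn)//; last by have /andP[] := mn n Nn.
  by rewrite /ths Nn.
- exact: powR_ge0.
- exact: truncn_oo.
Qed.

End LimitTransform.

(** * Coefficients of quadratic polynomials and real parts *)

Lemma coef_mul_top (F : comNzRingType) (p q : {poly F}) i j :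
  (size p <= i.+1)%N -> (size q <= j.+1)%N -> (p * q)`_(i + j) = p`_i * q`_j.
Proof.
move=> sp sq; rewrite coefM.
have ij : (i < (i + j).+1)%N by rewrite ltnS leq_addr.
rewrite (bigD1 (Ordinal ij)) //= addKn big1 ?addr0 // => k ki.
have [lt_ik|le_ki] := ltnP i k.
  by rewrite nth_default ?mul0r // (leq_trans sp).
have lt_ki : (k < i)%N by rewrite ltn_neqAle le_ki andbT; exact: ki.
by rewrite [q`_ _]nth_default ?mulr0 // (leq_trans sq) //; move: lt_ki; clear; lia.
Qed.

Lemma interlacing_map (R : realType) (xi eta : nat -> R) n : forall m,
  (forall k, (m <= k < m + n)%N -> eta k <= xi k <= eta k.+1) ->
  interlacing (eta m) [seq xi k | k <- iota m n] [seq eta k | k <- iota m.+1 n].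
Proof.
elim: n => [|n IH] m h //=.
have /andP[h1 h2] := h m ltac:(lia).
by split=> //; apply: IH => k hk; apply: h; move: hk; clear; lia.
Qed.

Section Coefficients.
Variable R : realType.
Implicit Types (p q : {poly R[i]}).

(** The polynomial c p(s X), written so that its size is visibly at most N. *)
Definition dilate N (c s : R[i]) p : {poly R[i]} := \poly_(i < N) (c * s ^+ i * p`_i).

Lemma horner_dilate N c s p u : (size p <= N)%N -> (dilate N c s p).[u] = c * p.[s * u].
Proof.
move=> sp; rewrite horner_poly (horner_coef_wide _ sp) mulr_sumr.
by apply: eq_bigr => i _; rewrite exprMn; ring.
Qed.

Lemma quadratic_coef p : (size p <= 3)%N ->
  [/\ p`_0 = p.[0], p`_1 = (p.[1] - p.[-1]) / 2, p`_2 = (p.[1] + p.[-1]) / 2 - p.[0] &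
   forall i, (3 <= i)%N -> p`_i = 0].
Proof.
move=> sp; have E u : p.[u] = p`_0 + p`_1 * u + p`_2 * u ^+ 2.
  rewrite (horner_coef_wide _ sp) big_ord_recr big_ord_recr big_ord_recr big_ord0 /=.
  by rewrite add0r expr0 mulr1 expr1.
split; last by move=> i hi; rewrite nth_default // (leq_trans sp).
- by rewrite E; ring.
- by rewrite !E; field.
- by rewrite !E; field.
Qed.

(** The coefficients are linear combinations of the values at 0, 1 and -1. *)
Lemma quadratic_coef_cvg (p : nat -> {poly R[i]}) q :
  (forall n, (size (p n) <= 3)%N) -> (size q <= 3)%N ->
  (forall z, ccvg (fun n => (p n).[z]) q.[z]) -> forall i, ccvg (fun n => (p n)`_i) q`_i.
Proof.
move=> sp sq pq i; have [q0 q1 q2 qi] := quadratic_coef sq.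
have E n := quadratic_coef (sp n).
case: i => [|[|[|i]]].
- by rewrite q0; apply: ccvg_ext (pq 0) => n; have [] := E n.
- rewrite q1; apply: (ccvg_ext (v := fun n => ((p n).[1] - (p n).[-1]) / 2)) => [n|].
    by have [] := E n.
  by apply: ccvgM; [apply: ccvgB | exact: ccvg_cst].
- rewrite q2; apply: (ccvg_ext (v := fun n => ((p n).[1] + (p n).[-1]) / 2 - (p n).[0])) => [n|].
    by have [] := E n.
  by apply: ccvgB => //; apply: ccvgM; [apply: ccvgD | exact: ccvg_cst].
- rewrite qi //; apply: (ccvg_ext (v := fun=> 0)) => [n|]; last exact: ccvg_cst.
  by have [_ _ _ ->] := E n.
Qed.

Lemma ccvgV (u : nat -> R[i]) l : ccvg u l -> l != 0 -> ccvg (fun n => (u n)^-1) l^-1.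
Proof.
move=> ul l0 e e0; have cl : 0 < cn l by rewrite cn_gt0.
have c2 : 0 < cn l / 2 by rewrite divr_gt0.
have [N hN] := ul _ c2.
have e1 : 0 < e * (cn l * (cn l / 2)) by rewrite !mulr_gt0.
have [M hM] := ul _ e1.
exists (maxn N M) => n; rewrite geq_max => /andP[/hN h1 /hM h2].
have h3 : cn l / 2 <= cn (u n) by have := cnB l (l - u n); rewrite subKr (cn_distC l); move: h1; lra.
have un0 : u n != 0 by rewrite -cn_gt0 (lt_le_trans c2).
rewrite inv_diff // !cnM !cnV cn_distC.
have den : 0 < cn l * cn (u n) by rewrite mulr_gt0 // cn_gt0.
rewrite -invfM ler_pdivrMr ?(mulrC (cn (u n)))//.
apply: (le_trans h2); apply: ler_wpM2l; rewrite ?(ltW e0)//.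
by apply: ler_wpM2l; rewrite ?(ltW cl).
Qed.

Lemma ccvg_of_cvgC (u : nat -> R[i]) (l : R[i]) :
  (u n : R[i]^o) @[n --> \oo] --> (l : R[i]^o) -> ccvg u l.
Proof.
by move=> ul e e0; have [N _ hN] := cn_of_cvgC _ ul e0; exists N => n /hN /ltW.
Qed.

Definition Repoly p : {poly R} := \poly_(i < size p) complex.Re p`_i.

Lemma coef_Repoly p i : (Repoly p)`_i = complex.Re p`_i.
Proof.
rewrite coef_poly; case: ltnP => // h; by rewrite nth_default.
Qed.

Lemma size_Repoly p N : (size p <= N)%N -> (size (Repoly p) <= N)%N.
Proof. exact/leq_trans/size_poly. Qed.

Lemma horner_Repoly p (u : R) : (Repoly p).[u] = complex.Re p.[u%:C].
Proof.
rewrite horner_poly horner_coef raddf_sum; apply: eq_bigr => i _.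
by rewrite -rmorphXn /= ReM /= mulr0 subr0.
Qed.

End Coefficients.

(** * Reduction to monic polynomials with real coefficients *)

Section Reduction.
Variables (R : realType) (P A B : nat -> {poly R[i]}) (a b : {poly R[i]}).
Variables (x : nat -> nat -> R) (phi L : nat -> R) (alpha beta sigma : R).
Hypothesis sizeA : forall n, (size (A n) <= 3)%N.
Hypothesis sizeB : forall n, (size (B n) <= 2)%N.
Hypothesis recP : forall n, P n.+1 = A n * (P n)^`() + B n * P n.
Hypothesis zerosP : forall n, ordered_real_zeros n (P n) (fun k => x k n).
Hypothesis interlace : forall n k, (2 <= n)%N -> (1 <= k <= n.-1)%N ->
  x k n <= x k n.-1 <= x k.+1 n.
Hypothesis phi_gt0 : forall n, (0 < n)%N -> 0 < phi n.
Hypothesis phi_incr : forall m n, (0 < m <= n)%N -> phi m <= phi n.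
Hypothesis le_alpha_beta : alpha <= beta.
Hypothesis zeros_bounded : forall n k, (1 <= k <= n)%N -> alpha <= x k n / phi n <= beta.
Hypothesis sigma_ge0 : 0 <= sigma.
Hypothesis phi_rv : regularly_varying sigma phi L.
Hypothesis size_a : (size a <= 3)%N.
Hypothesis size_b : (size b <= 2)%N.
Hypothesis limA : forall z : R[i],
  ((n%:R / phi n ^+ 2)%:C * (A n).[(phi n)%:C * z] : R[i]^o) @[n --> \oo] --> (a.[z] : R[i]^o).
Hypothesis limB : forall z : R[i],
  (((phi n)^-1)%:C * (B n).[(phi n)%:C * z] : R[i]^o) @[n --> \oo] --> (b.[z] : R[i]^o).
Hypothesis nondeg : a`_2 + b`_1 != 0.

Definition zerosX n := [seq x k n / phi n | k <- index_iota 1 n.+1].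
(** The zeros of P n.+1 on the scale phi n. At n = 0, where phi is arbitrary, the
    conventions here and in monicA and monicB make the recurrence hold. *)
Definition zerosY n := if n == 0%N then [:: 0] else [seq x k n.+1 / phi n | k <- index_iota 1 n.+2].

Let lc n : R[i] := lead_coef (P n).
Definition lead_ratio n := lc n.+1 / lc n.

Lemma lc_neq0 n : lc n != 0.
Proof.
rewrite /lc lead_coef_eq0 -size_poly_eq0; by have [-> _ _] := zerosP n.
Qed.

Lemma lead_ratio_neq0 n : lead_ratio n != 0.
Proof. by rewrite /lead_ratio mulf_neq0 ?invr_eq0 ?lc_neq0. Qed.

Let phiC n : (0 < n)%N -> (phi n)%:C != 0 :> R[i].
Proof. by move=> /phi_gt0 h; rewrite -cn_gt0 cnR gtr0_norm. Qed.

Definition scaledA n := dilate 3 (n%:R / phi n ^+ 2)%:C (phi n)%:C (A n).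
Definition scaledB n := dilate 2 ((phi n)^-1)%:C (phi n)%:C (B n).
(** The coefficients of the recurrence between the monic polynomials with zeros
    zerosX n and zerosY n. *)
Definition monicA n : {poly R[i]} := if n == 0%N then 0 else (lead_ratio n)^-1 *: scaledA n.
Definition monicB n : {poly R[i]} := if n == 0%N then 'X else (lead_ratio n)^-1 *: scaledB n.

Let cs (s : seq R) : seq R[i] := [seq y%:C | y <- s].

Lemma size_zerosX n : size (zerosX n) = n.
Proof. by rewrite size_map size_iota subn1. Qed.

Lemma size_zerosY n : size (zerosY n) = n.+1.
Proof. by rewrite /zerosY; case: n => [|n] //=; rewrite size_map size_iota. Qed.

Lemma size_monicA n : (size (monicA n) <= 3)%N.
Proof.
rewrite /monicA; case: eqP => _; first by rewrite size_poly0.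
exact: leq_trans (size_scale_leq _ _) (size_poly _ _).
Qed.

Lemma size_monicB n : (size (monicB n) <= 2)%N.
Proof.
rewrite /monicB; case: eqP => _; first by rewrite size_polyX.
exact: leq_trans (size_scale_leq _ _) (size_poly _ _).
Qed.

Let rescaled m n : seq R[i] := [seq (x k m / phi n)%:C | k <- index_iota 1 m.+1].

Lemma P_rescaled m n : (0 < n)%N ->
  P m \Po ((phi n)%:C *: 'X) = (lc m * (phi n)%:C ^+ m) *: roots_poly (rescaled m n).
Proof.
move=> n0; have [_ -> _] := zerosP m; rewrite -/(lc m).
rewrite comp_polyZ -scalerA; congr (_ *: _).
rewrite /roots_poly /rescaled big_map rmorph_prod /=.
rewrite [RHS](_ : _ = \prod_(1 <= k < m.+1) ((phi n)%:C *: ('X - ((x k m / phi n)%:C)%:P))); last first.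
  by rewrite scaler_prod prodr_const_nat subn1.
apply: eq_bigr => k _; rewrite comp_polyB comp_polyX comp_polyC scalerBr; congr (_ - _).
by rewrite -mul_polyC -polyCM -rmorphM mulrC divfK // gt_eqF // phi_gt0.
Qed.

Lemma cs_zerosX n : cs (zerosX n) = rescaled n n.
Proof. by rewrite /cs /zerosX -map_comp. Qed.

Lemma cs_zerosY n : (0 < n)%N -> cs (zerosY n) = rescaled n.+1 n.
Proof. by rewrite /cs /zerosY; case: n => // n _; rewrite -map_comp. Qed.

Lemma monic_step n : roots_poly (cs (zerosY n)) =
  ((n%:R : R[i])^-1 *: monicA n) * (roots_poly (cs (zerosX n)))^`() + monicB n * roots_poly (cs (zerosX n)).
Proof.
have [->|n0] := posnP n.
  rewrite /monicA /monicB /zerosX /zerosY /= /roots_poly !(big_cons, big_nil).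
  by rewrite rmorph0 subr0 scaler0 mul0r add0r.
rewrite cs_zerosX cs_zerosY // /monicA /monicB !gtn_eqF //.
have p0 := phiC n0; have nz : (n%:R : R[i]) != 0 by rewrite pnatr_eq0 -lt0n.
have e1 := P_rescaled n n0; have e2 := P_rescaled n.+1 n0.
apply: poly_eq_horner => u _.
have lX : ('X : {poly R[i]})^`().[u] = 1 by rewrite derivX hornerC.
have h1 := congr1 (fun p => p.[u]) e1; rewrite /= horner_comp !hornerZ hornerX in h1.
have h2 := congr1 (fun p => p.[u]) e2; rewrite /= horner_comp !hornerZ hornerX recP !(hornerD, hornerM) h1 in h2.
have h3 := congr1 (fun p => p^`().[u]) e1; rewrite /= deriv_comp !derivZ hornerM horner_comp !hornerZ lX hornerX mulr1 in h3.
have h4 : (P n)^`().[(phi n)%:C * u] = lc n * (phi n)%:C ^+ n * (roots_poly (rescaled n n))^`().[u] / (phi n)%:C.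
  by rewrite -h3 mulfK.
rewrite h4 in h2.
rewrite !(hornerD, hornerM, hornerZ) !horner_dilate // /lead_ratio.
rewrite !(rmorphM, fmorphV, rmorphXn, rmorph_nat) /=.
have l0 := lc_neq0 n; have l1 := lc_neq0 n.+1.
apply: (mulfI (mulf_neq0 l1 (expf_neq0 n.+1 p0))).
rewrite -h2 exprS.
move: (lc n) (lc n.+1) (phi n)%:C l0 l1 p0 => l l' s l0 l1 p0.
move: (s ^+ n) => t.
by field; rewrite p0 nz l0 l1.
Qed.

Lemma size_roots_poly (F : fieldType) (s : seq F) : size (roots_poly s) = (size s).+1.
Proof. by rewrite /roots_poly size_prod_XsubC. Qed.

Lemma roots_poly_top (F : fieldType) (s : seq F) : (roots_poly s)`_(size s) = 1.
Proof.
have /monicP := monic_prod_XsubC s xpredT id.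
by rewrite /lead_coef size_prod_XsubC.
Qed.

Lemma monic_coef_sum n : (0 < n)%N -> (monicA n)`_2 + (monicB n)`_1 = 1.
Proof.
move=> n0; have nz : (n%:R : R[i]) != 0 by rewrite pnatr_eq0 -lt0n.
have sX : size (cs (zerosX n)) = n by rewrite size_map size_zerosX.
have := congr1 (fun p : {poly R[i]} => p`_(n.+1)) (monic_step n).
have topY : (roots_poly (cs (zerosY n)))`_n.+1 = 1.
  by have := roots_poly_top (cs (zerosY n)); rewrite size_map size_zerosY.
have topX : (roots_poly (cs (zerosX n)))`_n = 1.
  by have := roots_poly_top (cs (zerosX n)); rewrite sX.
rewrite topY coefD.
set rX := roots_poly (cs (zerosX n)).
have srX : size rX = n.+1 by rewrite size_roots_poly sX.
have sdX : (size rX^`() <= n.-1.+1)%N.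
  by rewrite prednK //; have := lt_size_deriv (_ : rX != 0); rewrite srX -size_poly_eq0 srX => /(_ isT).
have -> : (n%:R^-1 *: monicA n * rX^`())`_n.+1 = (monicA n)`_2.
  have -> : n.+1 = (2 + n.-1)%N by rewrite addSn add1n prednK.
  rewrite coef_mul_top //; last by rewrite (leq_trans (size_scale_leq _ _)) ?size_monicA.
  rewrite coefZ coef_deriv prednK // topX.
  by rewrite mulrAC mulVf // mul1r.
have -> : (monicB n * rX)`_n.+1 = (monicB n)`_1.
  by rewrite -add1n coef_mul_top ?size_monicB ?srX// topX mulr1.
by move=> <-.
Qed.

(** Compare the leading coefficients in the recurrence. *)
Lemma lead_ratioE n : (0 < n)%N -> lead_ratio n = (scaledA n)`_2 + (scaledB n)`_1.
Proof.
move=> n0; have := monic_coef_sum n0; rewrite /monicA /monicB gtn_eqF // !coefZ -mulrDr => h.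
by rewrite -[LHS]mulr1 -h mulVKf // lead_ratio_neq0.
Qed.

Lemma scaledA_cvg i : ccvg (fun n => (scaledA n)`_i) a`_i.
Proof.
apply: quadratic_coef_cvg => // [n|z]; first exact: size_poly.
apply: (ccvg_ext (v := fun n => (n%:R / phi n ^+ 2)%:C * (A n).[(phi n)%:C * z])) => [n|].
  exact: horner_dilate.
exact (@ccvg_of_cvgC R _ _ (@limA z)).
Qed.

Lemma scaledB_cvg i : ccvg (fun n => (scaledB n)`_i) b`_i.
Proof.
apply: quadratic_coef_cvg => [n||z]; first exact: leq_trans (size_poly _ _) _.
  exact: leq_trans size_b _.
apply: (ccvg_ext (v := fun n => ((phi n)^-1)%:C * (B n).[(phi n)%:C * z])) => [n|].
  exact: horner_dilate.
exact (@ccvg_of_cvgC R _ _ (@limB z)).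
Qed.

Let lam := a`_2 + b`_1.
Definition limitA := lam^-1 *: a.
Definition limitB := lam^-1 *: b.

Lemma lead_ratio_cvg : ccvg lead_ratio lam.
Proof.
apply: (ccvg_near (N := 1%N) (v := fun n => (scaledA n)`_2 + (scaledB n)`_1)) => [n|].
  exact: lead_ratioE.
by apply: ccvgD; [exact: scaledA_cvg | exact: scaledB_cvg].
Qed.

Lemma monicA_cvg i : ccvg (fun n => (monicA n)`_i) limitA`_i.
Proof.
apply: (ccvg_near (N := 1%N) (v := fun n => (lead_ratio n)^-1 * (scaledA n)`_i)) => [n n0|].
  by rewrite /monicA gtn_eqF // coefZ.
rewrite coefZ; apply: ccvgM; last exact: scaledA_cvg.
by apply: ccvgV => //; exact: lead_ratio_cvg.
Qed.

Lemma monicB_cvg i : ccvg (fun n => (monicB n)`_i) limitB`_i.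
Proof.
apply: (ccvg_near (N := 1%N) (v := fun n => (lead_ratio n)^-1 * (scaledB n)`_i)) => [n n0|].
  by rewrite /monicB gtn_eqF // coefZ.
rewrite coefZ; apply: ccvgM; last exact: scaledB_cvg.
by apply: ccvgV => //; exact: lead_ratio_cvg.
Qed.

Lemma roots_polyR (s : seq R) (u : R) : (roots_poly (cs s)).[u%:C] = ((roots_poly s).[u])%:C.
Proof.
by rewrite !horner_roots_poly big_map rmorph_prod; apply: eq_bigr => y _; rewrite rmorphB.
Qed.

Lemma deriv_roots_polyR (s : seq R) (u : R) : (roots_poly (cs s))^`().[u%:C] = ((roots_poly s)^`().[u])%:C.
Proof.
have -> : roots_poly (cs s) = map_poly (real_complex R) (roots_poly s).
  by rewrite /roots_poly map_prod_XsubC big_map.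
by rewrite deriv_map horner_map.
Qed.

(** Evaluate the complex recurrence at real points and take real parts. The
    imaginary parts of the coefficients need not vanish: when p_X and p_X' have
    common zeros, the recurrence does not determine its coefficients. *)
Lemma real_step n : roots_poly (zerosY n) =
  (n%:R^-1 *: Repoly (monicA n)) * (roots_poly (zerosX n))^`() + Repoly (monicB n) * roots_poly (zerosX n).
Proof.
apply: poly_eq_horner => u _; apply: (@complexI R).
have h := congr1 (fun p => complex.Re p.[u%:C]) (monic_step n).
rewrite /= !(hornerD, hornerM, hornerZ) !roots_polyR deriv_roots_polyR /= in h.
rewrite !(hornerD, hornerM, hornerZ) !horner_Repoly; congr (_%:C).
have -> : (roots_poly (zerosY n)).[u] = complex.Re ((roots_poly (zerosY n)).[u])%:C by [].
rewrite h.
have -> : (n%:R : R[i])^-1 = (n%:R^-1)%:C by rewrite fmorphV rmorph_nat.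
by rewrite raddfD /= !ReM /= !ImM /=; ring.
Qed.

Lemma ReA_cvg i : (Repoly (monicA n))`_i @[n --> \oo] --> (Repoly limitA)`_i.
Proof.
have /ccvgP[h _] := monicA_cvg i; rewrite coef_Repoly.
by apply: cvgn_ext h => n; rewrite coef_Repoly.
Qed.

Lemma ReB_cvg i : (Repoly (monicB n))`_i @[n --> \oo] --> (Repoly limitB)`_i.
Proof.
have /ccvgP[h _] := monicB_cvg i; rewrite coef_Repoly.
by apply: cvgn_ext h => n; rewrite coef_Repoly.
Qed.

Lemma scaling_zeros K n : (0 < n)%N ->
  psum K (zerosX n.+1) * phi n.+1 ^+ K = psum K (zerosY n) * phi n ^+ K.
Proof.
move=> n0; rewrite /psum /zerosX /zerosY gtn_eqF // !big_map !mulr_suml.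
apply: eq_bigr => k _; rewrite -!exprMn !divfK // gt_eqF // phi_gt0 //.
Qed.

Lemma zerosX_box n y : y \in zerosX n -> alpha <= y <= beta.
Proof.
move=> /mapP[k]; rewrite mem_index_iota => kn ->; apply: zeros_bounded.
by move: kn; rewrite ltnS.
Qed.

Lemma zerosY_ratio n y : (0 < n)%N -> y \in zerosY n ->
  exists2 u, alpha <= u <= beta & y = u * (phi n.+1 / phi n).
Proof.
move=> n0; rewrite /zerosY gtn_eqF // => /mapP[k]; rewrite mem_index_iota => kn ->.
exists (x k n.+1 / phi n.+1); first by apply: zeros_bounded; move: kn; rewrite ltnS.
by rewrite mulrA divfK // gt_eqF // phi_gt0.
Qed.

Lemma zeros_interlacing n : exists y t, zerosY n = y :: t /\ interlacing y (zerosX n) t.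
Proof.
have [->|n0] := posnP n; first by exists 0, [::].
exists (x 1%N n.+1 / phi n), [seq x k n.+1 / phi n | k <- iota 2 n].
split; first by rewrite /zerosY gtn_eqF // /index_iota subSS subn0.
rewrite /zerosX /index_iota subSS subn0.
apply: (@interlacing_map _ (fun k => x k n / phi n) (fun k => x k n.+1 / phi n)) => k kn.
have pn : 0 < (phi n)^-1 by rewrite invr_gt0 phi_gt0.
rewrite !ler_pM2r //; apply: (interlace (n := n.+1)); first by rewrite ltnS.
by move: kn; rewrite add1n ltnS.
Qed.

Lemma ratio_succ_cvg : phi n.+1 / phi n @[n --> \oo] --> (1 : R).
Proof.
have h := phi_succ phi_gt0 phi_incr sigma_ge0 phi_rv.
apply: (cvgn_ext (v := fun n => (phi n / phi n.+1)^-1)) => [n|]; first by rewrite invf_div.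
by rewrite -[X in _ --> X]invr1; apply: cvgV => //; exact: oner_neq0.
Qed.

Let M : R := `|alpha| + `|beta|.

Lemma box_M y : alpha <= y <= beta -> `|y| <= M.
Proof.
move=> /andP[y1 y2]; have h1 := ler_norm (- alpha); have h2 := ler_norm beta.
rewrite normrN in h1; have h3 := normr_ge0 alpha; have h4 := normr_ge0 beta.
by rewrite ler_norml /M; move: y1 y2 h1 h2 h3 h4; move: `|alpha| `|beta| => p q; lra.
Qed.

(** The zeros of P n.+1 are within [alpha, beta] on their own scale, and
    phi n.+1 / phi n tends to 1. *)
Lemma zerosY_box (d : R) : 0 < d -> exists N, forall n y, (N <= n)%N -> y \in zerosY n ->
  alpha - d <= y <= beta + d.
Proof.
move=> d0; have M0 : 0 <= M by rewrite addr_ge0.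
have M1 : 0 < M + 1 by rewrite ltr_wpDl.
have e0 : 0 < d / (M + 1) by rewrite divr_gt0.
have /cvg0P/(_ _ e0)[N hN] := cvgn_sub0 ratio_succ_cvg.
exists N.+1 => n y Nn yY; have [|u ub ->] := zerosY_ratio _ yY; first exact: leq_trans Nn.
have := hN n (ltnW Nn); rewrite ler_pdivlMr //; set r := _ - 1 => rd.
have rE : phi n.+1 / phi n = 1 + r by rewrite /r addrC subrK.
have ur : `|u * r| <= d.
  rewrite normrM mulrC; apply: le_trans rd; apply: ler_wpM2l => //.
  by rewrite (le_trans (box_M ub)) // lerDl.
rewrite rE mulrDr mulr1; move: ur ub; rewrite ler_norml; lra.
Qed.

Lemma zeros_bound : exists C : R, [/\ forall y, alpha <= y <= beta -> `|y| <= C,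
  forall n y, y \in zerosX n -> `|y| <= C & forall n, `|increment zerosX zerosY 1 n| <= C].
Proof.
have [K hK] := cvgn_bounded ratio_succ_cvg.
have K0 : 0 <= K by apply: le_trans (hK 0%N).
have M0 : 0 <= M by rewrite addr_ge0.
have MK : 0 <= M * K by rewrite mulr_ge0.
have boxC y : alpha <= y <= beta -> `|y| <= M + 3 * (M * K).
  by move=> /box_M h; rewrite (le_trans h) // lerDl mulr_ge0.
exists (M + 3 * (M * K)); split=> [//|n y /zerosX_box/boxC//|n].
have Yb y : y \in zerosY n -> `|y| <= M * K.
  have [->|n0] := posnP n; first by rewrite inE => /eqP ->; rewrite normr0.
  move=> /(zerosY_ratio n0)[u /box_M uM ->]; rewrite normrM; apply: ler_pM => //.
have [y [t [Yn il]]] := zeros_interlacing n.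
have lip (u v : R) : True -> True -> cn (u%:C - v%:C) <= 1 * `|u - v| by rewrite -rmorphB cnR mul1r.
have := interlacing_sum (F := fun u => u%:C) (P := fun=> True) il (fun _ _ => I) (fun _ _ => I) ler01 lip.
rewrite -!rmorph_sum -rmorphB cnR mul1r.
have y1 : `|y| <= M * K by apply: Yb; rewrite Yn inE eqxx.
have y2 : `|last y t| <= M * K by apply: Yb; rewrite Yn mem_last.
have psum1 (r : seq R) : psum 1 r = \sum_(u <- r) u by apply: eq_bigr => u _; rewrite expr1.
rewrite /increment /dpsum !psum1 Yn big_cons -addrA.
set D := (\sum_(_ <- t) _ - _) => hD.
apply: (le_trans (ler_normD _ _)).
have h1 := ler_norm (last y t); have h2 := ler_norm (- y); rewrite normrN in h2.
move: y1 y2 hD M0 MK h1 h2; move: (M * K) M (last y t) `|last y t| `|D| `|y| => m M' l nl dd yy.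
lra.
Qed.

Lemma ReA_neg n z : z \in zerosX n -> (Repoly (monicA n)).[z] <= 0.
Proof.
move=> zX; have n0 : (0 < n)%N by case: n zX.
have [k /=] := mapP zX; rewrite mem_index_iota ltnS => kn ->.
have pn : 0 < (phi n)^-1 by rewrite invr_gt0 phi_gt0.
have [_ _ sortedx] := zerosP n.
have step := real_step n.
rewrite /roots_poly /zerosY gtn_eqF // !big_map in step.
have := @interlaced_sign R n (fun k => x k n / phi n) (fun k => x k n.+1 / phi n) _ _ _ _ step k kn.
rewrite hornerZ pmulr_rle0 ?invr_gt0 ?ltr0n//; apply.
  by move=> j jn; rewrite ler_pM2r // sortedx.
by move=> j jn; rewrite !ler_pM2r //; apply: (interlace (n := n.+1)).
Qed.

End Reduction.

(** * Admissible dilations and the theorem *)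

Section Scales.
Variables (R : realType) (phi L : nat -> R) (alpha beta alphas betas sigma : R).
Hypothesis phi_gt0 : forall n, (0 < n)%N -> 0 < phi n.
Hypothesis phi_incr : forall m n, (0 < m <= n)%N -> phi m <= phi n.
Hypothesis le_alpha_beta : alpha <= beta.
Hypothesis phi_cases :
     [/\ phi @ \oo --> +oo, alphas = minr 0 alpha & betas = maxr 0 beta] \/
     [/\ exists c, forall n, (0 < n)%N -> phi n = c,
         alphas = alpha & betas = beta].
Hypothesis sigma_ge0 : 0 <= sigma.
Hypothesis phi_rv : regularly_varying sigma phi L.

(** Otherwise phi [n / 2] / phi n would tend to 2 ^ (- sigma) < 1. *)
Lemma constant_scale c : (forall n, (0 < n)%N -> phi n = c) -> sigma = 0.
Proof.
move=> phic; have t01 : 0 < (2^-1 : R) <= 1 by rewrite invr_gt0 ltr0n /=; lra.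
have h1 := phi_truncn sigma_ge0 phi_rv t01.
have half0 : 0 < 2^-1 :> R by case/andP: t01.
have [N hN] := truncn_oo 1 half0.
have h2 : phi (truncn (n%:R * (2^-1 : R))) / phi n @[n --> \oo] --> (1 : R).
  have near1 n : (N.+1 <= n)%N -> phi (truncn (n%:R * (2^-1 : R))) / phi n = (fun=> 1) n.
    move=> Nn; have n0 : (0 < n)%N by exact: leq_trans Nn.
    have m0 : (0 < truncn (n%:R * (2^-1 : R)))%N := hN n (ltnW Nn).
    by rewrite (phic _ n0) (phic _ m0) divff // -(phic _ n0) gt_eqF // phi_gt0.
  exact: (cvgn_near near1 (cvg_cst (1 : R))).
have := cvg_unique (@Rhausdorff R) h1 h2.
have [->//|s0] := eqVneq sigma 0.
have sgt0 : 0 < sigma by rewrite lt0r s0.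
have : (2^-1 : R) `^ sigma < 1 `^ sigma by rewrite gt0_ltr_powR ?nnegrE ?invr_ge0//; lra.
by rewrite powR1 => + e; rewrite e ltxx.
Qed.

(** The dilations of [alpha, beta] that stay inside [alphas, betas]: all th in
    [0, 1] when [alphas, betas] is the hull of 0 and [alpha, beta], and th = 1 in
    any case. *)
Definition admissible (th : R) := 0 <= th <= 1 /\ (alphas = minr 0 alpha /\ betas = maxr 0 beta \/ th = 1).

Lemma le_alphas_betas : alphas <= betas.
Proof.
case: phi_cases => -[_ -> ->] //.
by rewrite ge_min le_max lexx.
Qed.

Lemma admissible_pow t : 0 <= t <= 1 -> admissible (t `^ sigma).
Proof.
move=> /andP[t0 t1]; split.
  rewrite powR_ge0 /=; have [->|t_n0] := eqVneq t 0.
    by rewrite /powR eqxx; case: (_ == _); rewrite ?ler01 ?lexx.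
  have one : 1 = 1 `^ sigma :> R by rewrite powR1.
  by rewrite [leRHS]one ge0_ler_powR ?nnegrE.
case: phi_cases => -[h ? ?]; first by left.
right; have [c hc] := h; by rewrite (constant_scale hc) powRr0.
Qed.

Lemma admissible_ratio m n : (0 < m <= n)%N -> admissible (phi m / phi n).
Proof.
move=> /[dup] mn /andP[m0 lemn]; have n0 : (0 < n)%N by exact: leq_trans lemn.
have pn := phi_gt0 n0; split.
  by rewrite divr_ge0 ?(ltW (phi_gt0 _))//= ler_pdivrMr // mul1r phi_incr.
case: phi_cases => -[h ? ?]; first by left.
by right; have [c hc] := h; rewrite (hc m) // -(hc n) // divff // gt_eqF.
Qed.

Lemma admissible_clear z : ~ real_segment alphas betas z ->
  exists2 d : R, 0 < d & forall th, admissible th -> clear alpha beta z th d.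
Proof.
move=> zN; have [d d0 aw] := away_enlarge le_alphas_betas zN.
exists d => // th [/andP[th0 th1] adm] y /andP[y1 y2]; apply: (away_box d0 aw).
case: adm => [[-> ->]|->]; last first.
  rewrite mul1r; case: phi_cases => -[_ -> ->]; last by rewrite y1.
  by rewrite ge_min le_max y1 y2 !orbT.
rewrite ge_min le_max; have [y0|y0] := leP 0 y.
  by rewrite mulr_ge0 //= (le_trans _ y2) ?orbT// -[leRHS]mul1r ler_wpM2r.
have -> : th * y <= 0 by rewrite mulr_ge0_le0 // ltW.
have -> : alpha <= th * y by apply: (le_trans y1); rewrite -[leLHS]mul1r ler_wnM2r // ltW.
by rewrite orbT.
Qed.

End Scales.

Theorem theorem3 (R : realType)
  (P A B : nat -> {poly R[i]}) (a b : {poly R[i]})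
  (x : nat -> nat -> R) (phi L : nat -> R)
  (alpha beta alphas betas sigma : R)
  (P0 : P 0%N = 1)
  (sizeA : forall n, (size (A n) <= 3)%N)
  (sizeB : forall n, (size (B n) <= 2)%N)
  (recP : forall n, P n.+1 = A n * (P n)^`() + B n * P n)
  (zerosP : forall n, ordered_real_zeros n (P n) (fun k => x k n))
  (interlace : forall n k, (2 <= n)%N -> (1 <= k <= n.-1)%N ->
     x k n <= x k n.-1 <= x k.+1 n)
  (phi_gt0 : forall n, (0 < n)%N -> 0 < phi n)
  (phi_incr : forall m n, (0 < m <= n)%N -> phi m <= phi n)
  (le_alpha_beta : alpha <= beta)
  (zeros_bounded : forall n k, (1 <= k <= n)%N ->
     alpha <= x k n / phi n <= beta)
  (phi_cases :
     [/\ phi @ \oo --> +oo, alphas = minr 0 alpha & betas = maxr 0 beta] \/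
     [/\ exists c, forall n, (0 < n)%N -> phi n = c,
         alphas = alpha & betas = beta])
  (sigma_ge0 : 0 <= sigma)
  (phi_rv : regularly_varying sigma phi L)
  (size_a : (size a <= 3)%N) (size_b : (size b <= 2)%N)
  (limA : forall z : R[i],
     ((n%:R / phi n ^+ 2)%:C * (A n).[(phi n)%:C * z] : R[i]^o) @[n --> \oo]
       --> (a.[z] : R[i]^o))
  (limB : forall z : R[i],
     (((phi n)^-1)%:C * (B n).[(phi n)%:C * z] : R[i]^o) @[n --> \oo]
       --> (b.[z] : R[i]^o))
  (* a_2 + b_1 is the limit of the ratios of the leading coefficients of
     P n.+1 and P n; if it vanishes, then the denominator of the integrand
     vanishes identically and the integral equation is meaningless. *)
  (nondeg : a`_2 + b`_1 != 0)
  (Lambda : set nat) (f : R -> R[i]^o -> R[i]^o)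
  (Lambda_infinite : infinite_set Lambda)
  (limf : limit_along P phi (real_segment alphas betas) Lambda f) :
  [/\ (* independence of the subsequence *)
      forall (Lambda' : set nat) (f' : R -> R[i]^o -> R[i]^o),
        infinite_set Lambda' ->
        limit_along P phi (real_segment alphas betas) Lambda' f' ->
        forall t z, 0 <= t <= 1 -> ~ real_segment alphas betas z ->
          f' t z = f t z,
      (* the integrand is well defined *)
      forall t z, 0 < t <= 1 -> ~ real_segment alphas betas z ->
        derivable (denominator a b sigma f t) z 1 /\
        denominator a b sigma f t z != 0,
      (* integral equation *)
      forall s z, 0 <= s <= 1 -> ~ real_segment alphas betas z ->
        cintegrable `[0, s] (fun t => integrand a b sigma f t z) /\
        f s z = cintegral `[0, s] (fun t => integrand a b sigma f t z),
      forall z, ~ real_segment alphas betas z -> f 0 z = 0 &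
      forall s, 0 <= s <= 1 ->
        (z * f s z : R[i]^o) @[z --> cinfty_nbhs] --> (s%:C : R[i]^o)].
Proof.
have [C [boxC XC incrC]] := zeros_bound interlace phi_gt0 phi_incr zeros_bounded sigma_ge0 phi_rv.
pose X := zerosX x phi; pose Y := zerosY x phi.
have sX : forall n, size (X n) = n := size_zerosX x phi.
have sY : forall n, size (Y n) = n.+1 := size_zerosY x phi.
have stepR := real_step sizeA sizeB recP zerosP phi_gt0.
have cA i : (Repoly (monicA P A phi n))`_i @[n --> \oo] --> (Repoly (limitA a b))`_i.
  exact: (@ReA_cvg R P A B a b x phi sizeA sizeB recP zerosP phi_gt0 size_a size_b limA limB nondeg i).
have cB i : (Repoly (monicB P B phi n))`_i @[n --> \oo] --> (Repoly (limitB a b))`_i.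
  exact: (@ReB_cvg R P A B a b x phi sizeA sizeB recP zerosP phi_gt0 size_a size_b limA limB nondeg i).
have sRA n : (size (Repoly (monicA P A phi n)) <= 3)%N by apply/size_Repoly/size_monicA.
have sRB n : (size (Repoly (monicB P B phi n)) <= 2)%N by apply/size_Repoly/size_monicB.
have sla : (size (limitA a b) <= 3)%N := leq_trans (size_scale_leq _ _) size_a.
have slb : (size (limitB a b) <= 2)%N := leq_trans (size_scale_leq _ _) size_b.
have scal := scaling_zeros x phi_gt0.
have Aneg n z := @ReA_neg R P A B x phi sizeA sizeB recP zerosP interlace phi_gt0 n z.
have kar K := @karamata R phi L sigma phi_gt0 phi_incr sigma_ge0 phi_rv K.
have moments := moment_cvg sX sY sRA sRB (size_Repoly sla) stepR cA cB phi_gt0 scal XC Aneg incrC sigma_ge0 kar.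
have selfsim K := @increment_self_similar R X Y _ _ _ _ phi sigma C sX sY sRA sRB stepR cA cB phi_gt0 scal XC sigma_ge0 kar K.
have Xbox n y := @zerosX_box R x phi alpha beta zeros_bounded n y.
have Ybox d := @zerosY_box R x phi L alpha beta sigma phi_gt0 phi_incr zeros_bounded sigma_ge0 phi_rv d.
have XY := zeros_interlacing interlace phi_gt0.
have stepC := monic_step sizeA sizeB recP zerosP phi_gt0.
have cmA := monicA_cvg sizeA sizeB recP zerosP phi_gt0 size_a size_b limA limB nondeg.
have cmB := monicB_cvg sizeA sizeB recP zerosP phi_gt0 size_a size_b limA limB nondeg.
have P_roots n : (0 < n)%N -> exists2 c : R[i], c != 0 & P n = c *: roots_poly [seq (phi n * y)%:C | y <- X n].
  move=> n0; exists (lead_coef (P n)); first exact: (lc_neq0 zerosP).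
  have [_ {1}-> _] := zerosP n; congr (_ *: _).
  rewrite /roots_poly !big_map; apply: eq_bigr => k _.
  by rewrite mulrC divfK // gt_eqF // phi_gt0.
have le_seg := le_alphas_betas le_alpha_beta phi_cases.
have ok01 th : admissible alpha beta alphas betas th -> 0 <= th <= 1 by case.
have ok_pow t : 0 <= t <= 1 -> admissible alpha beta alphas betas (t `^ sigma).
  exact: (admissible_pow phi_gt0 phi_cases sigma_ge0 phi_rv).
have ok_clear z : ~ real_segment alphas betas z -> _ := @admissible_clear R phi alpha beta alphas betas le_alpha_beta phi_cases z.
have ok_ratio m n : (0 < m <= n)%N -> admissible alpha beta alphas betas (phi m / phi n).
  exact: (admissible_ratio phi_gt0 phi_incr phi_cases).
have trunc_cvg t : 0 < t <= 1 -> phi (truncn (n%:R * t)) / phi n @[n --> \oo] --> t `^ sigma.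
  exact: (@phi_truncn R phi L sigma sigma_ge0 phi_rv t).
have unique Lambda' f' : infinite_set Lambda' -> limit_along P phi (real_segment alphas betas) Lambda' f' ->
    forall t z, 0 <= t <= 1 -> ~ real_segment alphas betas z -> f' t z = transform X sigma t z.
  move=> infL lim' t z t01 zN; apply: (limit_along_unique infL lim' t01 zN).
  exact: (rescaled_log_deriv_cvg le_alpha_beta sX moments Xbox boxC sigma_ge0 ok_pow ok_clear P0 P_roots phi_gt0 trunc_cvg ok_ratio t01 zN).
have fE := unique _ _ Lambda_infinite limf.
have aE : a = (a`_2 + b`_1) *: limitA a b by rewrite /limitA scalerA divff // scale1r.
have bE : b = (a`_2 + b`_1) *: limitB a b by rewrite /limitB scalerA divff // scale1r.
(* a_2 + b_1 itself contains a and b, so aE and bE are used under the operators only *)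
have dE : denominator a b = denominator ((a`_2 + b`_1) *: limitA a b) ((a`_2 + b`_1) *: limitB a b).
  by rewrite -aE -bE.
have iE : integrand a b = integrand ((a`_2 + b`_1) *: limitA a b) ((a`_2 + b`_1) *: limitB a b).
  by rewrite -aE -bE.
split.
- by move=> Lambda' f' infL lim' t z t01 zN; rewrite (unique _ _ infL lim') // fE.
- move=> t z t01 zN; rewrite dE; split.
    have [h _] := cderiv_derive (denominator_deriv le_alpha_beta sX moments Xbox (limitA a b) (limitB a b)
      (a`_2 + b`_1) ok_pow le_seg ok_clear fE t01 zN).
    exact: h.
  have /eqP nz := (denominator_neq0 le_alpha_beta sX moments Xbox Ybox XY (size_monicA P A phi) (size_monicB P B phi)
    sla slb stepC cmA cmB nondeg ok_pow ok_clear fE t01 zN).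
  by apply/eqP => dz; apply: nz; exact: dz.
- move=> s z s01 zN; rewrite iE.
  exact: (transform_integral le_alpha_beta sX moments selfsim Xbox Ybox XY boxC (size_monicA P A phi)
    (size_monicB P B phi) sla slb stepC cmA cmB nondeg sigma_ge0 ok01 ok_pow le_seg ok_clear fE s01 zN).
- by move=> z zN; rewrite fE ?lexx ?ler01// transform0.
- move=> s s01.
  exact: (transform_infinity le_alpha_beta sX moments Xbox boxC ok01 ok_pow fE s01).
Qed.
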